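(* Let $n\ge2$, $K\ge1$, and let $f:\mathbb{H}^n\to\mathbb{H}^n$ be a $K$-quasiconformal homeomorphism (onto) fixing $e_n=(0,\dots,0,1)$. Suppose that $f(x)\to\infty$ as $x\to\infty$ in $\mathbb{H}^n$. Then $f$ extends to a homeomorphism $\tilde f:\overline{\mathbb{H}}^n\to\overline{\mathbb{H}}^n$ and, for every $R>0$, there exists a constant $C=C(R,K,n)>0$ (depending only on $R,K,n$) such that $$|f(x)-\tilde f(\xi)|\le C|x-\xi|^{\alpha}$$ whenever $\xi\in\partial\mathbb{H}^n$ with $|\xi|\le R$ and $x\in\mathbb{H}^n$ with $|x-\xi|\le1$. Here $\alpha=1/K^{1/(n-1)}$.
   Context: $\mathbb{H}^n=\{x\in\mathbb{R}^n:x_n>0\}$; $\overline{\mathbb{H}}^n$ is its closure in $\overline{\mathbb{R}}^n=\mathbb{R}^n\cup\{\infty\}$. For a curve family $\Gamma$ the conformal modulus is $\mathsf{M}(\Gamma)=\inf_\rho\int_{\mathbb{R}^n}\rho^n\,dm$ over Borel $\rho\ge0$ with $\int_\gamma\rho\,|dx|\ge1$ for every locally rectifiable $\gamma\in\Gamma$. A homeomorphism $f:G\to G'$ between domains in $\overline{\mathbb{R}}^n$ is $K$-quasiconformal if $K^{-1}\mathsf{M}(\Gamma)\le\mathsf{M}(f(\Gamma))\le K\,\mathsf{M}(\Gamma)$ for all curve families $\Gamma$ in $G$. *)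

(* Defs.v *)
From HB Require Import structures.
From mathcomp Require Import all_boot all_order all_algebra.
From mathcomp Require Import all_classical all_reals all_analysis.
From mathcomp Require Import measurable_realfun.

Set Implicit Arguments.
Unset Strict Implicit.
Unset Printing Implicit Defensive.

Import Order.TTheory GRing.Theory Num.Theory.
Import numFieldNormedType.Exports.

Local Open Scope classical_set_scope.
Local Open Scope ring_scope.

(* The points of R^n are the row vectors 'rV[R]_n.  The library's norm on them
   is the sup norm, hence the separate Euclidean norm [enorm]; both induce the
   library's (product) topology. *)

Definition enorm (R : realType) (n : nat) (x : 'rV[R]_n) : R :=
  Num.sqrt (\sum_(i < n) x ord0 i ^+ 2).

(* n-dimensional Lebesgue measure.  It is built on n.-tuple R as an iterated
   product of the one-dimensional one, then transported to the Borel
   sigma-algebra of 'rV[R]_n. *)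

Section lebesgue_measure_tuple.
Context {R : realType}.
Local Notation mR := (measurableTypeR R).

Definition cons_pair (n : nat) (z : mR * n.-tuple mR) : n.+1.-tuple mR :=
  [tuple of z.1 :: z.2].

Lemma measurable_cons_pair n :
  measurable_fun [set: mR * n.-tuple mR] (@cons_pair n).
Proof. exact: measurable_cons. Qed.

Section cons_measure.
Variables (n : nat) (m : {sigma_finite_measure set (n.-tuple mR) -> \bar R}).

Definition cons_measure : set (n.+1.-tuple mR) -> \bar R :=
  pushforward (lebesgue_measure \x m)%E (@cons_pair n).

Let cons_measure0 : cons_measure set0 = 0%E.
Proof. by rewrite /cons_measure /pushforward preimage_set0 measure0. Qed.

Let cons_measure_ge0 A : (0 <= cons_measure A)%E.
Proof. by rewrite /cons_measure /pushforward; exact: measure_ge0. Qed.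

Let cons_measure_sigma_additive : semi_sigma_additive cons_measure.
Proof.
exact: (@measure_semi_sigma_additive _ _ _
  (measure_function_pushforward__canonical__measure_function_Measure
    (lebesgue_measure \x m)%E (@measurable_cons_pair n))).
Qed.

HB.instance Definition _ := isMeasure.Build _ _ _ cons_measure
  cons_measure0 cons_measure_ge0 cons_measure_sigma_additive.

Let cons_measure_sigma_finite : sigma_finite setT cons_measure.
Proof.
have /sigma_finiteP[F [FT ndF Foo]] := sigma_finiteT (@lebesgue_measure R).
have /sigma_finiteP[G [GT ndG Goo]] := sigma_finiteT m.
pose H k (t : n.+1.-tuple mR) := F k (thead t) /\ G k [tuple of behead t].
have HE k : @cons_pair n @^-1` H k = F k `*` G k.
  apply/seteqP; split => -[x t] [/= Fx Gt]; split => //=.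
    by move: Gt; congr (G k _); apply: val_inj.
  by move: Gt; congr (G k _); apply: val_inj.
exists H => [|k].
  apply/esym/seteqP; split => // t _.
  have [i _ Fi] : (\bigcup_i F i) (thead t) by rewrite -FT.
  have [j _ Gj] : (\bigcup_i G i) [tuple of behead t] by rewrite -GT.
  exists (maxn i j) => //; split.
    by move: Fi; exact/subsetPset/ndF/leq_maxl.
  by move: Gj; exact/subsetPset/ndG/leq_maxr.
have [mF Fkoo] := Foo k; have [mG Gkoo] := Goo k; split.
  apply: measurableI.
    by rewrite -[X in measurable X]setTI; exact: measurable_tnth.
  by rewrite -[X in measurable X]setTI; exact: measurable_behead.
rewrite /cons_measure /pushforward HE product_measure1E//.
by rewrite lte_mul_pinfty// ge0_fin_numE.
Qed.

HB.instance Definition _ := Measure_isSigmaFinite.Build _ _ _ cons_measure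
  cons_measure_sigma_finite.

End cons_measure.

Fixpoint lebesgue_tuple (n : nat) :
    {sigma_finite_measure set (n.-tuple mR) -> \bar R} :=
  match n with
  | 0 => dirac ([tuple] : 0.-tuple mR)
  | n'.+1 => cons_measure (lebesgue_tuple n')
  end.

Lemma lebesgue_tuple_box n (A : 'I_n -> set mR) :
  (forall i, measurable (A i)) ->
  lebesgue_tuple n [set t | forall i, A i (tnth t i)] =
  (\prod_(i < n) lebesgue_measure (A i))%E.
Proof.
elim: n A => [|n IH] A mA.
  rewrite big_ord0 /= diracE (_ : _ \in _ = true) //.
  by apply/mem_set => -[].
rewrite big_ord_recl -IH //= /cons_measure /pushforward -product_measure1E //.
  congr (_ _); apply/seteqP; split => -[x t] /=.
    move=> H; split=> [|i]; first exact: (H ord0).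
    by have := H (lift ord0 i); rewrite tnthS.
  move=> [Hx Ht] i; case: (unliftP ord0 i) => [j ->|->]; last exact: Hx.
  rewrite tnthS; exact: Ht.
rewrite (_ : mkset _ = \bigcap_(i in [set: 'I_n])
    ((fun t : n.-tuple mR => tnth t i) @^-1` A (lift ord0 i))).
  apply: fin_bigcap_measurable => // i _.
  by rewrite -[X in measurable X]setTI; apply: measurable_tnth.
by apply/seteqP; split=> t /= H i => [_|]; exact: H.
Qed.

End lebesgue_measure_tuple.

Notation borel_rV R n := (g_sigma_algebraType (@open 'rV[R]_n)).

Definition row_of_tuple (R : realType) (n : nat)
    (t : n.-tuple (measurableTypeR R)) : borel_rV R n :=
  \row_i (tnth t i : R).

Lemma measurable_row_of_tuple (R : realType) (n : nat) :
  measurable_fun setT (@row_of_tuple R n).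
Proof.
apply: (@measurability _ _ _ (borel_rV R n) _ _ (@open 'rV[R]_n)) => //.
move=> _ [U oU <-]; rewrite setTI.
pose box (p : {ffun 'I_n -> rat} * nat) : set 'rV[R]_n :=
  [set x | forall i, ball (ratr (p.1 i) : R) p.2.+1%:R^-1 (x ord0 i)].
pose P p := box p `<=` U.
have -> : @row_of_tuple R n @^-1` U =
    \bigcup_p (if `[< P p >] then @row_of_tuple R n @^-1` box p else set0).
  apply/seteqP; split => [t Ut|t [p _]]; last first.
    by case: ifPn => // /asboolP Pp; exact: Pp.
  have /nbhs_ballP[e e0 eU] : nbhs (row_of_tuple t : 'rV[R]_n) U.
    exact: open_nbhs_nbhs.
  have [k ke] : exists k : nat, k.+1%:R^-1 + k.+1%:R^-1 < e.
    have e2 : 0 < e / 2 by rewrite divr_gt0.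
    exists (Num.truncn (e / 2)^-1); rewrite [ltRHS]splitr.
    have : (Num.truncn (e / 2)^-1).+1%:R^-1 < e / 2.
      by rewrite invf_plt ?posrE//; exact: truncnS_gt.
    by move=> h; exact: ltrD.
  have k0 : 0 < k.+1%:R^-1 :> R by rewrite invr_gt0.
  have qP i : {q : rat | ball (tnth t i : R) k.+1%:R^-1 (ratr q)}.
    apply: cid.
    have [|r [rb [q _ qr]]] := @dense_rat R (ball (tnth t i : R) k.+1%:R^-1) _
        (ball_open _ _).
      by exists (tnth t i : R); exact: ballxx.
    by exists q; rewrite qr.
  exists ([ffun i => sval (qP i)], k) => //.
  rewrite asboolT.
    move=> i /=; rewrite /row_of_tuple ffunE mxE.
    by apply: ball_sym; exact: (svalP (qP i)).
  move=> y /= yb; apply: eU; split => // i j.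
  rewrite /row_of_tuple ord1 mxE.
  apply: (le_ball (ltW ke)); apply: ball_triangle (svalP (qP j)) _.
  by have := yb j; rewrite ffunE.
apply: countable_bigcupT_measurable => [|p]; first exact: countableP.
case: ifPn => _; last exact: measurable0.
rewrite (_ : _ @^-1` _ = \bigcap_(i in [set: 'I_n])
  ((fun t : n.-tuple (measurableTypeR R) => tnth t i) @^-1`
     ball (ratr (p.1 i) : R) p.2.+1%:R^-1)).
  apply: fin_bigcap_measurable => // i _.
  rewrite -[X in measurable X]setTI; apply: measurable_tnth => //.
  exact: measurable_ball.
apply/seteqP; split => [t /= tb i _ /=|t tb i].
  by have := tb i; rewrite /row_of_tuple mxE.
by rewrite /row_of_tuple mxE; exact: tb.
Qed.


Definition lebesgue_rV (R : realType) (n : nat) : set (borel_rV R n) -> \bar R :=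
  pushforward (lebesgue_tuple n) (@row_of_tuple R n).

Section lebesgue_rV_measure.
Variables (R : realType) (n : nat).

Let lebesgue_rV0 : @lebesgue_rV R n set0 = 0%E.
Proof. by rewrite /lebesgue_rV /pushforward preimage_set0 measure0. Qed.

Let lebesgue_rV_ge0 A : (0 <= @lebesgue_rV R n A)%E.
Proof. by rewrite /lebesgue_rV /pushforward; exact: measure_ge0. Qed.

Let lebesgue_rV_sigma_additive : semi_sigma_additive (@lebesgue_rV R n).
Proof.
exact: (@measure_semi_sigma_additive _ _ _
  (measure_function_pushforward__canonical__measure_function_Measure
    (lebesgue_tuple n) (@measurable_row_of_tuple R n))).
Qed.

HB.instance Definition _ := isMeasure.Build _ _ _ (@lebesgue_rV R n)
  lebesgue_rV0 lebesgue_rV_ge0 lebesgue_rV_sigma_additive.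

End lebesgue_rV_measure.

(* A curve is a continuous map on an arbitrary (open, closed, half-open,
   bounded or not) nonempty interval; the values of [curve_fun] outside
   [curve_dom] are irrelevant. *)
Record curve (R : realType) (n : nat) := Curve {
  curve_dom : interval R ;
  curve_fun :> R -> 'rV[R]_n }.

Definition is_curve_in (R : realType) (n : nat) (G : set 'rV[R]_n)
    (c : curve R n) : Prop :=
  [/\ [set` curve_dom c] !=set0,
      {within [set` curve_dom c], continuous c} &
      forall t, t \in curve_dom c -> G (c t)].

Definition curve_image (R : realType) (n : nat) (f : 'rV[R]_n -> 'rV[R]_n)
    (c : curve R n) : curve R n :=
  Curve (curve_dom c) (f \o c).

Definition path_length (R : realType) (n : nat) (g : R -> 'rV[R]_n) (a b : R) :
    \bar R :=
  ereal_sup [set (\sum_(0 <= k < size s)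
      enorm (g (nth b (a :: s) k.+1) - g (nth b (a :: s) k)))%:E
    | s in itv_partition a b].

Definition subarcs (R : realType) (n : nat) (c : curve R n) : set (R * R) :=
  [set p | [/\ p.1 \in curve_dom c, p.2 \in curve_dom c & p.1 <= p.2]].

Definition locally_rectifiable (R : realType) (n : nat) (c : curve R n) : Prop :=
  forall p, subarcs c p -> (path_length c p.1 p.2 < +oo)%E.

(* For a continuous g rectifiable on [a, b], all the parameters t of [a, b]
   with path_length g a t = s have the same image g t, so that the choice made
   by [xget] is immaterial for 0 <= s <= path_length g a b. *)
Definition arclength_param (R : realType) (n : nat) (g : R -> 'rV[R]_n)
    (a b : R) (s : R) : 'rV[R]_n :=
  g (xget a [set t | a <= t <= b /\ path_length g a t = s%:E]).

Definition arc_integral (R : realType) (n : nat) (rho : 'rV[R]_n -> \bar R)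
    (g : R -> 'rV[R]_n) (a b : R) : \bar R :=
  (\int[lebesgue_measure]_(s in `[0%R, fine (path_length g a b)])
     rho (arclength_param g a b s))%E.

(* The closed subarcs exhaust the curve; this is how the line integral along a
   locally rectifiable, not necessarily closed, curve is defined. *)
Definition line_integral (R : realType) (n : nat) (rho : 'rV[R]_n -> \bar R)
    (c : curve R n) : \bar R :=
  ereal_sup [set arc_integral rho c p.1 p.2 | p in subarcs c].

Definition admissible (R : realType) (n : nat) (Gamma : set (curve R n)) :
    set ('rV[R]_n -> \bar R) :=
  [set rho | [/\ measurable_fun [set: borel_rV R n] rho,
                 forall x, (0 <= rho x)%E &
                 forall c, Gamma c -> locally_rectifiable c ->
                   (1 <= line_integral rho c)%E]].

Definition modulus (R : realType) (n : nat) (Gamma : set (curve R n)) : \bar R :=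
  ereal_inf [set (\int[@lebesgue_rV R n]_x (rho x ^+ n))%E
            | rho in admissible Gamma].

Definition is_domain (T : topologicalType) (G : set T) : Prop :=
  [/\ G !=set0, open G & connected G].

Definition homeomorphism_on (T U : topologicalType) (A : set T) (B : set U)
    (f : T -> U) : Prop :=
  [/\ set_bij A B f, {within A, continuous f} &
      exists g : U -> T, {within B, continuous g} /\
        forall x, A x -> g (f x) = x].

Definition quasiconformal (R : realType) (n : nat) (K : R)
    (G G' : set 'rV[R]_n) (f : 'rV[R]_n -> 'rV[R]_n) : Prop :=
  [/\ is_domain G, is_domain G', homeomorphism_on G G' f &
      forall Gamma : set (curve R n), Gamma `<=` is_curve_in G ->
        (K^-1%:E * modulus Gamma <= modulus (curve_image f @` Gamma)
         <= K%:E * modulus Gamma)%E].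

(* The last coordinate of 'rV[R]_n is the one of index n.-1; it is written this
   way to keep the dimension n a variable (for n = 0 there is none). *)
Definition half_space (R : realType) (n : nat) : set 'rV[R]_n :=
  [set x | forall i : 'I_n, i = n.-1 :> nat -> 0 < x ord0 i].
Arguments half_space : clear implicits.

Definition e_last (R : realType) (n : nat) : 'rV[R]_n :=
  \row_(i < n) (i == n.-1 :> nat)%:R.
Arguments e_last : clear implicits.

Definition closed_half_space (R : realType) (n : nat) :
    set (one_point_compactification 'rV[R]_n) :=
  closure ((Some : 'rV[R]_n -> one_point_compactification 'rV[R]_n) @`
           half_space R n).
Arguments closed_half_space : clear implicits.

Definition boundary (T : topologicalType) (A : set T) : set T :=
  closure A `\` interior A.

Definition tends_to_infty (R : realType) (n : nat) (G : set 'rV[R]_n)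
    (f : 'rV[R]_n -> 'rV[R]_n) : Prop :=
  forall M : R, exists N : R, forall x, G x -> N <= enorm x -> M <= enorm (f x).

Definition homeomorphic_extension (R : realType) (n : nat)
    (f : 'rV[R]_n -> 'rV[R]_n)
    (ft : one_point_compactification 'rV[R]_n ->
          one_point_compactification 'rV[R]_n) : Prop :=
  homeomorphism_on (closed_half_space R n) (closed_half_space R n) ft /\
  forall x, half_space R n x -> ft (Some x) = Some (f x).

(* Main.v *)
(* The sharp exponent comes from comparing two half-annuli centred at [xi] and at
   [f xi].  The curves crossing an annulus of logarithmic width N inside the
   half-space have modulus c0 N^(1-n), up to replacing N by N + 1: the upper bound
   is given by rho = 1/(N |x - xi|), the lower one by the radial segments.
   K-quasiconformality then gives alpha N <= N' + 1, whence the Hoelder estimate, once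
   f is known to be quasisymmetric at the boundary up to constants.  Quasisymmetry
   (and the existence of boundary limits) follows by playing the upper annulus bound
   against a Loewner-type estimate: if two sets both meet all sup-norm spheres of
   comparable radii, then curves joining them have modulus bounded below.  To see
   this, on a coordinate hyperplane slice of small energy the exponent n exceeds the
   dimension n - 1, so by a Morrey estimate any two points of the slice are joined by
   a rho-short path; good slices in different directions intersect.  The constants
   depend only on R, K, n because f fixes e_n. *)

From HB Require Import structures.
Require Import Defs.
From mathcomp Require Import all_boot all_order all_algebra.
From mathcomp Require Import all_classical all_reals all_analysis.
From mathcomp Require Import measurable_realfun ring lra.
Import Order.TTheory GRing.Theory Num.Theory.
Import numFieldNormedType.Exports.
Set Implicit Arguments.
Unset Strict Implicit.
Unset Printing Implicit Defensive.
Local Open Scope classical_set_scope.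
Local Open Scope ring_scope.

(** * Lebesgue measure on row vectors *)

(** Only the annulus bounds have to be sharp. Both are written with one constant c0, the mass of
    |x|^-n over the unit half-shell 1 <= |x| < e. It cancels when K-quasiconformality compares the
    two bounds, and its value is never computed. Shells of integer logarithmic width are tiled by
    dilates of the unit one, so dilation invariance does the work of polar coordinates, and rounding
    the widths costs only constant factors. The Loewner estimate may lose any constant. It uses
    sup-norm spheres because a point at sup-distance t from y has some coordinate equal to y_j + t
    or y_j - t: it lies on one of 2n hyperplanes, and a single t can be chosen for which all of them
    carry small energy. Each use of it has the same pattern: two connected sets separated by a wide
    half-annulus have images that both meet a full range of spheres about one point. The behaviour
    of f at infinity supplies the far points needed for this; the same behaviour of the inverse says
    that f stays bounded near finite boundary points. *)

Section Boxes.
Variable R : realType.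
Notation mR := (measurableTypeR R).
Implicit Types n : nat.

Definition box n (a b : 'I_n -> R) : set 'rV[R]_n :=
  [set x | forall i, a i < x ord0 i < b i].

Lemma open_countable_box n (U : set 'rV[R]_n) : open U ->
  exists (D : set ({ffun 'I_n -> rat} * nat)),
    U = \bigcup_(p in D) box (fun i => ratr (p.1 i) - p.2.+1%:R^-1)
                             (fun i => ratr (p.1 i) + p.2.+1%:R^-1).
Proof.
move=> oU; pose B (p : {ffun 'I_n -> rat} * nat) : set 'rV[R]_n :=
   box (fun i => ratr (p.1 i) - p.2.+1%:R^-1) (fun i => ratr (p.1 i) + p.2.+1%:R^-1).
exists [set p | B p `<=` U]; apply/seteqP; split=> [x Ux|x [p Up Bx]]; last exact: Up.
have /nbhs_ballP[e /= e0 eU] : nbhs x U by exact: open_nbhs_nbhs.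
have [k ke] : exists k : nat, k.+1%:R^-1 + k.+1%:R^-1 < e.
  have e2 : 0 < e / 2 by rewrite divr_gt0.
  exists (Num.truncn (e / 2)^-1); rewrite [ltRHS]splitr.
  have : (Num.truncn (e / 2)^-1).+1%:R^-1 < e / 2.
    by rewrite invf_plt ?posrE//; exact: truncnS_gt.
  by move=> h; exact: ltrD.
have k0 : 0 < k.+1%:R^-1 :> R by rewrite invr_gt0.
have [d dE] : exists d : R, d = k.+1%:R^-1 by eexists.
rewrite -dE in k0 ke.
have qP i : {q : rat | x ord0 i - d < ratr q < x ord0 i + d}.
  apply: cid.
  have [|q] := @rat_in_itvoo R (x ord0 i - d) (x ord0 i + d).
    by lra.
  by rewrite in_itv /= => h; exists q.
exists ([ffun i => sval (qP i)], k).
  move=> y By; apply: eU; split=> // i j; rewrite ord1.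
  have := By j; have := svalP (qP j); rewrite /= ffunE -?dE => /andP[h1 h2] /andP[h3 h4].
  by rewrite /ball /= ltr_distlC; lra.
move=> i; have /andP[h1 h2] := svalP (qP i); rewrite /= ffunE -?dE.
by apply/andP; split; lra.
Qed.

Lemma box_open n (a b : 'I_n -> R) : open (box a b).
Proof.
rewrite openE => x xab.
apply: (@filter_forall _ _ (fun i => [set y : 'rV[R]_n | a i < y ord0 i < b i]) (nbhs x)) => i.
have ab : nbhs (x ord0 i) `]a i, b i[%classic.
  by apply: open_nbhs_nbhs; split; [exact: itv_open|rewrite /= in_itv /=; exact: xab].
apply: (@filterS _ _ (nbhs_filter x) _ _ _ (@coord_continuous R 1 n ord0 i x _ ab)) => y.
by rewrite /= in_itv.
Qed.

Lemma continuous_measurable_rVR n (f : 'rV[R]_n -> R) : continuous f ->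
  measurable_fun [set: borel_rV R n] (f : borel_rV R n -> mR).
Proof.
move=> cf; apply: (@measurability _ _ _ mR _ _ _ (RGenOpens.measurableE R)) => //.
move=> _ [_ [a [b ->]] <-]; rewrite setTI; apply: sub_sigma_algebra.
by move/continuousP: cf; apply; exact: itv_open.
Qed.

Lemma measurable_coord n (i : 'I_n) :
  measurable_fun [set: borel_rV R n] (fun x : borel_rV R n => (x ord0 i : mR)).
Proof. by apply: continuous_measurable_rVR; exact: coord_continuous. Qed.

Lemma box_measurable n (a b : 'I_n -> R) : measurable (box a b : set (borel_rV R n)).
Proof. by apply: sub_sigma_algebra; exact: box_open. Qed.

Definition boxes n : set (set 'rV[R]_n) := [set A | exists a b, A = box a b].

Lemma borel_boxes n : @measurable _ (borel_rV R n) = <<s @boxes n >>.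
Proof.
apply/seteqP; split.
  apply: smallest_sub; first exact: smallest_sigma_algebra.
  move=> U /open_countable_box [D ->].
  pose T := g_sigma_algebraType (@boxes n).
  rewrite (_ : \bigcup_(p in D) _ = \bigcup_p (if `[< D p >] then
     box (fun i => ratr (p.1 i) - p.2.+1%:R^-1) (fun i => ratr (p.1 i) + p.2.+1%:R^-1)
     else set0)).
    apply: (@countable_bigcupT_measurable _ T) => [|p]; first exact: countableP.
    case: ifPn => _; last exact: (@measurable0 _ T).
    by apply: sub_sigma_algebra; eexists; eexists.
  apply/seteqP; split => [x [p Dp Bx]|x [p _]].
    by exists p => //; rewrite asboolT.
  by case: ifPn => // /asboolP Dp Bx; exists p.
apply: smallest_sub; first exact: smallest_sigma_algebra.
by move=> _ [a [b ->]]; exact: box_measurable.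
Qed.

Lemma measurable_rV d (T : measurableType d) n (f : T -> 'rV[R]_n) :
  (forall i, measurable_fun [set: T] (fun t => f t ord0 i : mR)) ->
  measurable_fun [set: T] (f : T -> borel_rV R n).
Proof.
move=> mf; apply: (@measurability _ _ T (borel_rV R n) setT f _ (@borel_boxes n)) => //.
move=> _ [_ [a [b ->]] <-]; rewrite setTI.
rewrite (_ : f @^-1` _ = \bigcap_(i in [set: 'I_n])
    ((fun t => f t ord0 i) @^-1` `]a i, b i[%classic)).
  apply: fin_bigcap_measurable => // i _.
  by rewrite -[X in measurable X]setTI; apply: mf.
by apply/seteqP; split => x h i => [_|]; have := h i; rewrite /= in_itv /= //; exact.
Qed.

Lemma prod_itv_lty n (a b : 'I_n -> R) :
  (\prod_(i < n) lebesgue_measure `]a i, b i[%classic < +oo)%E.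
Proof.
rewrite ltey_eq; apply/orP; left.
apply: (big_ind (fun x : \bar R => x \is a fin_num)) => //; first exact: fin_numM.
by move=> i _; rewrite lebesgue_measure_itv /=; case: ifP.
Qed.

Lemma lebesgue_rV_box n (a b : 'I_n -> R) :
  lebesgue_rV (box a b : set (borel_rV R n)) =
  (\prod_(i < n) lebesgue_measure `]a i, b i[%classic)%E.
Proof.
rewrite -lebesgue_tuple_box; last by move=> i; exact: measurable_itv.
congr (lebesgue_tuple n _); apply/seteqP; split => t h i; have := h i;
  by rewrite /= in_itv /= mxE.
Qed.

(** Boxes are stable under intersection, generate the Borel sets and exhaust the space by sets of
    finite measure. Every change of variables for row vectors below is therefore checked on boxes
    only. *)
Lemma rV_measure_unique n (mu : {measure set (borel_rV R n) -> \bar R}) :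
  (forall a b : 'I_n -> R, mu (box a b) =
    (\prod_(i < n) lebesgue_measure `]a i, b i[%classic)%E) ->
  forall A, measurable A -> mu A = lebesgue_rV A.
Proof.
move=> H A mA.
pose g k := box (fun _ : 'I_n => - k%:R) (fun _ : 'I_n => k%:R).
apply: (@measure_unique _ R (borel_rV R n) (@boxes n) g) => //.
- exact: borel_boxes.
- move=> _ _ [a [b ->]] [c [d ->]].
  exists (fun i => Num.max (a i) (c i)), (fun i => Num.min (b i) (d i)).
  apply/seteqP; split => [x [h1 h2] i|x h].
    by have := h1 i; have := h2 i; rewrite gt_max lt_min => /andP[-> ->] /andP[-> ->].
  by split => i; have := h i; rewrite gt_max lt_min => /andP[/andP[h1 h2] /andP[h3 h4]];
    rewrite ?h1 ?h2 ?h3 ?h4.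
- by move=> i; eexists; eexists.
- apply/seteqP; split => // x _.
  exists (Num.truncn (\sum_i `|x ord0 i|)).+1 => // i.
  rewrite -ltr_norml; apply: le_lt_trans (truncnS_gt _).
  by rewrite (bigD1 i) //= lerDl sumr_ge0.
- by move=> _ [a [b ->]]; rewrite H; exact/esym/lebesgue_rV_box.
- move=> k; rewrite H; exact: prod_itv_lty.
Qed.

Lemma lebesgue_rV_sigma_finite n : sigma_finite setT (@lebesgue_rV R n).
Proof.
exists (fun k => box (fun _ : 'I_n => - k%:R) (fun _ : 'I_n => k%:R)) => [|k].
  apply/esym/seteqP; split => // x _.
  exists (Num.truncn (\sum_i `|x ord0 i|)).+1 => // i.
  rewrite -ltr_norml; apply: le_lt_trans (truncnS_gt _).
  by rewrite (bigD1 i) //= lerDl sumr_ge0.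
split; first exact: box_measurable.
have -> := @lebesgue_rV_box n (fun=> - k%:R) (fun=> k%:R).
exact: prod_itv_lty.
Qed.

HB.instance Definition _ n := Measure_isSigmaFinite.Build _ _ _ (@lebesgue_rV R n)
  (@lebesgue_rV_sigma_finite n).

Section transfer.
Context d (X : measurableType d) (mu : {measure set X -> \bar R}) (k : {nonneg R}).

(** The image of [mu] under [phi], multiplied by [k], agrees with Lebesgue measure on boxes, hence
    everywhere. With a dilation as [phi] this is the affine substitution; with [insert_coord] it is
    Tonelli along an arbitrary coordinate. *)
Lemma integral_rV_transfer n (phi : X -> borel_rV R n) (h : borel_rV R n -> \bar R) :
  measurable_fun setT phi ->
  (forall a b : 'I_n -> R, (k%:num%:E * mu (phi @^-1` box a b) =
    \prod_(i < n) lebesgue_measure `]a i, b i[%classic)%E) ->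
  measurable_fun setT h -> (forall x, (0 <= h x)%E) ->
  (\int[@lebesgue_rV R n]_x h x = k%:num%:E * \int[mu]_x h (phi x))%E.
Proof.
move=> mphi H mh h0.
pose nu := measure_function_pushforward__canonical__measure_function_Measure mu mphi.
transitivity (\int[mscale k nu]_x h x)%E.
  apply: eq_measure_integral => A mA _; apply/esym.
  exact: (@rV_measure_unique n (mscale k nu) H).
rewrite ge0_integral_mscale //; congr (_ * _)%E.
by rewrite (@ge0_integral_pushforward _ _ _ _ _ _ mphi) // preimage_setT.
Qed.

Lemma integral_R_transfer (phi : X -> mR) (h : mR -> \bar R) :
  measurable_fun setT phi ->
  (forall a b : R, (k%:num%:E * mu (phi @^-1` `]a, b]%classic) =
    lebesgue_measure `]a, b]%classic)%E) ->
  measurable_fun setT h -> (forall x, (0 <= h x)%E) ->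
  (\int[lebesgue_measure]_x h x = k%:num%:E * \int[mu]_x h (phi x))%E.
Proof.
move=> mphi H mh h0.
pose nu := measure_function_pushforward__canonical__measure_function_Measure mu mphi.
transitivity (\int[mscale k nu]_x h x)%E.
  apply: eq_measure_integral => A mA _.
  apply: (@lebesgue_measure_unique R (mscale k nu)) => //.
  by move=> _ [[a b] _ <-]; apply/esym/H.
rewrite ge0_integral_mscale //; congr (_ * _)%E.
by rewrite (@ge0_integral_pushforward _ _ _ _ _ _ mphi) // preimage_setT.
Qed.

End transfer.

Lemma integral_rV_affine n (p : 'rV[R]_n) (s : R) (h : borel_rV R n -> \bar R) :
  0 < s -> measurable_fun setT h -> (forall x, (0 <= h x)%E) ->
  (\int[@lebesgue_rV R n]_x h x =
   (s ^+ n)%:E * \int[@lebesgue_rV R n]_x h (p + s *: x)%R)%E.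
Proof.
move=> s0 mh h0; have sn0 : 0 <= s ^+ n by rewrite exprn_ge0 // ltW.
rewrite (@integral_rV_transfer _ _ (@lebesgue_rV R n) (NngNum sn0) n (fun x => p + s *: x) h) //.
  apply: measurable_rV => i; under eq_fun do rewrite !mxE.
  apply: measurable_funD => //; apply: measurable_funM => //.
  exact: measurable_coord.
move=> a b /=.
rewrite (_ : _ @^-1` _ = box (fun i => (a i - p ord0 i) / s) (fun i => (b i - p ord0 i) / s)); last first.
  by apply/seteqP; split => x /= h1 i; have := h1 i; rewrite !mxE ltr_pdivrMr // ltr_pdivlMr // ltrBlDl ltrBrDl [x _ _ * s]mulrC.
rewrite lebesgue_rV_box.
have -> : (s ^+ n)%:E = (\prod_(i < n) s%:E)%E.
  by rewrite big_const_ord; elim: (n) => //= k <-; rewrite exprS EFinM.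
rewrite -big_split /=.
apply: eq_bigr => i _; rewrite !lebesgue_measure_itv /= !lte_fin.
rewrite ltr_pM2r ?invr_gt0 // ltrD2r; case: ifP => _; last by rewrite mule0.
by rewrite -!EFinB -EFinM; congr EFin; field; rewrite gt_eqF.
Qed.

Lemma integral_R_affine (p s : R) (h : mR -> \bar R) :
  s != 0 -> measurable_fun setT h -> (forall x, (0 <= h x)%E) ->
  (\int[lebesgue_measure]_x h x =
   `|s|%:E * \int[lebesgue_measure]_x h (p + s * x)%R)%E.
Proof.
move=> s0 mh h0; have sn0 : 0 <= `|s| by [].
rewrite (@integral_R_transfer _ _ lebesgue_measure (NngNum sn0) (fun x => p + s * x) h) //.
  by apply: measurable_funD => //; apply: measurable_funM.
move=> a b /=.
have [sp|sn|//] := ltrgtP 0 s; last by move=> e; rewrite e eqxx in s0.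
  rewrite (_ : _ @^-1` _ = `](a - p) / s, (b - p) / s]%classic); last first.
    by apply/seteqP; split => x /=; rewrite !in_itv /= ltr_pdivrMr // ler_pdivlMr // ltrBlDl lerBrDl [x * s]mulrC.
  rewrite !lebesgue_measure_itv /= !lte_fin gtr0_norm //.
  rewrite ltr_pM2r ?invr_gt0 // ltrD2r; case: ifP => _; last by rewrite mule0.
  by rewrite -!EFinB -EFinM; congr EFin; field.
rewrite (_ : _ @^-1` _ = `[(b - p) / s, (a - p) / s[%classic); last first.
  by apply/seteqP; split => x /=; rewrite !in_itv /= ltr_ndivlMr // ler_ndivrMr // ltrBlDl lerBrDl [x * s]mulrC andbC.
rewrite !lebesgue_measure_itv /= !lte_fin ltr0_norm //.
rewrite ltr_nM2r ?invr_lt0 // ltrD2r; case: ifP => _; last by rewrite mule0.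
by rewrite -!EFinB -EFinM; congr EFin; field.
Qed.

Definition insert_coord n (j : 'I_n.+1) (t : R) (x : 'rV[R]_n) : 'rV[R]_n.+1 :=
  \row_i (if unlift j i is Some k then x ord0 k else t).

Lemma insert_coord_self n (j : 'I_n.+1) t (x : 'rV[R]_n) : insert_coord j t x ord0 j = t.
Proof. by rewrite mxE unlift_none. Qed.

Lemma insert_coord_lift n (j : 'I_n.+1) t (x : 'rV[R]_n) k : insert_coord j t x ord0 (lift j k) = x ord0 k.
Proof. by rewrite mxE liftK. Qed.

Lemma measurable_insert_coord n (j : 'I_n.+1) : measurable_fun setT
  (fun z : mR * borel_rV R n => insert_coord j z.1 z.2 : borel_rV R n.+1).
Proof.
apply: measurable_rV => i; case: (unliftP j i) => [k ->|->].
  under eq_fun do rewrite insert_coord_lift.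
  by apply: measurableT_comp (@measurable_coord n k) _; exact: measurable_snd.
under eq_fun do rewrite insert_coord_self; exact: measurable_fst.
Qed.

Lemma integral_rV_slice n (j : 'I_n.+1) (h : borel_rV R n.+1 -> \bar R) :
  measurable_fun setT h -> (forall x, (0 <= h x)%E) ->
  (\int[@lebesgue_rV R n.+1]_x h x =
   \int[lebesgue_measure]_t \int[@lebesgue_rV R n]_x h (insert_coord j t x))%E.
Proof.
move=> mh h0.
rewrite (@integral_rV_transfer _ _ (lebesgue_measure \x @lebesgue_rV R n)%E 1%:nng _
  (fun z => insert_coord j z.1 z.2)) ?mul1e //; last 2 first.
- exact: measurable_insert_coord.
- move=> a b; rewrite mul1e.
  rewrite (_ : _ @^-1` _ = `]a j, b j[%classic `*`
      box (fun i => a (lift j i)) (fun i => b (lift j i))); last first.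
    apply/seteqP; split => -[t x] /=.
      move=> H; split; first by have := H j; rewrite insert_coord_self in_itv.
      by move=> i; have := H (lift j i); rewrite insert_coord_lift.
    move=> [H1 H2] i; case: (unliftP j i) => [k ->|->].
      by rewrite insert_coord_lift; exact: H2.
    by rewrite insert_coord_self; move: H1; rewrite in_itv.
  transitivity (lebesgue_measure (`]a j, b j[%classic : set mR) *
      lebesgue_rV (box (fun i => a (lift j i)) (fun i => b (lift j i)) : set (borel_rV R n)))%E.
    by apply: product_measure1E => //; exact: box_measurable.
  by rewrite (bigD1_ord j) //= lebesgue_rV_box.
rewrite (fubini_tonelli1 (fun z : mR * borel_rV R n => h (insert_coord j z.1 z.2))) //.
exact: (measurableT_comp mh (@measurable_insert_coord n j)).
Qed.

End Boxes.

(** * Euclidean length of paths *)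

Section EuclideanNorm.
Variables (R : realType) (n : nat).
Implicit Types x y z : 'rV[R]_n.

Let sq x : R := \sum_i x ord0 i ^+ 2.

Lemma enorm_ge0 x : 0 <= enorm x.
Proof. exact: sqrtr_ge0. Qed.

Let sq_ge0 x : 0 <= sq x.
Proof. by apply: sumr_ge0 => i _; exact: sqr_ge0. Qed.

Lemma sqr_enorm x : enorm x ^+ 2 = \sum_i x ord0 i ^+ 2.
Proof. by rewrite sqr_sqrtr //; exact: sq_ge0. Qed.

Lemma ler_coord_enorm x i : `|x ord0 i| <= enorm x.
Proof.
rewrite -(@ler_pXn2r _ 2) ?nnegrE ?enorm_ge0 // sqr_enorm (bigD1 i) //= real_normK ?num_real //.
by rewrite lerDl sumr_ge0 // => j _; exact: sqr_ge0.
Qed.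

Lemma enorm_eq0 x : (enorm x == 0) = (x == 0).
Proof.
apply/idP/eqP => [/eqP h|->]; last first.
  by rewrite /enorm big1 ?sqrtr0 // => i _; rewrite mxE expr0n.
apply/rowP => i; rewrite mxE; apply/eqP; rewrite -normr_le0 -h; exact: ler_coord_enorm.
Qed.

Lemma enorm0 : enorm (0 : 'rV[R]_n) = 0.
Proof. by apply/eqP; rewrite enorm_eq0. Qed.

Lemma enorm_gt0 x : (0 < enorm x) = (x != 0).
Proof. by rewrite lt_neqAle enorm_ge0 andbT eq_sym enorm_eq0. Qed.

Lemma enormZ a x : enorm (a *: x) = `|a| * enorm x.
Proof.
rewrite /enorm; under eq_bigr do rewrite mxE exprMn.
by rewrite -mulr_sumr sqrtrM ?sqr_ge0 // sqrtr_sqr.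
Qed.

Lemma enormN x : enorm (- x) = enorm x.
Proof. by rewrite -scaleN1r enormZ normrN normr1 mul1r. Qed.

Lemma enormB x y : enorm (x - y) = enorm (y - x).
Proof. by rewrite -enormN opprB. Qed.

(** Cauchy-Schwarz: with a = |x| and b = |y|, the sum of the squares of b x_i - a y_i equals 2ab(ab
    - x.y), so the last factor is nonnegative. *)
Lemma dot_le x y : \sum_i x ord0 i * y ord0 i <= enorm x * enorm y.
Proof.
have [->|x0] := eqVneq x 0.
  by rewrite enorm0 mul0r big1 // => i _; rewrite mxE mul0r.
have [->|y0] := eqVneq y 0.
  by rewrite enorm0 mulr0 big1 // => i _; rewrite mxE mulr0.
have A0 : 0 < enorm x by rewrite enorm_gt0.
have B0 : 0 < enorm y by rewrite enorm_gt0.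
have : 0 <= \sum_i (enorm y * x ord0 i - enorm x * y ord0 i) ^+ 2.
  by apply: sumr_ge0 => i _; exact: sqr_ge0.
rewrite (_ : \sum_i _ = enorm y ^+ 2 * (\sum_i x ord0 i ^+ 2)
    + enorm x ^+ 2 * (\sum_i y ord0 i ^+ 2)
    - 2 * enorm x * enorm y * (\sum_i x ord0 i * y ord0 i)); last first.
  rewrite !mulr_sumr -sumrN -!big_split /=; apply: eq_bigr => i _; ring.
rewrite -!sqr_enorm => h.
rewrite -(ler_pM2l (mulr_gt0 A0 B0)); move: h; set s := \sum_i _.
by move=> h; nra.
Qed.

Lemma ler_enormD x y : enorm (x + y) <= enorm x + enorm y.
Proof.
rewrite -(@ler_pXn2r _ 2) ?nnegrE ?addr_ge0 ?enorm_ge0 //.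
rewrite sqrrD !sqr_enorm.
rewrite (_ : \sum_i _ = \sum_i x ord0 i ^+ 2 + (\sum_i x ord0 i * y ord0 i) *+ 2
   + \sum_i y ord0 i ^+ 2); last first.
  rewrite -sumrMnl -!big_split /=; apply: eq_bigr => i _; rewrite mxE; ring.
by rewrite lerD2r lerD2l lerMn2r dot_le orbT.
Qed.

Lemma ler_enormB x y z : enorm (x - z) <= enorm (x - y) + enorm (y - z).
Proof. by apply: le_trans (ler_enormD _ _); rewrite addrA subrK. Qed.

Lemma ler_dist_enorm x y : `|enorm x - enorm y| <= enorm (x - y).
Proof.
rewrite ler_norml; apply/andP; split.
  rewrite lerNl opprB lerBlDl.
  by have := ler_enormD (y - x) x; rewrite subrK enormB addrC.
by rewrite lerBlDl; have := ler_enormD (x - y) y; rewrite subrK addrC.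
Qed.

Lemma enorm_le_sum x : enorm x <= \sum_i `|x ord0 i|.
Proof.
rewrite -(@ler_pXn2r _ 2) ?nnegrE ?enorm_ge0 ?sumr_ge0 // sqr_enorm expr2 mulr_suml.
apply: ler_sum => i _; rewrite -real_normK ?num_real // expr2 ler_wpM2l //.
by rewrite (bigD1 i) //= lerDl sumr_ge0.
Qed.

Lemma ler_coord_norm x i : `|x ord0 i| <= `|x|.
Proof. by rewrite /Num.norm /= mx_normrE; apply: (le_bigmax _ _ (ord0, i)). Qed.

Lemma norm_le_enorm x : `|x| <= enorm x.
Proof.
rewrite /Num.norm /= mx_normrE; apply: bigmax_le => [|[i j] _] /=; first exact: enorm_ge0.
by rewrite ord1; exact: ler_coord_enorm.
Qed.

Lemma enorm_le_norm x : enorm x <= n%:R * `|x|.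
Proof.
apply: le_trans (enorm_le_sum x) _.
rewrite -[X in X%:R * _](card_ord n) -sumr_const mulr_suml.
by apply: ler_sum => i _; rewrite mul1r; exact: ler_coord_norm.
Qed.

Lemma continuous_enorm : continuous (@enorm R n).
Proof.
move=> x; have F := nbhs_filter x; apply/cvgrPdist_lt => e e0.
have n0 : 0 < (n%:R + 1 : R) by rewrite ltr_wpDl.
have /cvgrPdist_lt/(_ _ (divr_gt0 e0 n0)) : id @ nbhs x --> (x : 'rV[R]_n).
  by exact: cvg_id.
apply: filterS => y h; apply: le_lt_trans (ler_dist_enorm _ _) _.
apply: le_lt_trans (enorm_le_norm _) _.
rewrite ltr_pdivlMr // in h; apply: le_lt_trans h; rewrite mulrC ler_wpM2l //; lra.
Qed.

Lemma enorm_lip_continuous (g : R -> 'rV[R]_n) :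
  (forall s t, enorm (g s - g t) <= `|s - t|) -> continuous g.
Proof.
move=> gl x; apply/cvgrPdist_lt => e e0.
have : \forall y \near x, `|x - y| < e by apply: nbhsx_ballx.
apply: filterS => y h; apply: le_lt_trans (norm_le_enorm _) _.
exact: le_lt_trans (gl _ _) h.
Qed.

Lemma continuous_enormP (T : pseudoMetricType R) (g : T -> 'rV[R]_n) t :
  {for t, continuous g} -> forall e, 0 < e ->
  \forall s \near t, enorm (g s - g t) < e.
Proof.
move=> gc e e0.
have n0 : 0 < (n%:R + 1 : R) by rewrite ltr_wpDl.
have /cvgrPdist_lt /(_ (e / (n%:R + 1))) : g x @[x --> t] --> g t := gc.
rewrite divr_gt0 // => /(_ isT); apply: filterS => y h.
rewrite enormB; apply: le_lt_trans (enorm_le_norm _) _.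
rewrite ltr_pdivlMr // in h; apply: le_lt_trans h; rewrite mulrC ler_wpM2l //; lra.
Qed.

End EuclideanNorm.


(** * Additivity and continuity of length, and the arclength parametrisation *)

Section PathLength.
Variables (R : realType) (n : nat).
Implicit Types (g : R -> 'rV[R]_n) (a b c : R).
Local Notation pl := (@path_length R n).

(** The partition sums of [path_length] in recursive form, suited to induction on the partition. *)
Fixpoint plen g a (s : seq R) : R :=
  if s is x :: s' then enorm (g x - g a) + plen g x s' else 0.

Lemma plen_sum g a b s : \sum_(0 <= k < size s)
   enorm (g (nth b (a :: s) k.+1) - g (nth b (a :: s) k)) = plen g a s.
Proof.
elim: s a => [|x s IH] a; first by rewrite big_nil.
by rewrite /= big_nat_recl //= IH.
Qed.

Lemma path_lengthE g a b : pl g a b = ereal_sup [set (plen g a s)%:E | s in itv_partition a b].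
Proof. by rewrite /path_length; under eq_fun do rewrite plen_sum. Qed.

Lemma plen_ge0 g a s : 0 <= plen g a s.
Proof. by elim: s a => //= x s IH a; rewrite addr_ge0 ?enorm_ge0. Qed.

Lemma plen_cat g a s t : plen g a (s ++ t) = plen g a s + plen g (last a s) t.
Proof. by elim: s a => [|x s IH] a /=; rewrite ?add0r // IH addrA. Qed.

Lemma partition_cons a b x s :
  itv_partition a b (x :: s) <-> a < x /\ itv_partition x b s.
Proof.
split=> [[/= /andP[ax ps] l]|[ax [ps l]]]; first by split.
by split => //=; rewrite ax.
Qed.

Lemma partition_le a b s : itv_partition a b s -> a <= b.
Proof.
elim: s a => [|x s IH] a; first by move=> /itv_partition_nil ->.
by move=> /partition_cons[ax /IH]; exact/le_trans/ltW.
Qed.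

Lemma partition_cat a b c s t : itv_partition a b s -> itv_partition b c t ->
  itv_partition a c (s ++ t).
Proof.
by move=> [ps /eqP ls] [pt lt]; split; rewrite ?cat_path ?last_cat ls ?ps.
Qed.

Lemma partition1 a b : a < b -> itv_partition a b [:: b].
Proof. by move=> ab; split; rewrite /= ?ab. Qed.

Lemma partitionxx a s : itv_partition a a s -> s = [::].
Proof.
by case: s => // x s /partition_cons[ax /partition_le xa]; move: ax; rewrite ltNge xa.
Qed.

Lemma plen_le_pl g a b s : itv_partition a b s -> ((plen g a s)%:E <= pl g a b)%E.
Proof. by move=> ps; rewrite path_lengthE; apply: ereal_sup_ubound; exists s. Qed.

Lemma pl_le g a b (M : \bar R) :
  (forall s, itv_partition a b s -> ((plen g a s)%:E <= M)%E) -> (pl g a b <= M)%E.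
Proof. by move=> H; rewrite path_lengthE; apply: ge_ereal_sup => _ [s ps <-]; exact: H. Qed.

Lemma pl_ge_dist g a b : a <= b -> ((enorm (g b - g a))%:E <= pl g a b)%E.
Proof.
rewrite le_eqVlt => /predU1P[<-|ab].
  by rewrite subrr enorm0; apply: (@plen_le_pl g a a [::]); split.
by have := plen_le_pl g (partition1 ab); rewrite /= addr0.
Qed.

Lemma pl_ge0 g a b : a <= b -> (0 <= pl g a b)%E.
Proof. by move=> ab; apply: le_trans (pl_ge_dist g ab); rewrite lee_fin enorm_ge0. Qed.

Lemma plxx g a : pl g a a = 0%E.
Proof.
apply/eqP; rewrite eq_le pl_ge0 // andbT; apply: pl_le => s /partitionxx -> /=.
exact: lexx.
Qed.

Lemma pl_lip g a b : a <= b ->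
  (forall u v : R, a <= u -> u <= v -> v <= b -> enorm (g v - g u) <= v - u) ->
  (pl g a b <= (b - a)%:E)%E.
Proof.
move=> ab H; apply: pl_le => s; rewrite lee_fin.
suff : forall x, a <= x -> itv_partition x b s -> plen g x s <= b - x by exact.
elim: s => [|y s IH] x ax /=; first by move/partition_le; rewrite subr_ge0.
move/partition_cons => [xy ys]; have yb := partition_le ys.
have := H x y ax (ltW xy) yb; have := IH y (le_trans ax (ltW xy)) ys; lra.
Qed.

Lemma pl_cat_le g a b c s : a <= b -> itv_partition b c s ->
  (pl g a b + (plen g b s)%:E <= pl g a c)%E.
Proof.
move=> ab ps; rewrite -leeBrDr //; apply: pl_le => t pt.
rewrite leeBrDr // -EFinD.
have := plen_le_pl g (partition_cat pt ps); rewrite plen_cat.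
by case: pt => _ /eqP ->.
Qed.

Lemma pl_mono g a b c : a <= b -> b <= c -> (pl g a b <= pl g a c)%E.
Proof.
move=> ab; rewrite le_eqVlt => /predU1P[-> //|bc].
apply: le_trans (pl_cat_le g ab (partition1 bc)).
by rewrite leeDl // lee_fin plen_ge0.
Qed.

Lemma pl_superadd g a b c : a <= b -> b <= c -> (pl g a b + pl g b c <= pl g a c)%E.
Proof.
move=> ab bc; case E : (pl g a b) => [r| |].
- rewrite addeC -leeBrDr //; apply: pl_le => s ps.
  by rewrite leeBrDr // addeC -E; exact: pl_cat_le.
- have := pl_mono g ab bc; rewrite E leye_eq => /eqP ->; exact: leey.
- by have := pl_ge0 g ab; rewrite E.
Qed.

(** Subadditivity of length: b is inserted into the partition at the cost of one triangle
    inequality. *)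
Lemma plen_insert g a b c s : a <= b -> b <= c -> itv_partition a c s ->
  ((plen g a s)%:E <= pl g a b + pl g b c)%E.
Proof.
elim: s a => [|x s IH] a ab bc.
  by move=> _; rewrite adde_ge0 // pl_ge0.
move/partition_cons => [ax xs] /=.
have [bx|xb] := leP b x.
  have h1 : (pl g a b + pl g b c >= (enorm (g b - g a))%:E + (enorm (g x - g b) + plen g x s)%:E)%E.
    apply: leeD; first exact: pl_ge_dist.
    move: bx; rewrite le_eqVlt => /predU1P[bx|bx].
      by rewrite bx subrr enorm0 add0r; exact: plen_le_pl.
    by apply: (@plen_le_pl g b c (x :: s)); apply/partition_cons.
  apply: le_trans h1; rewrite -EFinD lee_fin.
  by have := ler_enormB (g x) (g b) (g a); lra.
have := IH x (ltW xb) bc xs => h.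
rewrite EFinD; apply: le_trans (leeD2l _ h) _.
rewrite addeA; apply: leeD2r; apply: le_trans (pl_superadd g (ltW ax) (ltW xb)).
by apply: leeD2r; exact/pl_ge_dist/ltW.
Qed.

Lemma pl_add g a b c : a <= b -> b <= c -> (pl g a c = pl g a b + pl g b c)%E.
Proof.
move=> ab bc; apply/eqP; rewrite eq_le pl_superadd // andbT.
by apply: pl_le => s ps; exact: plen_insert.
Qed.

Section Continuous.
Variables (g : R -> 'rV[R]_n) (a b : R).
Hypotheses (ab : a <= b) (gc : continuous g) (gr : (pl g a b < +oo)%E).

Let cont t e : 0 < e -> exists2 d, 0 < d & forall s, `|t - s| < d -> enorm (g s - g t) < e.
Proof.
move=> e0; have /nbhs_ballP[d /= d0 H] := @continuous_enormP R n R g t (@gc t) e e0.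
by exists d.
Qed.

Let fin x y : a <= x -> x <= y -> y <= b -> pl g x y \is a fin_num.
Proof.
move=> ax xy yb; rewrite ge0_fin_numE ?pl_ge0 //; apply: le_lt_trans gr.
rewrite (pl_add _ ax (le_trans xy yb)) (pl_add _ xy yb).
by rewrite addeC -addeA leeDl // adde_ge0 // pl_ge0 // ltW.
Qed.

(** The last edge of a nearly optimal partition of [a, t0] is stopped at some t1 close to t0; by
    continuity of g this loses at most e/2, so length has no jump from the left. *)
Lemma pl_left_cont t0 e : a < t0 -> t0 <= b -> 0 < e ->
  exists t1, [/\ a <= t1, t1 < t0 & (pl g a t0 <= pl g a t1 + e%:E)%E].
Proof.
move=> at0 tb e0; have e2 : 0 < e / 2 by rewrite divr_gt0.
have f0 := fin (lexx a) (ltW at0) tb.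
have [_ [s ps <-]] : exists2 x, [set (plen g a s)%:E | s in itv_partition a t0] x &
    (pl g a t0 - (e / 2)%:E < x)%E.
  by move: f0; rewrite path_lengthE => f0; exact: ub_ereal_sup_adherent.
case/lastP: s ps => [|s x] ps.
  by move/itv_partition_nil: ps at0 => ->; rewrite ltxx.
case: (ps); rewrite last_rcons rcons_path => /andP[p1 p2] /eqP xt; rewrite xt in ps p2 *.
set p := last a s in p2.
have pp : itv_partition a p s by split.
have ap := partition_le pp.
have [d d0 H] := cont t0 e2.
pose t1 := Num.max ((p + t0) / 2) (t0 - d / 2).
have t1t : t1 < t0 by rewrite gt_max; apply/andP; split; lra.
have pt1 : p < t1 by rewrite lt_max; apply/orP; left; lra.
have td : enorm (g t1 - g t0) < e / 2.
  apply: H; rewrite gtr0_norm ?subr_gt0 //.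
  have : t0 - d / 2 <= t1 by rewrite le_max lexx orbT.
  lra.
rewrite -cats1 plen_cat /= addr0 -/p => h; exists t1; split => //.
  exact: le_trans (ltW pt1).
have h1 := plen_le_pl g (partition_cat pp (partition1 pt1)).
rewrite plen_cat /= addr0 -/p in h1.
have f1 := fin (lexx a) (le_trans ap (ltW pt1)) (le_trans (ltW t1t) tb).
move: h h1; rewrite -(fineK f0) -(fineK f1) -!EFinD lte_fin !lee_fin.
have := ler_enormB (g t0) (g t1) (g p); rewrite (enormB (g t0) (g t1)); lra.
Qed.

(** The same argument on the first edge of a nearly optimal partition of [t0, b]; additivity
    converts a small loss after t1 into a small length before it. *)
Lemma pl_right_cont t0 e : a <= t0 -> t0 < b -> 0 < e ->
  exists t1, [/\ t0 < t1, t1 <= b & (pl g a t1 <= pl g a t0 + e%:E)%E].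
Proof.
move=> at0 tb e0; have e2 : 0 < e / 2 by rewrite divr_gt0.
have f0 := fin at0 (ltW tb) (lexx b).
have [_ [s ps <-]] : exists2 x, [set (plen g t0 s)%:E | s in itv_partition t0 b] x &
    (pl g t0 b - (e / 2)%:E < x)%E.
  by move: f0; rewrite path_lengthE => f0; exact: ub_ereal_sup_adherent.
case: s ps => [|x s].
  by move/itv_partition_nil => E; move: tb; rewrite E ltxx.
move/partition_cons => [tx xs].
have [d d0 H] := cont t0 e2.
pose t1 := Num.min ((x + t0) / 2) (t0 + d / 2).
have t1t : t0 < t1 by rewrite lt_min; apply/andP; split; lra.
have t1x : t1 < x by rewrite gt_min; apply/orP; left; lra.
have td : enorm (g t1 - g t0) < e / 2.
  apply: H; rewrite distrC gtr0_norm ?subr_gt0 //.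
  have : t1 <= t0 + d / 2 by rewrite ge_min lexx orbT.
  lra.
have t1b := le_trans (ltW t1x) (partition_le xs).
move=> /= h; exists t1; split => //.
have h1 : ((enorm (g x - g t1) + plen g x s)%:E <= pl g t1 b)%E.
  by apply: (@plen_le_pl g t1 b (x :: s)); apply/partition_cons.
have f1 := fin (le_trans at0 (ltW t1t)) t1b (lexx b).
have f2 := fin at0 (ltW t1t) t1b.
rewrite (pl_add _ at0 (ltW t1t)); apply: leeD2l.
rewrite (pl_add _ (ltW t1t) t1b) in h.
move: h h1; rewrite -(fineK f1) -(fineK f2) -!EFinD lte_fin !lee_fin.
have := ler_enormB (g x) (g t1) (g t0); lra.
Qed.

(** This guarantees that the [xget] in [arclength_param] finds a parameter for every s up to the
    total length. The parameter is the supremum of those t whose length is at most s; one-sided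
    continuity excludes a jump there. *)
Lemma pl_ivt (s : R) : 0 <= s -> (s%:E <= pl g a b)%E ->
  exists t, [/\ a <= t, t <= b & pl g a t = s%:E].
Proof.
move=> s0 sl.
pose T := [set t | [/\ a <= t, t <= b & (pl g a t <= s%:E)%E]].
have Ta : T a by split => //; rewrite plxx lee_fin.
have hT : has_sup T by split; [exists a|exists b => t []].
pose t0 := sup T.
have at0 : a <= t0 by apply: ub_le_sup => //; case: hT.
have t0b : t0 <= b by apply: ge_sup => [|t []//]; exists a.
exists t0; split => //; apply/eqP; rewrite eq_le; apply/andP; split.
  apply/lee_addgt0Pr => e e0.
  move: at0; rewrite le_eqVlt => /predU1P[<-|at0].
    by rewrite plxx -EFinD lee_fin; lra.
  have [t1 [at1 t1t h]] := pl_left_cont at0 t0b e0.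
  have [t [at' tb ts] t1t'] : exists2 t, T t & t1 < t.
    by apply: sup_gt => //; exists a.
  apply: le_trans h _; apply: leeD2r; apply: le_trans ts.
  by apply: pl_mono => //; exact: ltW.
have [t0b'|] := ltP t0 b; last first.
  by move=> bt; rewrite (_ : t0 = b) //; apply/eqP; rewrite eq_le t0b.
rewrite leNgt; apply/negP => lt.
have f0 := fin (lexx a) at0 t0b.
pose e := s - fine (pl g a t0).
have e0 : 0 < e by rewrite subr_gt0 -lte_fin fineK.
have [t1 [t01 t1b h]] := pl_right_cont at0 t0b' e0.
have : t1 <= t0.
  apply: ub_le_sup; first by case: hT.
  split => //; first exact: le_trans (ltW t01).
  by apply: le_trans h _; rewrite -(fineK f0) -EFinD lee_fin /e; lra.
by rewrite leNgt t01.
Qed.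

(** Two parameters with the same length bound an arc of length zero, on which g has equal end
    values, so the choice made by [xget] drops out. *)
Lemma arclength_paramE (s t : R) : a <= t -> t <= b -> pl g a t = s%:E ->
  arclength_param g a b s = g t.
Proof.
move=> at' tb E; rewrite /arclength_param.
have : [set t | a <= t <= b /\ pl g a t = s%:E] (xget a [set t | a <= t <= b /\ pl g a t = s%:E]).
  by apply: xgetPex; exists t; rewrite /= at' tb.
set u := xget _ _; clearbody u => -[/andP[au ub] Eu].
suff H x y : a <= x -> x <= y -> y <= b -> pl g a x = s%:E -> pl g a y = s%:E -> g x = g y.
  by have [ut|/ltW tu] := leP u t; [apply: (H u t)|symmetry; apply: (H t u)].
move=> ax xy yb Ex Ey.
apply/eqP; rewrite eq_sym -subr_eq0 -enorm_eq0 eq_le enorm_ge0 andbT -lee_fin.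
apply: le_trans (pl_ge_dist g xy) _.
have := pl_add g ax xy; rewrite Ey Ex => h.
have fu := fin ax xy yb.
by move: h; rewrite -(fineK fu) -EFinD lee_fin => -[]; lra.
Qed.

Lemma arclength_lip (s t : R) : 0 <= s -> s <= t -> (t%:E <= pl g a b)%E ->
  enorm (arclength_param g a b t - arclength_param g a b s) <= t - s.
Proof.
move=> s0 st tl.
have [u [au ub Eu]] := pl_ivt s0 (le_trans (lee_tofin st) tl).
have [v [av vb Ev]] := pl_ivt (le_trans s0 st) tl.
rewrite (arclength_paramE au ub Eu) (arclength_paramE av vb Ev).
have [uv|/ltW vu] := leP u v.
  rewrite -lee_fin; apply: le_trans (pl_ge_dist g uv) _.
  have := pl_add g au uv; rewrite Ev Eu => h.
  have fu := fin au uv vb.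
  by move: h; rewrite -(fineK fu) -EFinD lee_fin => -[]; lra.
have ts : t = s.
  apply/eqP; rewrite eq_le st andbT.
  by have := pl_mono g av vu; rewrite Eu Ev lee_fin.
have : arclength_param g a b t = arclength_param g a b s by rewrite ts.
by rewrite (arclength_paramE au ub Eu) (arclength_paramE av vb Ev) => ->; rewrite subrr enorm0 ts subrr.
Qed.

End Continuous.
End PathLength.

Section Clamp.
Variables (R : realType) (L : R).
Hypothesis L0 : 0 <= L.

(** Retraction of the line onto [0, L]; composing with it freezes a path outside its domain. *)
Definition clamp (s : R) : R := Num.max 0 (Num.min s L).

Lemma clampE s : 0 <= s -> s <= L -> clamp s = s.
Proof. by move=> s0 sL; rewrite /clamp min_l // max_r. Qed.

Lemma clamp_le0 s : s <= 0 -> clamp s = 0.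
Proof. by move=> s0; rewrite /clamp max_l // ge_min s0. Qed.

Lemma clamp_ge s : L <= s -> clamp s = L.
Proof. by move=> s0; rewrite /clamp min_r // max_r. Qed.

Lemma clamp_rng s : 0 <= clamp s <= L.
Proof. by rewrite /clamp le_max lexx /= ge_max ge_min lexx orbT L0. Qed.

Lemma clamp_lip s t : s <= t -> 0 <= clamp t - clamp s <= t - s.
Proof.
move=> st; rewrite /clamp; case: (leP s L) => h1; case: (leP t L) => h2.
- by case: (leP 0 s) => h3; case: (leP 0 t) => h4; lra.
- by case: (leP 0 s) => h3; case: (leP 0 L) => h4; lra.
- by case: (leP 0 L) => h3; case: (leP 0 t) => h4; lra.
- by case: (leP 0 L) => h3; lra.
Qed.

End Clamp.

(** * Unit-speed paths and connections of small rho-length *)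

Section UnitSpeed.
Variables (R : realType) (n : nat).
Notation mR := (measurableTypeR R).
Implicit Types (g : R -> 'rV[R]_n) (p q : 'rV[R]_n).

(** Paths already parametrised by arclength on [0, L] and frozen outside: for them [arc_integral]
    becomes the plain integral of rho along g, and a global Lipschitz bound gives continuity and
    measurability at once. *)
Definition unit_speed g (L : R) : Prop :=
  [/\ 0 <= L, forall s t, enorm (g s - g t) <= `|s - t|,
      forall s, s <= 0 -> g s = g 0, forall s, L <= s -> g s = g L &
      forall a b, 0 <= a -> a <= b -> b <= L -> path_length g a b = (b - a)%:E].

Lemma unit_speed_measurable g L : unit_speed g L ->
  measurable_fun [set: mR] (g : mR -> borel_rV R n).
Proof.
move=> [_ /enorm_lip_continuous gc _ _ _]; apply: measurable_rV => i.
apply: continuous_measurable_fun => x.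
apply: (@continuous_comp _ _ _ g (fun y : 'rV[R]_n => y ord0 i) x); first exact: gc.
exact: coord_continuous.
Qed.

Lemma integral_itv_shift (h : mR -> \bar R) (a b : R) :
  measurable_fun setT h -> (forall x, (0 <= h x)%E) ->
  (\int[lebesgue_measure]_(s in `[a, b]) h s =
   \int[lebesgue_measure]_(s in `[0%R, (b - a)%R]) h (a + s)%R)%E.
Proof.
move=> mh h0; rewrite integral_mkcond [RHS]integral_mkcond.
rewrite (@integral_R_affine R a 1) ?oner_eq0 //; last 2 first.
- by apply/(measurable_restrictT _ _).1 => //; exact: measurable_funTS.
- by move=> x; rewrite patchE; case: ifP.
rewrite normr1 mul1e; apply: eq_integral => s _; rewrite mul1r !patchE.
have -> : (a + s \in `[a, b]%classic) = (s \in `[0, b - a]%classic) => //.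
by apply/idP/idP; rewrite !inE /= !in_itv /=; lra.
Qed.

Lemma integral_itv_affine (h : mR -> \bar R) (a b k : R) : a <= b -> 0 < k ->
  measurable_fun setT h -> (forall x, (0 <= h x)%E) ->
  (\int[lebesgue_measure]_(s in `[0%R, ((b - a) * k)%R]) h (a + s / k)%R =
   k%:E * \int[lebesgue_measure]_(s in `[a, b]) h s)%E.
Proof.
move=> ab k0 mh h0; rewrite integral_mkcond [in RHS]integral_mkcond.
have ki0 : 0 < k^-1 by rewrite invr_gt0.
rewrite [in RHS](@integral_R_affine R a k^-1) ?gt_eqF //; last 2 first.
- by apply/(measurable_restrictT _ _).1 => //; exact: measurable_funTS.
- by move=> x; rewrite patchE; case: ifP.
rewrite gtr0_norm // muleA -EFinM divff ?gt_eqF // mul1e.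
apply: eq_integral => s _; rewrite !patchE [k^-1 * s]mulrC.
have -> : (a + s / k \in `[a, b]%classic) = (s \in `[0, (b - a) * k]%classic) => //.
have -> : s = (s / k) * k by rewrite divfK // gt_eqF.
move: (s / k) => u; rewrite mulfK ?gt_eqF //.
apply/idP/idP; rewrite !inE /= !in_itv /= pmulr_lge0 // ler_pM2r //; lra.
Qed.

Lemma unit_speed_line_integral g L (rho : borel_rV R n -> \bar R) :
  unit_speed g L -> measurable_fun setT rho -> (forall x, (0 <= rho x)%E) ->
  (line_integral rho (Curve `[0%R, L] g) <=
   \int[lebesgue_measure]_(s in `[0%R, L]) rho (g s))%E.
Proof.
move=> ug mrho rho0; have mg := unit_speed_measurable ug.
have mrg : measurable_fun setT (fun s : mR => rho (g s)) := measurableT_comp mrho mg.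
have [L0 gl _ _ gu] := ug.
apply: ge_ereal_sup => _ [[a b] [/= ha hb ab] <-].
rewrite !in_itv /= in ha hb.
have [/andP[a0 aL] /andP[b0 bL]] := (ha, hb).
rewrite /arc_integral (gu a b a0 ab bL) /=.
apply: (@le_trans _ _ (\int[lebesgue_measure]_(s in `[0%R, (b - a)%R]) rho (g (a + s)%R))%E).
  rewrite le_eqVlt; apply/orP; left; apply/eqP; apply: eq_integral => s; rewrite inE /= in_itv /= => /andP[s0 sb].
  rewrite (@arclength_paramE R n g a b _ s (a + s)) //.
  - by rewrite (gu a b a0 ab bL) ltry.
  - lra.
  - lra.
  - by rewrite gu; [congr EFin; ring|lra|lra|lra].
rewrite -(@integral_itv_shift (fun s => rho (g s))) //.
apply: ge0_subset_integral => //; first exact: measurable_funTS.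
by apply: subset_itv; rewrite bnd_simp.
Qed.

Lemma unit_speed_rectifiable g L : unit_speed g L ->
  locally_rectifiable (Curve `[0, L] g).
Proof.
move=> [L0 _ _ _ gu] [a b] [/= ha hb ab]; rewrite !in_itv /= in ha hb.
have [/andP[a0 aL] /andP[b0 bL]] := (ha, hb).
by rewrite gu // ltry.
Qed.

(** A path from p to q inside D of rho-length at most k. Since k is only a bound, connections can be
    weakened and concatenated without computing integrals. *)
Definition rho_conn (D : set 'rV[R]_n) (rho : borel_rV R n -> \bar R) (k : R) p q :=
  exists L g, [/\ unit_speed g L, g 0 = p, g L = q, forall t, D (g t) &
    (\int[lebesgue_measure]_(s in `[0%R, L]) rho (g s) <= k%:E)%E].

Section conn.
Variables (D : set 'rV[R]_n) (rho : borel_rV R n -> \bar R).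
Hypotheses (mrho : measurable_fun setT rho) (rho0 : forall x, (0 <= rho x)%E).

Lemma rho_connW k k' p q : k <= k' -> rho_conn D rho k p q -> rho_conn D rho k' p q.
Proof.
move=> kk [L [g [ug g0 gL Dg h]]]; exists L, g; split => //.
by apply: le_trans h _; rewrite lee_fin.
Qed.

(** The delicate point is that the concatenation still has unit speed. The Lipschitz bound gives the
    upper estimate of every length; the lower estimate is obtained on each side of L1, by carrying
    partitions over to [g1] and [g2], and then added. *)
Lemma rho_conn_cat k1 k2 p q r :
  rho_conn D rho k1 p q -> rho_conn D rho k2 q r -> rho_conn D rho (k1 + k2) p r.
Proof.
move=> [L1 [g1 [ug1 g10 g1L D1 h1]]] [L2 [g2 [ug2 g20 g2L D2 h2]]].
have mg1 : measurable_fun setT (fun s : mR => rho (g1 s)) := measurableT_comp mrho (unit_speed_measurable ug1).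
have mg2 : measurable_fun setT (fun s : mR => rho (g2 s)) := measurableT_comp mrho (unit_speed_measurable ug2).
have [L10 l1 n1 p1 u1] := ug1; have [L20 l2 n2 p2 u2] := ug2.
pose g (s : R) := if s <= L1 then g1 s else g2 (s - L1).
have gE1 s : s <= L1 -> g s = g1 s by rewrite /g => ->.
have gE2 s : L1 <= s -> g s = g2 (s - L1).
  rewrite /g le_eqVlt => /predU1P[<-|h]; first by rewrite lexx subrr g1L g20.
  by rewrite leNgt h.
have glip s t : s <= t -> enorm (g t - g s) <= t - s.
  move=> st; have [tL|/ltW Lt] := leP t L1.
    rewrite (gE1 t) // (gE1 s) ?(le_trans st) //; apply: le_trans (l1 _ _) _.
    by rewrite ger0_norm ?subr_ge0.
  have [sL|/ltW Ls] := leP s L1; last first.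
    rewrite !gE2 //; apply: le_trans (l2 _ _) _.
    by rewrite ger0_norm; lra.
  apply: le_trans (ler_enormB _ (g L1) _) _.
  have -> : t - s = (t - L1) + (L1 - s) by ring.
  apply: lerD.
    rewrite !gE2 //; apply: le_trans (l2 _ _) _.
    by rewrite ger0_norm; lra.
  rewrite !gE1 //; apply: le_trans (l1 _ _) _.
  by rewrite ger0_norm; lra.
have plb a b : a <= b -> (path_length g a b <= (b - a)%:E)%E.
  by move=> ab; apply: pl_lip => // u v _ uv _; exact: glip.
have pl1 a b : 0 <= a -> a <= b -> b <= L1 -> path_length g a b = (b - a)%:E.
  move=> a0 ab bL; rewrite -u1 // !path_lengthE; congr ereal_sup.
  apply: eq_set => x; apply: propext; split => -[s ps <-]; exists s => //; congr EFin.
    elim: s a ps {a0 ab} => //= y s IH a /partition_cons[ay ys].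
    have yb := partition_le ys.
    by rewrite (IH y) // !gE1 // ?(le_trans yb) // (le_trans (ltW ay)) // (le_trans yb).
  elim: s a ps {a0 ab} => //= y s IH a /partition_cons[ay ys].
  have yb := partition_le ys.
  by rewrite (IH y) // !gE1 // ?(le_trans yb) // (le_trans (ltW ay)) // (le_trans yb).
have pl2 a b : L1 <= a -> a <= b -> b <= L1 + L2 -> ((b - a)%:E <= path_length g a b)%E.
  move=> a0 ab bL.
  have -> : b - a = (b - L1) - (a - L1) by ring.
  rewrite -u2; [|lra..].
  apply: pl_le => s ps.
  suff [s' ps' ->] : exists2 s', itv_partition a b s' & plen g2 (a - L1) s = plen g a s'.
    exact: plen_le_pl.
  elim: s a a0 ab ps => [|y s IH] a a0 ab ps.
    exists [::] => //; have e := itv_partition_nil ps.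
    by have -> : a = b by lra.
  move/partition_cons: ps => [ay ys]; have yb := partition_le ys.
  have [|||s' ps' e] := IH (y + L1); [lra|lra|by rewrite addrK|].
  exists (y + L1 :: s'); first by apply/partition_cons; split => //; lra.
  by rewrite /= -e addrK !gE2 ?addrK //; lra.
exists (L1 + L2), g; split.
- split; first lra.
  + move=> s t; have [st|/ltW st] := leP s t.
      by rewrite enormB distrC ger0_norm ?subr_ge0 //; exact: glip.
    by rewrite ger0_norm ?subr_ge0 //; exact: glip.
  + by move=> s s0; rewrite !gE1 ?n1 //; lra.
  + by move=> s s0; rewrite !gE2 ?(p2 (s - L1)) ?[L1 + L2]addrC ?addrK //; lra.
  + move=> a b a0 ab bL; apply/eqP; rewrite eq_le plb //=.
    have [bL1|/ltW L1b] := leP b L1; first by rewrite pl1.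
    have [aL1|/ltW L1a] := leP a L1; last exact: pl2.
    rewrite (pl_add _ aL1 L1b) (pl1 a) //.
    apply: le_trans (leeD2l _ (pl2 _ _ (lexx _) L1b bL)).
    by rewrite -EFinD lee_fin; lra.
- by rewrite gE1.
- by rewrite gE2 ?[L1 + L2]addrC ?addrK //; lra.
- by move=> t; rewrite /g; case: ifP.
have mg : measurable_fun setT (fun s : mR => rho (g s)).
  rewrite (_ : (fun s => rho (g s)) = (fun s => if s <= L1 then rho (g1 s) else rho (g2 (s - L1)))); last first.
    by apply/funext => s; rewrite /g; case: ifP.
  apply: measurable_fun_ifT => //.
    by apply: measurable_fun_ler => //.
  by apply: (measurableT_comp mg2); apply: measurable_funB.
rewrite (@itv_bndbnd_setU _ _ _ (BRight L1)) ?bnd_simp //; last lra.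
rewrite ge0_integral_setU //=; last 2 first.
  exact: measurable_funTS.
  rewrite disj_set2E; apply/eqP/seteqP; split => // x [] /=; rewrite !in_itv /=; lra.
rewrite EFinD; apply: leeD.
  apply: le_trans h1; rewrite le_eqVlt; apply/orP; left; apply/eqP; apply: eq_integral => s.
  by rewrite inE /= in_itv /= => /andP[_ sL]; rewrite gE1.
apply: le_trans h2.
apply: (@le_trans _ _ (\int[lebesgue_measure]_(s in `[L1, (L1 + L2)%R]) rho (g s))%E).
  apply: ge0_subset_integral => //; first exact: measurable_funTS.
  by apply: subset_itv; rewrite bnd_simp.
rewrite (@integral_itv_shift (fun s => rho (g s))) //.
rewrite [(L1 + L2)%R]addrC addrK le_eqVlt; apply/orP; left; apply/eqP; apply: eq_integral => s.
rewrite inE /= in_itv /= => /andP[s0 sL]; rewrite gE2; last lra.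
by rewrite addrC addKr.
Qed.

Lemma rho_conn_seg k p q : 0 <= k ->
  (forall t, 0 <= t -> t <= 1 -> D (p + t *: (q - p))) ->
  ((enorm (q - p))%:E * \int[lebesgue_measure]_(t in `[0%R, 1%R]) rho (p + t *: (q - p))%R <= k%:E)%E ->
  rho_conn D rho k p q.
Proof.
move=> k0 Dpq hk; set v := q - p in hk.
set L := enorm v in hk.
have Dp : D p by have := Dpq 0 (lexx _) ler01; rewrite scale0r addr0.
(* The parametrisation below divides by the length L, so the constant path is treated apart. *)
have [v0|vn0] := eqVneq v 0.
  have pq : q = p by apply/eqP; rewrite -subr_eq0 -/v v0.
  exists 0, (fun=> p); split => //.
    split => //; first by move=> s t; rewrite subrr enorm0.
    by move=> a b a0 ab b0; rewrite (_ : b = a) ?subrr ?plxx //; lra.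
  by rewrite set_itv1 integral_set1.
have L0 : 0 < L by rewrite enorm_gt0.
have cl_rng := clamp_rng (ltW L0).
have clE := @clampE R L.
have cl_lip := @clamp_lip R L.
pose cl := clamp L.
pose g s := p + (cl s / L) *: v.
have gB s t : g t - g s = ((cl t - cl s) / L) *: v.
  by rewrite /g addrAC opprD addrA subrr add0r addrC -scalerBl mulrBl.
have gN s t : s <= t -> enorm (g t - g s) = cl t - cl s.
  move=> st; have /andP[h1 h2] := cl_lip s t st.
  by rewrite gB enormZ ger0_norm ?divr_ge0 // ?(ltW L0) // divfK ?gt_eqF.
have glip s t : s <= t -> enorm (g t - g s) <= t - s.
  by move=> st; rewrite gN //; case/andP: (cl_lip s t st).
exists L, g; split.
- split; first exact: ltW.
  + move=> s t; have [st|/ltW st] := leP s t.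
      by rewrite enormB distrC ger0_norm ?subr_ge0 //; exact: glip.
    by rewrite ger0_norm ?subr_ge0 //; exact: glip.
  + by move=> s s0; rewrite /g /cl !clamp_le0.
  + by move=> s s0; rewrite /g /cl !clamp_ge // ltW.
  + move=> a b a0 ab bL; apply/eqP; rewrite eq_le; apply/andP; split.
      by apply: pl_lip => // u w _ uw _; exact: glip.
    apply: le_trans (pl_ge_dist _ ab); rewrite gN // /cl !clE //.
    exact: le_trans bL. exact: le_trans ab.
- by rewrite /g /cl clamp_le0 // mul0r scale0r addr0.
- by rewrite /g /cl clamp_ge ?(ltW L0) // divff ?gt_eqF // scale1r addrC subrK.
- move=> t; apply: Dpq; have /andP[h1 h2] := cl_rng t; first by rewrite divr_ge0 // ltW.
  by rewrite ler_pdivrMr // mul1r.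
apply: le_trans hk.
have mr : measurable_fun setT (fun t : mR => rho (p + t *: v)).
  apply: (measurableT_comp mrho); apply: measurable_rV => i.
  under eq_fun do rewrite !mxE.
  by apply: measurable_funD => //; apply: measurable_funM.
rewrite -(@integral_itv_affine (fun t => rho (p + t *: v)) 0 1 L) // subr0 mul1r.
rewrite le_eqVlt; apply/orP; left; apply/eqP; apply: eq_integral => s.
by rewrite inE /= in_itv /= => /andP[s0 sL]; rewrite /g /cl clE // add0r.
Qed.

End conn.
End UnitSpeed.

(** * Logarithmic length accumulated by a Lipschitz function *)

Section LogLength.
Variable R : realType.
Notation mR := (measurableTypeR R).
Implicit Types (m : R -> R).

Definition lip1 m := forall s t, `|m s - m t| <= `|s - t|.

Lemma lip1_continuous m : lip1 m -> continuous m.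
Proof.
move=> lm x; apply/cvgrPdist_lt => e e0.
have : \forall y \near x, `|x - y| < e by apply: nbhsx_ballx.
by apply: filterS => y; exact/le_lt_trans/lm.
Qed.

(** Together with the first later passage through a higher level, this cuts out an interval on which
    m climbs from one level to the other and stays strictly between them in the interior. *)
Lemma lip1_last_time m a b r : lip1 m -> a <= b -> m a <= r -> r <= m b ->
  exists s0, [/\ a <= s0, s0 <= b, m s0 = r & forall s, s0 < s -> s <= b -> r < m s].
Proof.
move=> lm ab ma mb.
pose T := [set s | [/\ a <= s, s <= b & m s <= r]].
have Ta : T a by split.
have hT : has_sup T by split; [exists a|exists b => t []].
pose s0 := sup T.
have as0 : a <= s0 by apply: ub_le_sup => //; case: hT.
have s0b : s0 <= b by apply: ge_sup => [|t []//]; exists a.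
have after s : s0 < s -> s <= b -> r < m s.
  move=> s0s sb; rewrite ltNge; apply/negP => ms.
  have : s <= s0 by apply: ub_le_sup; [case: hT|split => //; exact: le_trans (ltW s0s)].
  by rewrite leNgt s0s.
exists s0; split => //; apply/eqP; rewrite eq_le; apply/andP; split.
  apply/ler_addgt0Pr => e e0.
  have [t [at' tb ts] t1t'] : exists2 t, T t & s0 - e < t.
    by apply: sup_adherent.
  have ts0 : t <= s0 by apply: ub_le_sup; [case: hT|split].
  by have := lm s0 t; rewrite ler_norml (ger0_norm (_ : 0 <= s0 - t)); lra.
move: s0b; rewrite le_eqVlt => /predU1P[-> //|s0b].
apply/ler_addgt0Pr => e e0.
pose t := Num.min b (s0 + e).
have t0 : s0 < t by rewrite lt_min s0b; lra.
have tb : t <= b by rewrite ge_min lexx.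
have te : t <= s0 + e by rewrite ge_min lexx orbT.
have := after t t0 tb; have := lm t s0; rewrite ler_norml (ger0_norm (_ : 0 <= t - s0)); lra.
Qed.

(** The last-passage statement after reversing both the time and the sign of m. *)
Lemma lip1_first_time m a b r : lip1 m -> a <= b -> m a <= r -> r <= m b ->
  exists s1, [/\ a <= s1, s1 <= b, m s1 = r & forall s, a <= s -> s < s1 -> m s < r].
Proof.
move=> lm ab ma mb.
have lm' : lip1 (fun s => - m (- s)).
  by move=> s t; rewrite -opprD normrN; apply: le_trans (lm _ _) _; rewrite -opprD normrN.
have [|||s [s1 s2 s3 s4]] := @lip1_last_time _ (- b) (- a) (- r) lm'; rewrite ?opprK; [lra..|].
exists (- s); split; [lra|lra|lra|] => t at' ts.
have := s4 (- t); rewrite opprK => s4'; suff : - r < - m t by lra.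
by apply: s4'; lra.

Qed.

Lemma measurable_invr : measurable_fun [set: mR] (fun x : mR => x^-1 : mR).
Proof.
(* The real power with exponent -1 is the inverse for nonnegative bases, so it is applied to x^2 and
   multiplied back by x; both sides vanish at 0. *)
rewrite (_ : (fun x => x^-1) = (fun x : R => x * (x ^+ 2) `^ (-1))); last first.
  apply/funext => x; rewrite powR_inv1 ?sqr_ge0 //.
  by have [->|x0] := eqVneq x 0; rewrite ?invr0 ?mul0r //; field.
apply: measurable_funM => //.
apply: (@measurableT_comp _ _ _ _ _ _ (fun x : mR => x `^ (-1)) _ (fun x : mR => x ^+ 2)).
  exact: measurable_powR.
exact: measurable_funX.
Qed.

Lemma measurable_inv_lip1 m : lip1 m -> measurable_fun setT (fun s : mR => ((m s)^-1)%:E : \bar R).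
Proof.
move=> lm; apply/measurable_EFinP.
apply: (measurableT_comp (f := fun x : R => x^-1)); last by apply: continuous_measurable_fun; exact: lip1_continuous.
exact: measurable_invr.
Qed.

(** Since m is merely Lipschitz, the fundamental theorem for ln m is replaced by a Riemann sum. On
    one step 1/m >= 1/(m a + h), while ln m grows by at most h / m a; the difference is quadratic in
    h and vanishes under refinement. *)
Lemma ln_step m a h r : lip1 m -> 0 < r -> 0 <= h ->
  (forall s, a <= s -> s <= a + h -> r <= m s) ->
  ((ln (m (a + h)) - ln (m a) - h ^+ 2 / r ^+ 2)%:E <=
   \int[lebesgue_measure]_(s in `[a, (a + h)%R]) ((m s)^-1)%:E)%E.
Proof.
move=> lm r0 h0 mr.
have ma : 0 < m a by apply: lt_le_trans (mr a _ _) => //; lra.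
have mh : 0 < m (a + h) by apply: lt_le_trans (mr _ _ _) => //; lra.
have mra := mr a (lexx _) (_ : a <= a + h).
apply: (@le_trans _ _ (\int[lebesgue_measure]_(s in `[a, (a + h)%R]) (cst ((m a + h)^-1)%:E s))%E).
  rewrite integral_cst //= lebesgue_measure_itv /= lte_fin.
  have -> : (if a < a + h then ((a + h)%:E - a%:E)%E else 0%E) = h%:E.
    case: ifPn => [_|]; first by rewrite -EFinB; congr EFin; ring.
    by rewrite -leNgt => hh; congr EFin; lra.
  rewrite -EFinM lee_fin.
  have h1 : ln (m (a + h)) - ln (m a) <= h / m a.
    rewrite -lnV ?posrE // -lnM ?posrE ?invr_gt0 //.
    have -> : m (a + h) / m a = 1 + (m (a + h) - m a) / m a by field; rewrite gt_eqF.
    apply: le_trans (le_ln1Dx _) _.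
      rewrite ltr_pdivlMr //; lra.
    rewrite ler_pM2r ?invr_gt0 //.
    by have := lm (a + h) a; rewrite ler_norml (ger0_norm (_ : 0 <= a + h - a)); lra.
  suff h2 : h / m a - h ^+ 2 / r ^+ 2 <= (m a + h)^-1 * h by lra.
  have : h / m a - (m a + h)^-1 * h <= h ^+ 2 / r ^+ 2.
    have -> : h / m a - (m a + h)^-1 * h = h ^+ 2 / (m a * (m a + h)).
      by field; apply/andP; split; rewrite gt_eqF //; lra.
    rewrite ler_wpM2l ?sqr_ge0 // lef_pV2 ?posrE ?exprn_gt0 //; last by rewrite mulr_gt0 //; lra.
    by rewrite expr2; apply: ler_pM; rewrite ?(ltW r0) //; have := mra; lra.
  lra.
apply: ge0_le_integral => //.
- by move=> s _; rewrite lee_fin invr_ge0; lra.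
- by apply: measurable_funTS; exact: measurable_inv_lip1.
move=> s; rewrite /= in_itv /= => /andP[as1 sh]; rewrite lee_fin.
have ms := mr s as1 sh.
rewrite lef_pV2 ?posrE; [|lra|lra].
by have := lm s a; rewrite ler_norml (ger0_norm (_ : 0 <= s - a)); lra.
Qed.

Lemma ln_steps m a h r k : lip1 m -> 0 < r -> 0 <= h ->
  (forall s, a <= s -> s <= a + k%:R * h -> r <= m s) ->
  ((ln (m (a + k%:R * h)) - ln (m a) - k%:R * (h ^+ 2 / r ^+ 2))%:E <=
   \int[lebesgue_measure]_(s in `[a, (a + k%:R * h)%R]) ((m s)^-1)%:E)%E.
Proof.
move=> lm r0 h0; elim: k => [|k IH] mr.
  rewrite !mul0r addr0 subrr subr0; apply: integral_ge0 => s.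
  rewrite /= in_itv /= => /andP[h1 h2]; rewrite lee_fin invr_ge0.
  by apply: le_trans (mr _ _ _); rewrite ?mul0r ?addr0 // ltW.
have kh : 0 <= k%:R * h by rewrite mulr_ge0.
have E : a + k.+1%:R * h = a + k%:R * h + h by rewrite -natr1; ring.
rewrite E in mr *.
rewrite (@itv_bndbnd_setU _ _ _ (BLeft (a + k%:R * h))) ?bnd_simp //; [|lra|lra].
rewrite ge0_integral_setU //=; last 3 first.
- by apply: measurable_funTS; exact: measurable_inv_lip1.
- move=> s hs; rewrite lee_fin invr_ge0; apply: le_trans (ltW r0) _.
  by apply: mr; case: hs; rewrite /= !in_itv /=; lra.
- by rewrite disj_set2E; apply/eqP/seteqP; split => // x [] /=; rewrite !in_itv /=; lra.
rewrite integral_itv_bndo_bndc; last first.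
  by apply: measurable_funTS; exact: measurable_inv_lip1.
apply: le_trans (leeD (IH _) (ln_step lm r0 h0 _)).
- by rewrite -EFinD lee_fin -natr1; lra.
- by move=> s s1 s2; apply: mr; lra.
- by move=> s s1 s2; apply: mr; lra.
Qed.

Lemma ln_le_integral_inv m a b r : lip1 m -> 0 < r -> a <= b ->
  (forall s, a <= s -> s <= b -> r <= m s) ->
  ((ln (m b) - ln (m a))%:E <= \int[lebesgue_measure]_(s in `[a, b]) ((m s)^-1)%:E)%E.
Proof.
move=> lm r0 ab mr; apply/lee_addgt0Pr => e e0.
pose M := (b - a) ^+ 2 / r ^+ 2.
have M0 : 0 <= M by rewrite divr_ge0 // sqr_ge0.
(* With k equal steps the total error is k (M / k^2) = M / k, which this k makes at most e. *)
pose k := (Num.truncn (M / e)).+1.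
have kM : M / k%:R <= e.
  by rewrite ler_pdivrMr ?ltr0n // mulrC -ler_pdivrMr // ltW // truncnS_gt.
have k0 : k%:R != 0 :> R by rewrite pnatr_eq0.
have E : b = a + k%:R * ((b - a) / k%:R) by field.
have h0 : 0 <= (b - a) / k%:R by rewrite divr_ge0 // subr_ge0.
have := @ln_steps m a ((b - a) / k%:R) r k lm r0 h0; rewrite -E => /(_ mr) h.
have := leeD2r e%:E h; apply: le_trans.
rewrite -EFinD lee_fin.
have -> : k%:R * (((b - a) / k%:R) ^+ 2 / r ^+ 2) = M / k%:R.
  by rewrite /M; field; rewrite k0 gt_eqF.
lra.
Qed.

Lemma ln_le_shell_integral m l r1 r2 : lip1 m -> 0 <= l -> 0 < r1 -> r1 <= r2 ->
  m 0 <= r1 -> r2 <= m l ->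
  ((ln (r2 / r1))%:E <= \int[lebesgue_measure]_(s in `[0%R, l])
     (if (r1 < m s < r2)%R then ((m s)^-1)%:E else 0))%E.
Proof.
move=> lm l0 r10 r12 m0 ml.
have r20 : 0 < r2 by apply: lt_le_trans r12.
have [s0 [s01 s02 ms0 s03]] := lip1_last_time lm l0 m0 (le_trans r12 ml).
have [|s1 [s11 s12 ms1 s13]] := lip1_first_time lm s02 _ ml; first by rewrite ms0.
have mm : measurable_fun setT (fun s : mR => if (r1 < m s < r2)%R then ((m s)^-1)%:E else 0%E : \bar R).
  have mm := continuous_measurable_fun (lip1_continuous lm).
  apply: measurable_fun_ifT => //; last exact: measurable_inv_lip1.
  by apply: measurable_and; exact: measurable_fun_ltr.
have nn s : (0 <= if (r1 < m s < r2)%R then ((m s)^-1)%:E else 0%E :> \bar R)%E.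
  by case: ifP => // /andP[h _]; rewrite lee_fin invr_ge0; lra.
apply: (@le_trans _ _ (\int[lebesgue_measure]_(s in `]s0, s1[) ((m s)^-1)%:E)%E).
  rewrite -(@integral_itv_bndoo _ _ _ _ true false) ; last first.
    by apply: measurable_funTS; exact: measurable_inv_lip1.
  rewrite lnM ?posrE ?invr_gt0 // lnV ?posrE // -ms1 -[in leLHS]ms0.
  apply: (@ln_le_integral_inv _ _ _ r1) => // s ss0 ss1.
  move: ss0; rewrite le_eqVlt => /predU1P[<-|ss0]; first by rewrite ms0.
  by apply/ltW/s03 => //; exact: le_trans s12.
rewrite [leLHS](_ : _ = \int[lebesgue_measure]_(s in `]s0, s1[)
     (if (r1 < m s < r2)%R then ((m s)^-1)%:E else 0))%E; last first.
  apply: eq_integral => s; rewrite inE /= in_itv /= => /andP[h1 h2].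
  by rewrite s03 ?s13 // ltW // (lt_le_trans h2).
apply: ge0_subset_integral => //; first exact: measurable_funTS.
by apply: subset_itv; rewrite bnd_simp.
Qed.

End LogLength.

(** * Modulus of half-annuli *)

Section HalfSpace.
Variables (R : realType) (n : nat).
Notation H := (half_space R n).
Implicit Types (x y xi : 'rV[R]_n).

Lemma half_space_open : open H.
Proof.
rewrite openE => x Hx.
apply: (@filterS _ _ (nbhs_filter x)
  [set y : 'rV[R]_n | forall i : 'I_n, i = n.-1 :> nat -> 0 < y ord0 i]); first by [].
apply: (@filter_forall _ _ (fun i : 'I_n => [set y : 'rV[R]_n | i = n.-1 :> nat -> 0 < y ord0 i]) (nbhs x)) => i.
have [ie|ie] := eqVneq (i : nat) n.-1; last first.
  by apply: (@filterS _ _ (nbhs_filter x) setT _ _ filterT) => y _ /=; move/eqP: ie.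
have ab : nbhs (x ord0 i) `]0, (x ord0 i + 1)[%classic.
  by apply: open_nbhs_nbhs; split; [exact: itv_open|rewrite /= in_itv /= ltrDl ltr01 andbT; exact: Hx].
apply: (@filterS _ _ (nbhs_filter x) _ _ _ (@coord_continuous R 1 n ord0 i x _ ab)) => y.
by rewrite /= in_itv /= => /andP[].
Qed.

Lemma half_space_measurable : measurable (H : set (borel_rV R n)).
Proof. by apply: sub_sigma_algebra; exact: half_space_open. Qed.

Definition on_hyperplane : set 'rV[R]_n := [set x | forall i : 'I_n, i = n.-1 :> nat -> x ord0 i = 0].

Lemma half_space_affine xi x (s : R) : on_hyperplane xi -> 0 < s -> H (xi + s *: x) <-> H x.
Proof.
move=> fx s0; split => h i ie; have := h i ie; rewrite !mxE fx // add0r ?pmulr_rgt0 //.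
Qed.

(* The curves are kept constant outside [0, L], so that a homeomorphism of the
   half-space maps this family exactly onto the family joining the image sets. *)
Definition joining_curves (E F : set 'rV[R]_n) : set (curve R n) :=
  [set c | exists L g, [/\ c = Curve `[0, L] g, 0 <= L, continuous g,
      forall s, s <= 0 -> g s = g 0 & forall s, L <= s -> g s = g L] /\
      [/\ forall t, H (g t), E (g 0) & F (g L)]].

(** The shells a <= |x - xi| < b are half-open so that adjacent ones add up exactly. The measure
    with density |x - xi|^-n is invariant under dilations about a boundary point xi, which also
    preserve the half-space. *)
Definition shell_density xi (a b : R) x : \bar R :=
  if `[< H x >] && (a <= enorm (x - xi) < b) then ((enorm (x - xi))^-1 ^+ n)%:E else 0%E.

Lemma shell_density_ge0 xi a b x : (0 <= shell_density xi a b x)%E.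
Proof. by rewrite /shell_density; case: ifP => _ //; rewrite lee_fin exprn_ge0 // invr_ge0 enorm_ge0. Qed.

Lemma measurable_dist xi : measurable_fun [set: borel_rV R n]
  (fun x : borel_rV R n => enorm (x - xi) : measurableTypeR R).
Proof.
apply: continuous_measurable_rVR => x.
have F := nbhs_filter x; apply/cvgrPdist_lt => e e0.
have := @continuous_enormP R n 'rV[R]_n id x (@cvg_id _ (nbhs x)) e e0.
apply: filterS => y; apply: le_lt_trans; apply: le_trans (ler_dist_enorm _ _) _.
by rewrite opprB addrA subrK enormB.
Qed.

Lemma measurable_half_spaceb : measurable_fun [set: borel_rV R n]
  (fun x : borel_rV R n => `[< H x >]).
Proof.
apply: (measurable_fun_bool true); rewrite setTI.
rewrite (_ : _ @^-1` _ = H); first exact: half_space_measurable.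
by apply/seteqP; split => x /= /asboolP.
Qed.

Lemma measurable_shell_density xi a b : measurable_fun [set: borel_rV R n] (shell_density xi a b).
Proof.
have md := measurable_dist xi.
apply: measurable_fun_ifT => //.
  apply: measurable_and; first exact: measurable_half_spaceb.
  by apply: measurable_and; [exact: measurable_fun_ler|exact: measurable_fun_ltr].
apply/measurable_EFinP; apply: measurable_funX.
exact: (measurableT_comp (@measurable_invr R) md).
Qed.

Definition shell_mass xi a b : \bar R := (\int[@lebesgue_rV R n]_x shell_density xi a b x)%E.

Lemma shell_mass_scale xi (s a b : R) : on_hyperplane xi -> 0 < s ->
  shell_mass xi (s * a) (s * b) = shell_mass 0 a b.
Proof.
move=> fx s0; rewrite /shell_mass.
rewrite (@integral_rV_affine R n xi s) //; [|exact: measurable_shell_density|exact: shell_density_ge0].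
have sn0 : 0 <= s ^+ n by rewrite exprn_ge0 // ltW.
rewrite -ge0_integralZl_EFin //; last 2 first.
- by move=> x _; exact: shell_density_ge0.
- apply: (measurableT_comp (measurable_shell_density xi (s * a) (s * b))).
  apply: measurable_rV => i; under eq_fun do rewrite !mxE.
  by apply: measurable_funD => //; apply: measurable_funM => //; exact: measurable_coord.
apply: eq_integral => x _; rewrite /shell_density subr0 addrAC subrr add0r enormZ gtr0_norm //.
rewrite !ler_pM2l // !ltr_pM2l // (_ : `[< H (xi + s *: x) >] = `[< H x >]); last first.
  by apply: asbool_equiv_eq; exact: half_space_affine.
case: ifP => _; last by rewrite mule0.
by rewrite -EFinM invfM exprMn mulrA -exprMn divff ?gt_eqF // expr1n mul1r.
Qed.

Lemma shell_mass_add xi a b c : a <= b -> b <= c -> shell_mass xi a c = (shell_mass xi a b + shell_mass xi b c)%E.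
Proof.
move=> ab bc; rewrite /shell_mass -ge0_integralD //; try exact: measurable_shell_density; try by move=> x _; exact: shell_density_ge0.
apply: eq_integral => x _; rewrite /shell_density; case: (`[< H x >]); rewrite /= ?adde0 //.
set d := enorm _; case: (leP a d) => h1; case: (ltP d b) => h2; case: (ltP d c) => h3; case: (leP b d) => h4 //=;
  rewrite ?adde0 ?add0e //; exfalso; lra.
Qed.

Lemma emeasurable_funX d (T : measurableType d) (f : T -> \bar R) k :
  measurable_fun setT f -> measurable_fun setT (fun z => f z ^+ k)%E.
Proof.
move=> mf; elim: k => [|k IH]; first by (under eq_fun do rewrite expe0); exact: measurable_cst.
by under eq_fun do rewrite expeS; exact: emeasurable_funM.
Qed.

(** The constant c0 of the modulus bounds; it enters only through being positive and finite. *)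
Definition unit_shell_mass : \bar R := shell_mass 0 1 (expR 1).

(** The shell is cut into N dilated copies of the unit one, in place of an integration in polar
    coordinates. *)
Lemma shell_mass_exp xi (r : R) N : on_hyperplane xi -> 0 < r ->
  shell_mass xi r (r * expR N%:R) = (N%:R%:E * unit_shell_mass)%E.
Proof.
move=> fx r0; elim: N => [|N IH].
  rewrite expR0 mulr1 mul0e /shell_mass integral0_eq // => x _.
  by rewrite /shell_density; set d := enorm _; case: (leP r d) => h1; case: (ltP d r) => h2; rewrite ?andbF //; lra.
have h1 : 1 <= expR N%:R :> R by rewrite -expR0 ler_expR.
have h2 : expR N%:R <= expR N.+1%:R :> R by rewrite ler_expR ler_nat.
rewrite (@shell_mass_add _ _ (r * expR N%:R)); last 2 first.
- by rewrite ler_peMr // ltW.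
- by rewrite ler_pM2l.
rewrite IH -natr1 expRD mulrA.
rewrite -[X in shell_mass _ X _]mulr1 shell_mass_scale // ?mulr_gt0 ?expR_gt0 //.
by rewrite -/unit_shell_mass EFinD ge0_muleDl ?mul1e // lee_fin.
Qed.

Lemma unit_shell_mass_ge0 : (0 <= unit_shell_mass)%E.
Proof. by apply: integral_ge0 => x _; exact: shell_density_ge0. Qed.

Lemma unit_shell_mass_fin : (unit_shell_mass < +oo)%E.
Proof.
pose B := @box R n (fun=> - expR 1) (fun=> expR 1).
have mB : measurable (B : set (borel_rV R n)) by exact: box_measurable.
apply: (@le_lt_trans _ _ (\int[@lebesgue_rV R n]_x (\1_B x)%:E)%E); last first.
  rewrite integral_indic // setIT.
  apply: le_lt_trans (prod_itv_lty (fun _ : 'I_n => - expR 1 : R) (fun=> expR 1)).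
  by rewrite -lebesgue_rV_box.
apply: ge0_le_integral => //.
- by move=> x _; exact: shell_density_ge0.
- exact: measurable_shell_density.
- by apply/measurable_EFinP; exact: measurable_indic.
move=> x _; rewrite /shell_density subr0; case: ifP => [/andP[_ /andP[h1 h2]]|_]; last by rewrite lee_fin.
rewrite indicE mem_set.
  rewrite lee_fin exprn_ile1 ?invr_ge0 ?enorm_ge0 // invf_le1 //; lra.
by move=> i; rewrite -ltr_norml; apply: le_lt_trans h2; exact: ler_coord_enorm.
Qed.

Lemma unit_shell_mass_gt0 : (0 < n)%N -> (0 < unit_shell_mass)%E.
Proof.
move=> n0; have nR : 0 < n%:R :> R by rewrite ltr0n.
(* This box lies in the half-shell 1 <= |x| < e: the last coordinate already exceeds 1, and the
   absolute values of the coordinates add up to at most 3/2 + 1/2 = 2 < e. There the density is at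
   least 2^-n. *)
pose a (i : 'I_n) : R := if i == n.-1 :> nat then 1 else 0.
pose b (i : 'I_n) : R := if i == n.-1 :> nat then 3/2 else 1/(2*n%:R).
have mB : measurable (box a b : set (borel_rV R n)) by exact: box_measurable.
apply: (@lt_le_trans _ _ (\int[@lebesgue_rV R n]_x ((2^-1 ^+ n)%:E * (\1_(box a b) x)%:E))%E); last first.
  apply: ge0_le_integral => //.
  - by apply: emeasurable_funM => //; apply/measurable_EFinP; exact: measurable_indic.
  - exact: measurable_shell_density.
  move=> x _; rewrite indicE; case: (boolP (x \in _)) => [|_]; last by rewrite mule0 shell_density_ge0.
  rewrite inE mule1 => xB; rewrite /shell_density subr0.
  have Hx : H x.
    move=> i ie; have := xB i; rewrite /a /b ie eqxx; lra.
  have x1 : 1 <= enorm x.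
    have [l le] : exists l : 'I_n, l = n.-1 :> nat.
      by exists (Ordinal (eq_ind_r (fun k => (k <= n)%N) (leqnn n) (prednK n0))).
    apply: le_trans (ler_coord_enorm x l); have := xB l; rewrite /a /b le eqxx => /andP[h _].
    by apply: le_trans (ler_norm _); exact: ltW.
  have x2 : enorm x <= 2.
    apply: le_trans (enorm_le_sum x) _.
    apply: (@le_trans _ _ (\sum_(i < n) ((i == n.-1 :> nat)%:R * (3/2) + 1/(2*n%:R)))).
      apply: ler_sum => i _; have := xB i; rewrite /a /b.
      have h0 : 0 < 1/(2*n%:R) :> R by rewrite divr_gt0 // mulr_gt0.
      move: h0; move: (1 / (2 * n%:R)) => dl h0; case: eqP => _ /andP[h1 h2]; rewrite /= ger0_norm; lra.
    rewrite big_split /= sumr_const card_ord -mulr_suml.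
    have -> : \sum_(i < n) ((i == n.-1 :> nat)%:R : R) = 1.
      have [l le] : exists l : 'I_n, l = n.-1 :> nat.
        by exists (Ordinal (eq_ind_r (fun k => (k <= n)%N) (leqnn n) (prednK n0))).
      rewrite (bigD1 l) //= le eqxx big1 ?addr0 // => i il.
      by rewrite -le (inj_eq val_inj) (negbTE il).
    rewrite mul1r -[X in _ + X]mulr_natr (_ : 1 / (2 * n%:R) * n%:R = 1/2); first lra.
    by field; rewrite gt_eqF.
  have e2 : 2 < expR 1 :> R by have := @expR_gt1Dx R 1 (oner_neq0 _); lra.
  rewrite asboolT //= x1 (le_lt_trans x2 e2) /= lee_fin.
  by rewrite lerXn2r ?nnegrE ?invr_ge0 ?enorm_ge0 // lef_pV2 ?posrE //; lra.
rewrite ge0_integralZl_EFin //; last 2 first.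
all: try by [rewrite exprn_ge0|apply/measurable_EFinP; exact: measurable_indic|move=> x _; rewrite lee_fin].
rewrite integral_indic // setIT; apply: mule_gt0; first by rewrite lte_fin exprn_gt0.
suff : (0 < \prod_(i < n) lebesgue_measure `]a i, b i[%classic)%E.
  by rewrite -lebesgue_rV_box.
apply: (big_ind (fun x : \bar R => 0 < x)%E) => //; first exact: mule_gt0.
move=> i _; rewrite lebesgue_measure_itv /= lte_fin.
have h0 : 0 < 1/(2*n%:R) :> R by rewrite divr_gt0 // mulr_gt0.
by rewrite /a /b; case: eqP => _; rewrite ?h0 ?ifT -?EFinB ?lte_fin; lra.
Qed.

(** Along the arclength parametrisation the distance to xi is 1-Lipschitz and climbs from at most r
    to at least r exp N, so its inverse has integral at least N over the time spent in the shell.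
    Dividing by N makes the density admissible, and its n-th power is N^-n times the shell
    density. *)
Lemma modulus_le_shell (E F : set 'rV[R]_n) xi (r : R) N : (0 < n)%N -> on_hyperplane xi -> 0 < r -> (0 < N)%N ->
  (forall x, E x -> enorm (x - xi) <= r) ->
  (forall x, F x -> r * expR N%:R <= enorm (x - xi)) ->
  (modulus (joining_curves E F) <= (N%:R^-1 ^+ n * N%:R)%:E * unit_shell_mass)%E.
Proof.
move=> n0 fx r0 N0 hE hF; have NR : 0 < N%:R :> R by rewrite ltr0n.
set r' := r * expR N%:R in hF.
have rr' : r <= r' by rewrite ler_peMr ?(ltW r0) // -expR0 ler_expR.
have mdist := measurable_dist xi.
pose rho x : \bar R := if `[< H x >] && (r < enorm (x - xi) < r') then (N%:R^-1 * (enorm (x - xi))^-1)%:E else 0%E.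
have mrho : measurable_fun [set: borel_rV R n] rho.
  apply: measurable_fun_ifT => //.
    apply: measurable_and; first exact: measurable_half_spaceb.
    by apply: measurable_and; exact: measurable_fun_ltr.
  apply/measurable_EFinP; apply: measurable_funM => //.
  exact: (measurableT_comp (@measurable_invr R) mdist).
have rho0 x : (0 <= rho x)%E.
  by rewrite /rho; case: ifP => // _; rewrite lee_fin mulr_ge0 ?invr_ge0 ?enorm_ge0.
apply: (@le_trans _ _ (\int[@lebesgue_rV R n]_x (rho x ^+ n))%E); last first.
  rewrite EFinM -muleA -(shell_mass_exp N fx r0) /shell_mass -ge0_integralZl_EFin //; last 2 first.
  - by move=> x _; exact: shell_density_ge0.
  - exact: measurable_shell_density.
  apply: ge0_le_integral => //.
  - by move=> x _; exact: expe_ge0.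
  - exact: emeasurable_funX.
  - by apply: emeasurable_funM => //; exact: measurable_shell_density.
  move=> x _; rewrite /rho /shell_density; case: ifP => [/andP[hx /andP[h1 h2]]|_].
    by rewrite hx (ltW h1) h2 /= -EFin_expe -EFinM exprMn.
  rewrite -EFin_expe expr0n gtn_eqF //= mule_ge0 //; last exact: shell_density_ge0.
apply: ereal_inf_lbound; exists rho => //; split => // c [L [g [[-> L0 gc gn gp] [gH gE gF]]]] lr.
have plfin : (path_length g 0 L < +oo)%E.
  by apply: (lr (0, L)); split => //=; rewrite in_itv /= ?lexx ?L0.
have plge0 := pl_ge0 g L0.
set l := fine (path_length g 0 L).
have lE : path_length g 0 L = l%:E by rewrite fineK // ge0_fin_numE.
have l0 : 0 <= l by rewrite -lee_fin -lE.
apply: (@le_trans _ _ (arc_integral rho g 0 L)); last first.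
  apply: ereal_sup_ubound; exists (0, L) => //.
  by split => //=; rewrite in_itv /= ?lexx ?L0.
set ga := arclength_param g 0 L.
have gaH s : 0 <= s -> s <= l -> H (ga s).
  move=> s0 sl; have [|t [t0 tL Et]] := pl_ivt L0 gc plfin s0; first by rewrite lE lee_fin.
  by rewrite /ga (arclength_paramE plfin t0 tL Et).
have ga0 : ga 0 = g 0 by rewrite /ga (@arclength_paramE _ _ _ _ _ plfin 0 0) ?plxx.
have gal : ga l = g L by rewrite /ga (@arclength_paramE _ _ _ _ _ plfin l L).
have gaL s t : 0 <= s -> s <= t -> t <= l -> enorm (ga t - ga s) <= t - s.
  by move=> s0 st tl; apply: arclength_lip => //; rewrite lE lee_fin.
have cl_rng := clamp_rng l0.
have clE := @clampE R l.
have cl_lip := @clamp_lip R l.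
pose cl := clamp l.
(* Clamping extends the distance function, controlled only on [0, l], to a 1-Lipschitz function on
   the whole line. *)
pose m s := enorm (ga (cl s) - xi).
have lm' s t : s <= t -> `|m t - m s| <= t - s.
  move=> st; apply: le_trans (ler_dist_enorm _ _) _.
  rewrite opprB addrA subrK.
  have /andP[c1 c2] := cl_lip s t st; have /andP[s1 s2] := cl_rng s; have /andP[t1 t2] := cl_rng t.
  by apply: le_trans (gaL _ _ _ _ _) c2 => //; lra.
have lm : lip1 m.
  move=> s t; have [st|/ltW st] := leP s t.
    by rewrite distrC [leRHS]distrC (ger0_norm (_ : 0 <= t - s)) ?subr_ge0 //; exact: lm'.
  by rewrite (ger0_norm (_ : 0 <= s - t)) ?subr_ge0 //; exact: lm'.
have := @ln_le_shell_integral R m l r r' lm l0 r0 rr'.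
rewrite /m /cl !clE // ga0 gal => /(_ (hE _ gE) (hF _ gF)).
have -> : r' / r = expR N%:R by rewrite /r'; field; rewrite gt_eqF.
rewrite expRK => hN.
have mm : measurable_fun setT (fun s : measurableTypeR R => if (r < m s < r')%R then ((m s)^-1)%:E else 0%E : \bar R).
  have mm := continuous_measurable_fun (lip1_continuous lm).
  apply: measurable_fun_ifT => //; last exact: measurable_inv_lip1.
  by apply: measurable_and; exact: measurable_fun_ltr.
have -> : 1%E = ((N%:R^-1)%:E * N%:R%:E)%E :> \bar R by rewrite -EFinM mulVf ?gt_eqF.
have Ni0 : (0 <= N%:R^-1%:E :> \bar R)%E by rewrite lee_fin invr_ge0.
apply: le_trans (lee_wpmul2l Ni0 hN) _.
rewrite -ge0_integralZl_EFin //; last 2 first.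
- by move=> s _; case: ifP => // _; rewrite lee_fin invr_ge0 enorm_ge0.
- exact: measurable_funTS.
rewrite /arc_integral -/l -/ga le_eqVlt; apply/orP; left; apply/eqP; apply: eq_integral => s.
rewrite inE /= in_itv /= => /andP[s0 sl].
rewrite /rho asboolT ?gaH //= /m /cl ?clE //.
  by case: ifP => _; rewrite ?mule0 // -EFinM.
exact: gaH.
Qed.

End HalfSpace.

(** * The sharp lower bound for half-annuli *)

Section ShellLower.
Variables (R : realType) (n : nat).
Notation H := (half_space R n).
Notation mR := (measurableTypeR R).
Implicit Types (x y xi p q : 'rV[R]_n).

(** The bridge used by all lower bounds: a connection from E to F of rho-length below 1 refutes
    admissibility. *)
Lemma admissible_conn (E F : set 'rV[R]_n) (rho : borel_rV R n -> \bar R) k p q :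
  admissible (joining_curves E F) rho -> E p -> F q -> rho_conn H rho k p q -> 1 <= k.
Proof.
move=> [mrho rho0 adm] Ep Fq [L [g [ug g0 gL gH hk]]].
have [L0 gl gn gp _] := ug.
have h := adm (Curve `[0, L] g) _ (unit_speed_rectifiable ug).
have {}h := h (ex_intro _ L (ex_intro _ g (conj _ _))).
rewrite -lee_fin; apply: le_trans hk; apply: le_trans (unit_speed_line_integral ug mrho rho0).
apply: h; first by split => //; exact: enorm_lip_continuous gl.
by rewrite g0 gL.
Qed.

(* The tangent line of [a ^ k.+1] at [b]; integrating it replaces Hoelder's inequality. *)
Lemma tangent_power k (a b : R) : 0 <= a -> 0 <= b ->
  k.+1%:R * b ^+ k * a <= a ^+ k.+1 + k%:R * b ^+ k.+1.
Proof.
move=> a0 b0; elim: k => [|k IH]; first by rewrite !expr0 expr1 expr1; lra.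
have h1 : 0 <= (a - b) * (a ^+ k.+1 - b ^+ k.+1).
  have [ab|/ltW ba] := leP a b.
    by rewrite mulr_le0 // subr_le0 // lerXn2r.
  by rewrite mulr_ge0 // subr_ge0 // lerXn2r.
have h2 := ler_wpM2l b0 IH.
have e1 : b * (k.+1%:R * b ^+ k * a) = k.+1%:R * b ^+ k.+1 * a by rewrite exprS; ring.
have e2 : b * (a ^+ k.+1 + k%:R * b ^+ k.+1) = b * a ^+ k.+1 + k%:R * b ^+ k.+2 by rewrite [b ^+ k.+2]exprS; ring.
have e3 : (a - b) * (a ^+ k.+1 - b ^+ k.+1) = a ^+ k.+2 - b * a ^+ k.+1 - a * b ^+ k.+1 + b ^+ k.+2.
  by rewrite [a ^+ k.+2]exprS [b ^+ k.+2]exprS; ring.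
rewrite e1 e2 in h2; rewrite e3 in h1.
rewrite -[k.+2%:R]natr1 -[X in _ + X * _]natr1; lra.
Qed.

Lemma etangent_power k (a : \bar R) (b : R) : (0 <= a)%E -> 0 <= b ->
  ((k.+1%:R * b ^+ k)%:E * a <= a ^+ k.+1 + (k%:R * b ^+ k.+1)%:E)%E.
Proof.
case: a => [a| |] //.
  by rewrite lee_fin => a0 b0; rewrite -EFin_expe -EFinM -EFinD lee_fin tangent_power.
move=> _ b0; rewrite expeS (_ : +oo ^+ k = if k is 0 then 1 else +oo)%E; last first.
  by case: k => // k; elim: k => // k IH; rewrite expeS IH mulyy.
case: k => [|k]; first by rewrite mule1 addye // leey.
by rewrite mulyy addye // leey.
Qed.

(** The condition on u says that u lies in ]d/e, d], over which 1/u integrates to ln e = 1. *)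
Lemma integral_inv_le1 (d a b : R) : 0 < d -> 0 < a ->
  (\int[lebesgue_measure]_(u in `[a, b])
    (if (u <= d < u * expR 1)%R then (u^-1)%:E else 0) <= 1)%E.
Proof.
move=> d0 a0; pose e : R := expR 1.
have e1 : 1 < e by rewrite expR_gt1.
have e0 : 0 < e by apply: lt_trans e1.
have de : d / e < d by rewrite ltr_pdivrMr // ltr_pMr.
have de0 : 0 < d / e by rewrite divr_gt0.
have mf : measurable_fun setT (fun u : mR => if (u <= d < u * e)%R then (u^-1)%:E else 0%E : \bar R).
  apply: measurable_fun_ifT => //; last by apply/measurable_EFinP; exact: measurable_invr.
  by apply: measurable_and; [exact: measurable_fun_ler|apply: measurable_fun_ltr => //; exact: measurable_funM].
have mi : measurable_fun setT (fun u : mR => (u^-1)%:E : \bar R).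
  by apply/measurable_EFinP; exact: measurable_invr.
apply: (@le_trans _ _ (\int[lebesgue_measure]_(u in `[(d / e)%R, d]) (u^-1)%:E)%E).
  rewrite integral_mkcond [leRHS]integral_mkcond; apply: ge0_le_integral => //.
  - move=> u _; rewrite patchE; case: ifPn => //; rewrite inE /= in_itv /= => /andP[au _].
    by case: ifP => // _; rewrite lee_fin invr_ge0; lra.
  - by apply/(measurable_restrictT _ _).1 => //; exact: measurable_funTS.
  - by apply/(measurable_restrictT _ _).1 => //; exact: measurable_funTS.
  move=> u _; rewrite !patchE.
  have nn : (0 <= if u \in `[(d / e)%R, d]%classic then (u^-1)%:E else 0 :> \bar R)%E.
    by case: ifPn => //; rewrite inE /= in_itv /= => /andP[h _]; rewrite lee_fin invr_ge0; lra.
  case: ifP => // ; rewrite inE /= in_itv /= => /andP[au ub].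
  case: ifP => // /andP[ud due].
  by rewrite ifT // inE /= in_itv /= ud andbT ler_pdivrMr // ltW.
rewrite (@continuous_FTC2 _ (fun u => u^-1) (@ln R) (d / e) d de).
- rewrite -EFinB lee_fin lnM ?posrE ?invr_gt0 // lnV ?posrE // expRK; lra.
- apply: continuous_in_subspaceT => u; rewrite inE /= in_itv /= => /andP[h _].
  by apply: inv_continuous; rewrite gt_eqF //; lra.
- split.
  + by move=> u; rewrite in_itv /= => /andP[h _]; have [] := @is_derive1_ln R u ltac:(lra).
  + apply: cvg_at_right_filter; apply: continuous_ln; lra.
  + apply: cvg_at_left_filter; apply: continuous_ln; lra.
- move=> u; rewrite in_itv /= => /andP[h _].
  have := @is_derive1_ln R u ltac:(lra) => D; rewrite derive1E; exact: derive_val.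
Qed.

(** The tangent inequality is integrated against the shell density with a = |y - xi| rho(y) and b =
    1/(N+1), the value of a for the extremal density, so nothing is lost. The shell has mass (N+1)
    c0, and what remains is n b^(n-1) c0 - (n-1) b^(n-1) c0 = b^(n-1) c0. *)
Lemma power_integral_ge (rho : borel_rV R n -> \bar R) xi (r : R) N : (0 < n)%N -> on_hyperplane xi -> 0 < r ->
  measurable_fun setT rho -> (forall x, (0 <= rho x)%E) ->
  (unit_shell_mass R n <= \int[@lebesgue_rV R n]_y (shell_density xi r (r * expR N.+1%:R) y * ((enorm (y - xi))%:E * rho y)))%E ->
  ((N.+1%:R^-1 ^+ n * N.+1%:R)%:E * unit_shell_mass R n <= \int[@lebesgue_rV R n]_x (rho x ^+ n))%E.
Proof.
move=> n0 fx r0 mrho rho0.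
have mdist := measurable_dist xi.
pose r2 := r * expR N.+1%:R.
pose k1 := shell_density xi r r2.
pose d (y : 'rV[R]_n) := enorm (y - xi).
have mk1 : measurable_fun setT (fun y : borel_rV R n => (k1 y * ((d y)%:E * rho y))%E).
  apply: emeasurable_funM; first exact: measurable_shell_density.
  by apply: emeasurable_funM => //; apply/measurable_EFinP.
have k1r0 y : (0 <= k1 y * ((d y)%:E * rho y))%E.
  by rewrite mule_ge0 ?shell_density_ge0 // mule_ge0 // lee_fin enorm_ge0.
have [k nk] : exists k, n = k.+1 by exists n.-1; rewrite prednK.
pose b : R := N.+1%:R^-1.
have b0 : 0 < b by rewrite invr_gt0 ltr0n.
have bN : b * N.+1%:R = 1 by rewrite mulVf // pnatr_eq0.
have bk0 : 0 <= b ^+ k by rewrite exprn_ge0 // ltW.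
have rn0 x : (0 <= rho x ^+ n)%E by exact: expe_ge0.
have mrn : measurable_fun setT (fun x : borel_rV R n => (rho x ^+ n)%E) by exact: emeasurable_funX.
have c1 : 0 <= k%:R * b ^+ n by rewrite mulr_ge0 // exprn_ge0 // ltW.
have c2 : 0 <= n%:R * b ^+ k by rewrite mulr_ge0.
have tang : ((n%:R * b ^+ k)%:E * \int[@lebesgue_rV R n]_y (k1 y * ((d y)%:E * rho y)) <=
   \int[@lebesgue_rV R n]_y (rho y ^+ n) + (k%:R * b ^+ n)%:E * shell_mass xi r r2)%E.
  rewrite /shell_mass -ge0_integralZl_EFin // -[X in (_ <= _ + X)%E]ge0_integralZl_EFin //; last 2 first.
  - by move=> x _; exact: shell_density_ge0.
  - exact: measurable_shell_density.
  rewrite -ge0_integralD //; last 2 first.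
  - by move=> x _; rewrite mule_ge0 ?shell_density_ge0 // lee_fin.
  - by apply: emeasurable_funM => //; exact: measurable_shell_density.
  apply: ge0_le_integral => //.
  - by move=> x _; rewrite mule_ge0 // lee_fin.
  - exact: emeasurable_funM.
  - apply: emeasurable_funD => //; apply: emeasurable_funM => //; exact: measurable_shell_density.
  move=> y _; rewrite muleCA.
  have a0 : (0 <= (d y)%:E * rho y)%E by rewrite mule_ge0 // lee_fin enorm_ge0.
  have k1y : (0 <= k1 y)%E by exact: shell_density_ge0.
  have := etangent_power k a0 (ltW b0); rewrite -nk => /(lee_wpmul2l k1y) h.
  apply: le_trans h _; rewrite ge0_muleDr ?expe_ge0 ?lee_fin //.
  apply: leeD; last by rewrite muleC.
  rewrite /k1 /shell_density; case: ifP => [/andP[_ /andP[h1 _]]|_]; last by rewrite mul0e.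
  have dy0 : 0 < d y by exact: lt_le_trans h1.
  case Erho : (rho y) (rho0 y) => [v| |] // v0; last first.
    rewrite (_ : +oo ^+ n = +oo)%E ?leey // nk.
    by elim: k {nk bk0 c1 c2} => [|k IH]; rewrite ?expe1 // expeS IH mulyy.
  rewrite -EFinM -!EFin_expe -EFinM lee_fin -exprMn mulrA mulVf ?gt_eqF // mul1r.
  exact: lexx.
rewrite /r2 shell_mass_exp // in tang.
move=> cle; have {}tang := le_trans (lee_wpmul2l (_ : 0 <= (n%:R * b ^+ k)%:E)%E cle) tang.
have {}tang := tang c2.
have cf : unit_shell_mass R n = (fine (unit_shell_mass R n))%:E by rewrite fineK // ge0_fin_numE ?unit_shell_mass_ge0 ?unit_shell_mass_fin.
move: tang; rewrite -/b cf; set c := fine _.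
case: (\int[_]_x _)%E => [j| |].
- rewrite -!EFinM -EFinD !lee_fin.
  have -> : k%:R * b ^+ n * (N.+1%:R * c) = k%:R * b ^+ k * c * (b * N.+1%:R) by rewrite nk exprS; ring.
  have -> : b ^+ n * N.+1%:R * c = b ^+ k * c * (b * N.+1%:R) by rewrite nk exprS; ring.
  rewrite bN !mulr1 nk -natr1; lra.
- by move=> _; exact: leey.
- by rewrite -!EFinM addNye.
Qed.

(* A radial segment covers the logarithmic radius [N]; averaging the admissibility
   inequality over the unit shell (Tonelli and scaling instead of polar coordinates)
   spreads it over a shell of logarithmic width [N.+1]. *)
Lemma modulus_ge_shell (E F : set 'rV[R]_n) xi (r : R) N : (0 < n)%N -> on_hyperplane xi -> 0 < r -> (0 < N)%N ->
  (forall x, H x -> enorm (x - xi) <= r * expR 1 -> E x) ->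
  (forall x, H x -> r * expR N%:R <= enorm (x - xi) -> F x) ->
  ((N.+1%:R^-1 ^+ n * N.+1%:R)%:E * unit_shell_mass R n <= modulus (joining_curves E F))%E.
Proof.
move=> n0 fx r0 N0 hE hF; apply: le_ereal_inf_tmp => _ [rho adm <-].
have [mrho rho0 _] := adm.
have mdist := measurable_dist xi.
pose dl := r * expR N%:R - r.
have eN1 : 1 < expR N%:R :> R by rewrite expR_gt1 ltr0n.
have e1 : 1 < expR 1 :> R by rewrite expR_gt1.
have dl0 : 0 < dl by rewrite subr_gt0 ltr_pMr.
(* The radial segment through x is xi + u(t) x with t in [0, 1]. For 1 <= |x| < e it starts within r
   e of xi, hence in E, and ends at distance at least r exp N, hence in F; all its points lie in the
   shell from r to r exp(N+1). *)
pose u (t : R) := r + t * dl.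
have u_rng t : 0 <= t <= 1 -> r <= u t <= r * expR N%:R.
  move=> /andP[t0 t1]; have h0 : 0 <= t * dl by rewrite mulr_ge0 // ltW.
  have h1 : t * dl <= dl by rewrite ler_piMl // ltW.
  by rewrite /u; move: h0 h1; rewrite /dl; lra.
pose r2 := r * expR N.+1%:R.
have r2E : r2 = r * expR N%:R * expR 1 by rewrite /r2 -natr1 expRD mulrA.
pose k0 := shell_density 0 1 (expR 1) : 'rV[R]_n -> \bar R.
pose k1 := shell_density xi r r2.
pose d (y : 'rV[R]_n) := enorm (y - xi).
have mu_ : measurable_fun [set: mR] (u : mR -> mR).
  by apply: measurable_funD => //; apply: measurable_funM.
have mseg : measurable_fun [set: mR * borel_rV R n]
    (fun z : mR * borel_rV R n => rho (xi + u z.1 *: z.2)).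
  apply: (measurableT_comp mrho); apply: measurable_rV => i.
  under eq_fun do rewrite !mxE.
  apply: measurable_funD => //; apply: measurable_funM.
    by apply: (measurableT_comp mu_); exact: measurable_fst.
  by apply: (measurableT_comp (@measurable_coord R n i)); exact: measurable_snd.
have mI01 d' (T : measurableType d') (f : T -> mR) : measurable_fun setT f ->
    measurable_fun setT (fun z => 0 <= f z <= 1).
  by move=> mf; apply: measurable_and; exact: measurable_fun_ler.
(* [G] spreads the rho-length of the radial segments over t and over the unit shell, with weight
   [k0]; [W] below is the same quantity expressed at the point y = xi + u(t) x. *)
pose G (z : mR * borel_rV R n) : \bar R := if 0 <= z.1 <= 1 then
   (k0 z.2 * ((dl * enorm z.2)%:E * rho (xi + u z.1 *: z.2)%R))%E else 0%E.
have G0 z : (0 <= G z)%E.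
  rewrite /G; case: ifP => // _; rewrite mule_ge0 ?shell_density_ge0 // mule_ge0 //.
  by rewrite lee_fin mulr_ge0 ?enorm_ge0 // ltW.
have men : measurable_fun [set: borel_rV R n] (fun x : borel_rV R n => enorm x : mR).
  by apply: continuous_measurable_rVR; exact: continuous_enorm.
have mG : measurable_fun setT G.
  apply: measurable_fun_ifT => //.
    by apply: mI01; exact: measurable_fst.
  apply: emeasurable_funM.
    by apply: (measurableT_comp (measurable_shell_density 0 1 (expR 1))); exact: measurable_snd.
  apply: emeasurable_funM => //; apply/measurable_EFinP; apply: measurable_funM => //.
  by apply: (measurableT_comp men); exact: measurable_snd.
pose W (z : mR * borel_rV R n) : \bar R := if (0 <= z.1 <= 1) && (u z.1 <= d z.2 < u z.1 * expR 1) then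
   ((dl * (u z.1)^-1)%:E * (k1 z.2 * ((d z.2)%:E * rho z.2)))%E else 0%E.
have uge t : 0 <= t <= 1 -> 0 < u t.
  by move=> /u_rng /andP[h _]; exact: lt_le_trans h.
have W0 z : (0 <= W z)%E.
  rewrite /W; case: ifP => // /andP[/uge h _]; rewrite mule_ge0 //.
    by rewrite lee_fin mulr_ge0 ?invr_ge0 // ltW.
  by rewrite mule_ge0 ?shell_density_ge0 // mule_ge0 // lee_fin enorm_ge0.
have mW : measurable_fun setT W.
  have mu1 : measurable_fun setT (fun z : mR * borel_rV R n => u z.1 : mR).
    by apply: (measurableT_comp mu_); exact: measurable_fst.
  have md2 : measurable_fun setT (fun z : mR * borel_rV R n => d z.2 : mR).
    by apply: (measurableT_comp mdist); exact: measurable_snd.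
  apply: measurable_fun_ifT => //.
    apply: measurable_and; first by apply: mI01; exact: measurable_fst.
    apply: measurable_and; first exact: measurable_fun_ler.
    by apply: measurable_fun_ltr => //; exact: measurable_funM.
  apply: emeasurable_funM.
    apply/measurable_EFinP; apply: measurable_funM => //.
    exact: (measurableT_comp (@measurable_invr R) mu1).
  apply: emeasurable_funM.
    by apply: (measurableT_comp (measurable_shell_density xi r r2)); exact: measurable_snd.
  apply: emeasurable_funM; first exact/measurable_EFinP.
  by apply: (measurableT_comp mrho); exact: measurable_snd.
have step2 : (\int[@lebesgue_rV R n]_x \int[lebesgue_measure]_t G (t, x) =
     \int[lebesgue_measure]_t \int[@lebesgue_rV R n]_x G (t, x))%E.
  by rewrite -(fubini_tonelli G mG G0).
(* For fixed t substitute y = xi + u(t) x: the volume factor u(t)^n cancels against the density, and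
   dl |x| becomes dl |y - xi| / u(t). *)
have step3 : (\int[lebesgue_measure]_t \int[@lebesgue_rV R n]_x G (t, x) =
     \int[lebesgue_measure]_t \int[@lebesgue_rV R n]_y W (t, y))%E.
  apply: eq_integral => t _.
  have [t01|t01] := boolP (0 <= t <= 1); last first.
    transitivity (0 : \bar R)%E.
      by rewrite integral0_eq // => x _; rewrite /G /= (negbTE t01).
    by rewrite integral0_eq // => x _; rewrite /W /= (negbTE t01).
  have ut := uge t t01; have /andP[ut1 ut2] := u_rng t t01.
  have mWt : measurable_fun setT (fun y : borel_rV R n => W (t, y)).
    exact: (measurableT_comp mW (measurable_pair1 t)).
  rewrite [RHS](@integral_rV_affine R n xi (u t)) //.
  rewrite -ge0_integralZl_EFin //; last 2 first.
  - apply: (measurableT_comp mWt); apply: measurable_rV => i; under eq_fun do rewrite !mxE.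
    by apply: measurable_funD => //; apply: measurable_funM => //; exact: measurable_coord.
  - by rewrite exprn_ge0 // ltW.
  apply: eq_integral => x _; rewrite /G /W /= t01 /= /d addrAC subrr add0r enormZ gtr0_norm //.
  have -> : (u t <= u t * enorm x < u t * expR 1) = (1 <= enorm x < expR 1).
    by rewrite -{1}[u t]mulr1 ler_pM2l // ltr_pM2l.
  rewrite /k0 /k1 /shell_density subr0 addrAC subrr add0r enormZ gtr0_norm //.
  rewrite (_ : `[< H (xi + u t *: x) >] = `[< H x >]); last first.
    by apply: asbool_equiv_eq; exact: half_space_affine.
  case: ifPn => [/andP[h1 h2]|]; last first.
    rewrite negb_and => /orP[h|h].
      by rewrite (negbTE h) /= mul0e; case: ifP => _; rewrite ?mul0e !mule0.
    by rewrite (negbTE h) /= mul0e mule0.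
  rewrite h2 h1; have /andP[x1 x2] := h2.
  rewrite ifT; last first.
    rewrite (le_trans ut1) ?ler_peMr ?(ltW ut) //=.
    by rewrite r2E; apply: (@lt_le_trans _ _ (u t * expR 1)); rewrite ?ltr_pM2l // ler_pM2r ?expR_gt0.
  rewrite !muleA -!EFinM; congr (_%:E * _)%E.
  have x0 : enorm x != 0 by rewrite gt_eqF // (lt_le_trans _ x1).
  rewrite invfM exprMn.
  transitivity ((u t ^+ n * (u t)^-1 ^+ n) * ((enorm x)^-1 ^+ n * (dl * enorm x)) * ((u t)^-1 * u t)).
    by rewrite -exprMn divff ?gt_eqF // expr1n mul1r mulVf ?gt_eqF // mulr1.
  ring.
have step4 : (\int[lebesgue_measure]_t \int[@lebesgue_rV R n]_y W (t, y) =
     \int[@lebesgue_rV R n]_y \int[lebesgue_measure]_t W (t, y))%E.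
  by rewrite (fubini_tonelli W mW W0).
have mk1 : measurable_fun setT (fun y : borel_rV R n => (k1 y * ((d y)%:E * rho y))%E).
  apply: emeasurable_funM; first exact: measurable_shell_density.
  by apply: emeasurable_funM => //; apply/measurable_EFinP.
have k1r0 y : (0 <= k1 y * ((d y)%:E * rho y))%E.
  by rewrite mule_ge0 ?shell_density_ge0 // mule_ge0 // lee_fin enorm_ge0.
apply: (power_integral_ge n0 fx r0 mrho rho0).
apply: (@le_trans _ _ (\int[@lebesgue_rV R n]_x \int[lebesgue_measure]_t G (t, x))%E).
  apply: ge0_le_integral => //.
  - by move=> x _; exact: shell_density_ge0.
  - exact: measurable_shell_density.
  - by apply: (@measurable_fun_fubini_tonelli_G _ _ mR (borel_rV R n) R lebesgue_measure G).
  move=> x _; rewrite -/k0.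
  have [/eqP ->|kx0] := boolP (k0 x == 0%E); first by apply: integral_ge0.
  have : k0 x != 0%E := kx0.
  rewrite {1}/k0 /shell_density subr0; case: ifP => [|_]; last by rewrite eqxx.
  move=> /andP[/asboolP Hx /andP[x1 x2]] _.
  pose p := xi + r *: x; pose q := xi + (r * expR N%:R) *: x.
  have qp : q - p = dl *: x.
    by rewrite /q /p opprD addrACA subrr add0r -scalerBl.
  have pt t : p + t *: (q - p) = xi + u t *: x.
    by rewrite qp /p /u scalerA -addrA -scalerDl.
  have eqp : enorm (q - p) = dl * enorm x by rewrite qp enormZ gtr0_norm.
  have Ep : E p.
    apply: hE; first by apply/half_space_affine.
    by rewrite /p addrAC subrr add0r enormZ gtr0_norm // ler_pM2l // ltW.
  have Fq : F q.
    apply: hF; first by apply/half_space_affine => //; rewrite mulr_gt0 // expR_gt0.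
    have h0 : 0 < r * expR N%:R by rewrite mulr_gt0 // expR_gt0.
    by rewrite /q addrAC subrr add0r enormZ gtr0_norm // ler_peMr // ltW.
  have len : (1 <= (dl * enorm x)%:E * \int[lebesgue_measure]_(t in `[0%R, 1%R]) rho (xi + u t *: x)%R)%E.
    rewrite leNgt; apply/negP => lt1.
    have Lge : (0 <= (dl * enorm x)%:E * \int[lebesgue_measure]_(t in `[0%R, 1%R]) rho (xi + u t *: x)%R)%E.
      by rewrite mule_ge0 // ?integral_ge0 // lee_fin mulr_ge0 ?enorm_ge0 // ltW.
    set X := ((dl * enorm x)%:E * _)%E in lt1 Lge.
    have Xf : X \is a fin_num by rewrite ge0_fin_numE // (lt_trans lt1) // ltry.
    have c : rho_conn H rho (fine X) p q.
      apply: rho_conn_seg => //; first exact: fine_ge0.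
        move=> t t0 t1; rewrite pt; apply/half_space_affine => //.
        by apply: uge; rewrite t0.
      rewrite eqp fineK // /X le_eqVlt; apply/orP; left; apply/eqP; congr (_ * _)%E.
      by apply: eq_integral => t _; rewrite pt.
    have := admissible_conn adm Ep Fq c.
    by rewrite -lee_fin fineK // leNgt lt1.
  have mr : measurable_fun setT (fun t : mR => rho (xi + u t *: x)).
    exact: (measurableT_comp mseg (measurable_pair2 x)).
  have k0x := shell_density_ge0 0 1 (expR 1) x; rewrite -/k0 in k0x.
  have dx : 0 <= dl * enorm x by rewrite mulr_ge0 ?enorm_ge0 // ltW.
  rewrite -[leLHS]mule1; apply: le_trans (lee_wpmul2l k0x len) _.
  rewrite -ge0_integralZl_EFin //; last exact: measurable_funTS.
  have k0f : k0 x = (fine (k0 x))%:E.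
    by rewrite fineK // /k0 /shell_density; case: ifP.
  rewrite k0f -ge0_integralZl_EFin //; last 3 first.
  - by move=> t _; rewrite mule_ge0.
  - by apply: measurable_funTS; exact: emeasurable_funM.
  - exact: fine_ge0.
  rewrite integral_mkcond le_eqVlt; apply/orP; left; apply/eqP; apply: eq_integral => t _.
  by rewrite patchE /G /= mem_setE in_itv /= -k0f.
rewrite step2 step3 step4.
apply: (@ge0_le_integral _ (borel_rV R n) R (@lebesgue_rV R n) setT measurableT _ _ _ _ mk1).
- by move=> y _; apply: integral_ge0 => t _; exact: W0.
- exact: (@measurable_fun_fubini_tonelli_G _ _ mR (borel_rV R n) R lebesgue_measure W).
(* The total weight of y is an integral over t; with v = u(t) it becomes the integral of 1/v over
   those v for which y lies in the unit shell dilated by v, and this is at most 1. *)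
move=> y _; have [d0|d0] := ltP 0 (d y); last first.
  rewrite integral0_eq // => t _; rewrite /W /=; case: ifP => // /andP[/uge h /andP[h1 _]]; exfalso; lra.
pose hf (v : R) : \bar R := if v <= d y < v * expR 1 then (v^-1)%:E else 0%E.
have hf0 v : 0 < v -> (0 <= hf v)%E.
  by move=> v0; rewrite /hf; case: ifP => // _; rewrite lee_fin invr_ge0 ltW.
have mhf : measurable_fun [set: mR] (hf : mR -> \bar R).
  apply: measurable_fun_ifT => //; last by apply/measurable_EFinP; exact: measurable_invr.
  apply: measurable_and; first exact: measurable_fun_ler.
  by apply: measurable_fun_ltr => //; exact: measurable_funM.
(* Cutting [hf] off at v <= 0 makes it nonnegative on the whole line, as the affine substitution
   requires. *)
pose hp (v : R) : \bar R := if 0 < v then hf v else 0%E.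
have hp0 v : (0 <= hp v)%E by rewrite /hp; case: ifP => // /hf0.
have mhp : measurable_fun [set: mR] (hp : mR -> \bar R).
  by apply: measurable_fun_ifT => //; exact: measurable_fun_ltr.
set X := (k1 y * _)%E.
have X0 : (0 <= X)%E by exact: k1r0.
have mhu : measurable_fun [set: mR] (fun t : mR => hp (u t)) := measurableT_comp mhp mu_.
have dlhp0 t : (0 <= dl%:E * hp (u t))%E by rewrite mule_ge0 // lee_fin ltW.
have WE : (\int[lebesgue_measure]_t W (t, y) =
   X * \int[lebesgue_measure]_(t in `[0%R, 1%R]) (dl%:E * hp (u t)))%E.
  rewrite muleC -ge0_integralZr //; last by apply: measurable_funTS; exact: emeasurable_funM.
  rewrite [RHS]integral_mkcond; apply: eq_integral => t _.
  rewrite patchE mem_setE in_itv /= /W /=; case: ifPn => [/andP[t01 cd]|].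
    by rewrite t01 /hp uge // /hf cd EFinM.
  case: (boolP (0 <= t <= 1)) => //= t01 cd.
  by rewrite /hp uge // /hf (negbTE cd) mule0 mul0e.
rewrite WE -[leRHS]mule1; apply: lee_wpmul2l => //.
rewrite ge0_integralZl_EFin //; last 2 first.
- exact: measurable_funTS.
- exact: ltW.
have di0 : 0 < dl^-1 by rewrite invr_gt0.
have := @integral_itv_affine R hp r (r * expR N%:R) dl^-1 _ di0 mhp hp0.
rewrite -/dl divff ?gt_eqF // => /(_ _) E1.
under eq_integral do rewrite /u -[X in (_ * X)%R]invrK.
rewrite E1; last by rewrite ler_peMr // ltW.
rewrite muleA -EFinM divff ?gt_eqF // mul1e.
apply: le_trans (@integral_inv_le1 (d y) r (r * expR N%:R) d0 r0).
rewrite le_eqVlt; apply/orP; left; apply/eqP; apply: eq_integral => v.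
by rewrite inE /= in_itv /= => /andP[v0 _]; rewrite /hp (lt_le_trans r0 v0).
Qed.

End ShellLower.

(** * A Loewner-type lower bound *)

Section Morrey.
Variable (R : realType).
Notation mR := (measurableTypeR R).

(** For m > 0 the integrand is singular at 0, so the fundamental theorem is applied on [1/(k+1), 1]
    with primitive (m+1) s^(1/(m+1)), followed by monotone convergence. *)
Lemma integral_pow_le (m : nat) :
  (\int[lebesgue_measure]_(s in `]0%R, 1%R]) (s `^ (m.+1%:R^-1 - 1))%:E <= m.+1%:R%:E :> \bar R)%E.
Proof.
pose g : R := m.+1%:R^-1.
have g0 : 0 < g by rewrite invr_gt0 ltr0n.
pose f (s : R) : R := s `^ (g - 1).
have mf : measurable_fun [set: mR] (EFin \o f) by apply/measurable_EFinP; exact: measurable_powR.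
have f0 s : (0 <= (f s)%:E)%E by rewrite lee_fin powR_ge0.
pose F (k : nat) : set mR := `]k.+1%:R^-1, 1]%classic.
have FU : \bigcup_k F k = `]0, 1]%classic.
  apply/seteqP; split => [x [k _]|x] /=; rewrite /F /= !in_itv /= => /andP[x0 x1].
    by rewrite x1 andbT (lt_trans _ x0) // invr_gt0.
  exists (Num.truncn x^-1) => //=; rewrite in_itv /= x1 andbT.
  by rewrite invf_plt ?posrE // truncnS_gt.
have H := @ge0_nondecreasing_set_cvg_integral _ mR R F (EFin \o f) lebesgue_measure.
rewrite FU in H.
have {}H : (\int[lebesgue_measure]_(x in F k) (EFin \o f) x)%E @[k --> \oo] --> (\int[lebesgue_measure]_(x in `]0%R, 1%R]) (EFin \o f) x)%E.
  apply: H => //.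
  - move=> i j ij; apply/subsetPset => x; rewrite /F /= !in_itv /= => /andP[h ->]; rewrite andbT.
    by apply: le_lt_trans h; rewrite lef_pV2 ?posrE ?ltr0n // ler_nat ltnS.
  - by move=> i; exact: measurable_itv.
  - by move=> i; apply: (measurable_funTS (f := EFin \o f)); exact: mf.
  - by move=> i x _; exact: f0.

rewrite -(cvg_lim _ H) //; apply: lime_le; first by apply/cvg_ex; eexists; exact: H.
near=> k; rewrite /F.
set e : R := k.+1%:R^-1.
have e0 : 0 < e by rewrite invr_gt0 ltr0n.
have [e1|e1] := ltP e 1; last first.
  rewrite set_itv_ge ?integral_set0 ?lee_fin //.
  by rewrite bnd_simp -leNgt.
rewrite integral_itv_obnd_cbnd; last exact: measurable_funTS.
pose P (s : R) := m.+1%:R * s `^ g.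
have dP (s : R) : 0 < s -> is_derive s 1 P (f s).
  move=> s0; have := @is_derive1_powR R g s s0 => h.
  have -> : f s = m.+1%:R * (g * s `^ (g - 1)).
    by rewrite mulrA /g divff ?mul1r // pnatr_eq0.
  exact: is_deriveZ.
have cP (s : R) : 0 < s -> {for s, continuous P}.
  move=> s0; apply: differentiable_continuous; apply/derivable1_diffP.
  by have [] := dP s s0.
rewrite (@continuous_FTC2 _ f P e 1 e1).
- rewrite -EFinB lee_fin /P powR1 mulr1 lerBlDr lerDl.
  by rewrite mulr_ge0 // powR_ge0.
- apply: continuous_in_subspaceT => s; rewrite inE /= in_itv /= => /andP[h _].
  have s0 : 0 < s by lra.
  have [d _] := @is_derive1_powR R (g - 1) s s0.
  by apply: differentiable_continuous; apply/derivable1_diffP.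
- split.
  + by move=> s; rewrite in_itv /= => /andP[h _]; have [] := dP s ltac:(lra).
  + by apply: cvg_at_right_filter; apply: cP.
  + by apply: cvg_at_left_filter; apply: cP; lra.
- move=> s; rewrite in_itv /= => /andP[h _].
  have D := dP s ltac:(lra); rewrite derive1E; exact: derive_val.
Unshelve. all: by end_near. Qed.

(** Young's inequality up to constants: either a <= b, or a/b > 1 and a <= a (a/b)^k. *)
Lemma young_pow (k : nat) (a : \bar R) (b : R) : (0 <= a)%E -> 0 < b ->
  (a <= b%:E + (b ^- k)%:E * a ^+ k.+1)%E.
Proof.
move=> a0 b0; have bk : 0 < b ^- k by rewrite invr_gt0 exprn_gt0.
case: a a0 => [a| |] // a0; last first.
  rewrite (_ : +oo ^+ k.+1 = +oo)%E; last by elim: k {bk} => // k IH; rewrite expeS IH mulyy.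
  by rewrite gt0_muley ?lte_fin // addey // leey.
rewrite -EFin_expe -EFinM -EFinD lee_fin.
rewrite lee_fin in a0.
have [ab|ba] := leP a b.
  by rewrite (le_trans ab) // lerDl mulr_ge0 // ?exprn_ge0 // ltW.
rewrite exprS mulrCA.
apply: (@le_trans _ _ (a * 1)); first by rewrite mulr1.
rewrite -[leLHS]add0r; apply: lerD; first exact: ltW.
rewrite ler_wpM2l // mulrC ler_pdivlMr ?exprn_gt0 // mul1r.
by rewrite lerXn2r ?nnegrE // ltW.
Qed.

Lemma box_convex n (a b : 'I_n -> R) (p z : 'rV[R]_n) (s : R) :
  box a b p -> box a b z -> 0 <= s <= 1 -> box a b (p + s *: (z - p)).
Proof.
move=> hp hz /andP[s0 s1] i; have := hp i; have := hz i; rewrite !mxE => /andP[z1 z2] /andP[p1 p2].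
have h1 : 0 <= s * (z ord0 i - a i) by rewrite mulr_ge0 // subr_ge0 ltW.
have h2 : 0 <= s * (b i - z ord0 i) by rewrite mulr_ge0 // subr_ge0 ltW.
have [->|s1'] := eqVneq s 1; first by lra.
have s1'' : s < 1 by rewrite lt_neqAle s1'.
have h3 : 0 < (1 - s) * (p ord0 i - a i) by rewrite mulr_gt0 // subr_gt0.
have h4 : 0 < (1 - s) * (b i - p ord0 i) by rewrite mulr_gt0 // subr_gt0.
by apply/andP; split; lra.
Qed.

(* Young's inequality with the weight [s ^ (1/(m+1) - 1)], which is chosen so that both
   resulting integrals over ]0, 1] converge. *)
Lemma morrey_average m (G : borel_rV R m -> \bar R) (a b : 'I_m -> R) p (dl : R) :
  measurable_fun setT G -> (forall x, (0 <= G x)%E) -> box a b p -> 0 < dl ->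
  (\int[@lebesgue_rV R m]_(z in box a b) \int[lebesgue_measure]_(s in `]0%R, 1%R]) G (p + s *: (z - p))%R <=
   m.+1%:R%:E * (dl%:E * lebesgue_rV (box a b : set (borel_rV R m)) +
     (dl ^- m)%:E * \int[@lebesgue_rV R m]_(z in box a b) (G z ^+ m.+1)))%E.
Proof.
move=> mG G0 bp dl0; set Q := box a b.
have mQ : measurable (Q : set (borel_rV R m)) by exact: box_measurable.
have mseg : measurable_fun [set: mR * borel_rV R m]
    (fun z : mR * borel_rV R m => G (p + z.1 *: (z.2 - p))).
  apply: (measurableT_comp mG); apply: measurable_rV => i.
  under eq_fun do rewrite !mxE.
  apply: measurable_funD => //; apply: measurable_funM; first exact: measurable_fst.
  apply: measurable_funB => //.
  by apply: (measurableT_comp (@measurable_coord R m i)); exact: measurable_snd.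
pose I1 : set mR := `]0, 1]%classic.
have mI1 : measurable I1 by exact: measurable_itv.
pose T (w : mR * borel_rV R m) : \bar R := if (w.1 \in I1) && (w.2 \in Q) then G (p + w.1 *: (w.2 - p)) else 0%E.
have T0 w : (0 <= T w)%E by rewrite /T; case: ifP.
have mI1b : measurable_fun [set: mR] (fun s : mR => s \in I1).
  by apply: (measurable_fun_bool true); rewrite setTI (_ : _ @^-1` _ = I1); [exact: measurable_itv|apply/seteqP; split => s /= h; [exact: set_mem|exact: mem_set]].
have mQb : measurable_fun [set: borel_rV R m] (fun s : borel_rV R m => s \in Q).
  by apply: (measurable_fun_bool true); rewrite setTI (_ : _ @^-1` _ = Q); [exact: mQ|apply/seteqP; split => s /= h; [exact: set_mem|exact: mem_set]].
have mT : measurable_fun setT T.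
  apply: measurable_fun_ifT => //; apply: measurable_and.
    by apply: (measurableT_comp mI1b); exact: measurable_fst.
  by apply: (measurableT_comp mQb); exact: measurable_snd.
rewrite [leLHS](_ : _ = \int[@lebesgue_rV R m]_z \int[lebesgue_measure]_s T (s, z))%E; last first.
  rewrite integral_mkcond; apply: eq_integral => z _; rewrite patchE /T /=.
  case: ifPn => zQ; last by rewrite integral0_eq // => s _; rewrite andbF.
  by rewrite integral_mkcond; apply: eq_integral => s _; rewrite patchE andbT.
rewrite -(fubini_tonelli T mT T0).
set V := lebesgue_rV _; set M := (\int[@lebesgue_rV R m]_(z in Q) (G z ^+ m.+1))%E.
have V0 : (0 <= V)%E by exact: measure_ge0.
have M0 : (0 <= M)%E by apply: integral_ge0 => z _; exact: expe_ge0.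
have dm0 : 0 < dl ^- m by rewrite invr_gt0 exprn_gt0.
set X := (_ + _)%E.
have X0 : (0 <= X)%E by rewrite adde_ge0 // mule_ge0 // lee_fin ltW.
pose f (s : R) : R := s `^ (m.+1%:R^-1 - 1).
have mf : measurable_fun [set: mR] (EFin \o f) by apply/measurable_EFinP; exact: measurable_powR.
have f0 s : (0 <= (f s)%:E)%E by rewrite lee_fin powR_ge0.
apply: (@le_trans _ _ (\int[lebesgue_measure]_(s in I1) ((f s)%:E * X))%E); last first.
  rewrite ge0_integralZr //; last exact: measurable_funTS.
  by apply: lee_wpmul2r => //; exact: integral_pow_le.
rewrite [X in (_ <= X)%E]integral_mkcond; apply: ge0_le_integral => //.
- by move=> s _; apply: integral_ge0.
- by apply: (@measurable_fun_fubini_tonelli_F _ _ mR (borel_rV R m) R (@lebesgue_rV R m) T).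
- apply/(measurable_restrictT _ _).1 => //; apply: measurable_funTS; exact: emeasurable_funM.
move=> s _; rewrite patchE; case: ifPn => sI; last first.
  by rewrite integral0_eq // => z _; rewrite /T /= (negbTE sI).
have := sI; rewrite inE /I1 /= in_itv /= => /andP[s0 s1].
have fs0 : 0 < f s by rewrite powR_gt0.
(* This identity dictates the exponent of f: s^-m is the Jacobian factor of the dilation by s about
   p. With the Young parameter dl f(s), the second term carries f(s)^-m s^-m = f(s), so both terms
   are constants times f(s). *)
have fsE : f s ^+ m.+1 = s ^- m.
  rewrite -powR_mulrn ?powR_ge0 // -powRrM mulrBl mulVf ?pnatr_eq0 // mul1r -natr1.
  by rewrite opprD addrCA subrr addr0 powRN powR_mulrn // ltW.
pose h (z : borel_rV R m) : \bar R := if z \in Q then (G z ^+ m.+1)%E else 0%E.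
have h0 z : (0 <= h z)%E by rewrite /h; case: ifP => // _; exact: expe_ge0.
have mGm : measurable_fun setT (fun z : borel_rV R m => (G z ^+ m.+1)%E) by exact: emeasurable_funX.
have mh : measurable_fun setT h by apply: measurable_fun_ifT.
have q0 : p + s *: (0 - p) = (1 - s) *: p by rewrite sub0r scalerN scalerBl scale1r.
have pe z : p + s *: (z - p) = (1 - s) *: p + s *: z.
  by rewrite scalerBr addrCA [RHS]addrC scalerBl scale1r.
have mseg1 : measurable_fun setT (fun z : borel_rV R m => p + s *: (z - p) : borel_rV R m).
  apply: measurable_rV => i; under eq_fun do rewrite !mxE.
  by apply: measurable_funD => //; apply: measurable_funM => //; apply: measurable_funB => //; exact: measurable_coord.
have mhs : measurable_fun setT (fun z : borel_rV R m => h (p + s *: (z - p))) := measurableT_comp mh mseg1.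
have ME : (\int[@lebesgue_rV R m]_z h (p + s *: (z - p))%R = (s ^- m)%:E * M)%E.
  have ME : M = (\int[@lebesgue_rV R m]_z h z)%E by rewrite /M integral_mkcond; apply: eq_integral => z _; rewrite patchE.
  rewrite ME (@integral_rV_affine R m ((1 - s) *: p) s h) // muleA -EFinM mulVf ?gt_eqF ?exprn_gt0 // mul1e.
  by apply: eq_integral => z _; rewrite pe.
have IQ : (\int[@lebesgue_rV R m]_z (\1_Q z)%:E = V)%E by rewrite integral_indic // setIT.
have b0 : 0 < dl * f s by rewrite mulr_gt0.
apply: (@le_trans _ _ (\int[@lebesgue_rV R m]_z ((dl * f s)%:E * (\1_Q z)%:E + ((dl * f s) ^- m)%:E * h (p + s *: (z - p))%R))%E).
  have mi : measurable_fun setT (fun z : borel_rV R m => (\1_Q z)%:E : \bar R).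
    by apply/measurable_EFinP; exact: measurable_indic.
  apply: ge0_le_integral => //.
  - exact: (measurableT_comp mT (measurable_pair1 s)).
  - by apply: emeasurable_funD; apply: emeasurable_funM.
  move=> z _; rewrite /T /= sI /= indicE.
  have hh : (0 <= ((dl * f s) ^- m)%:E * h (p + s *: (z - p))%R)%E.
    by rewrite mule_ge0 // lee_fin invr_ge0 exprn_ge0 // ltW.
  case: ifPn => zQ; last by rewrite mule0 add0e.
  rewrite mule1 /h ifT; last first.
    rewrite inE in zQ; rewrite inE; apply: box_convex => //.
    by rewrite (ltW s0) s1.
  exact: young_pow.
rewrite ge0_integralD //; last 4 first.
- by move=> z _; rewrite -EFinM lee_fin mulr_ge0 // ltW.
- by apply: emeasurable_funM => //; apply/measurable_EFinP; exact: measurable_indic.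
- by move=> z _; rewrite mule_ge0 // lee_fin invr_ge0 exprn_ge0 // ltW.
- exact: emeasurable_funM.
rewrite ge0_integralZl_EFin //; last 2 first.
- by apply/measurable_EFinP; exact: measurable_indic.
- exact: ltW.
rewrite ge0_integralZl_EFin //; last by rewrite invr_ge0 exprn_ge0 // ltW.
rewrite IQ ME; clearbody V M; rewrite /X ge0_muleDr ?mule_ge0 ?lee_fin ?(ltW dm0) ?(ltW dl0) //.
rewrite !muleA -!EFinM le_eqVlt; apply/orP; left; apply/eqP; congr (_%:E * _ + _%:E * _)%E.
  by rewrite mulrC.
rewrite exprMn invfM.
have fm : f s ^- m * s ^- m = f s.
  by rewrite -fsE exprS mulrCA mulVf ?mulr1 // gt_eqF // exprn_gt0.
by rewrite -mulrA fm mulrC.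
Qed.

End Morrey.

(** * Short connections inside hyperplane slices *)

Section Loewner.
Variable (R : realType).
Notation mR := (measurableTypeR R).

Lemma exists_le_average d (T : measurableType d) (mu : {measure set T -> \bar R})
    (A : set T) (f : T -> \bar R) (c : R) :
  measurable A -> measurable_fun A f -> (forall x, A x -> (0 <= f x)%E) -> 0 <= c ->
  (\int[mu]_(x in A) f x < c%:E * mu A)%E -> exists2 x, A x & (f x < c%:E)%E.
Proof.
move=> mA mf f0 c0 h; apply: contrapT => H; move: h; apply/negP; rewrite -leNgt.
rewrite -integral_cst //; apply: ge0_le_integral => //.
move=> x Ax; rewrite leNgt; apply/negP => fx; apply: H; by exists x.
Qed.

Lemma ereal_add_lt_real (u v : \bar R) (c : R) : (0 <= u)%E -> (0 <= v)%E -> (u + v < c%:E)%E ->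
  exists a b, [/\ 0 <= a, 0 <= b, u = a%:E, v = b%:E & a + b < c].
Proof.
case: u => [a| |] //; case: v => [b| |] // a0 b0; rewrite -?EFinD ?lte_fin => h.
by exists a, b; split.
Qed.

Section conn.
Variables (n : nat) (D : set 'rV[R]_n) (rho : borel_rV R n -> \bar R).
Hypotheses (mrho : measurable_fun setT rho) (rho0 : forall x, (0 <= rho x)%E).

Lemma measurable_seg (p v : 'rV[R]_n) :
  measurable_fun [set: mR] (fun t : mR => rho (p + t *: v)).
Proof.
apply: (measurableT_comp mrho); apply: measurable_rV => i.
under eq_fun do rewrite !mxE.
by apply: measurable_funD => //; apply: measurable_funM.
Qed.

(** Averaging controls segments that issue from a given point; a path p, z, q runs its second half
    in the opposite direction, hence the substitution of 1 - t for t. *)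
Lemma rho_conn_seg_rev k p q : 0 <= k ->
  (forall t, 0 <= t -> t <= 1 -> D (p + t *: (q - p))) ->
  ((enorm (q - p))%:E * \int[lebesgue_measure]_(t in `[0%R, 1%R]) rho (p + t *: (q - p))%R <= k%:E)%E ->
  rho_conn D rho k q p.
Proof.
move=> k0 hD hk.
have e t : q + t *: (p - q) = p + (1 - t) *: (q - p).
  by rewrite -opprB scalerN scalerBl scale1r addrA [p + _]addrC subrK.
apply: (rho_conn_seg mrho rho0 k0).
  by move=> t t0 t1; rewrite e; apply: hD; lra.
apply: le_trans hk; rewrite enormB le_eqVlt; apply/orP; left; apply/eqP; congr (_ * _)%E.
rewrite integral_mkcond [RHS]integral_mkcond.
have ms := measurable_seg p (q - p).
rewrite [RHS](@integral_R_affine R 1 (-1)) ?oppr_eq0 ?oner_eq0 //; last 2 first.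
- by apply/(measurable_restrictT _ _).1 => //; exact: measurable_funTS.
- by move=> x; rewrite patchE; case: ifP.
rewrite normrN normr1 mul1e; apply: eq_integral => t _; rewrite !patchE e mulN1r.
have -> // : (t \in `[0, 1]%classic) = (1 - t \in `[0, 1]%classic).
by apply/idP/idP; rewrite !inE /= !in_itv /=; lra.
Qed.

End conn.

Section slices.
Variable m : nat.
Let n := m.+1.
Variables (lo hi : 'I_n -> R) (Dm : R).
Hypotheses (D0 : 0 < Dm) (lohi : forall i, Dm <= hi i - lo i <= 2 * Dm).
Variable rho : borel_rV R n -> \bar R.
Hypotheses (mrho : measurable_fun setT rho) (rho0 : forall x, (0 <= rho x)%E).
Let B := box lo hi.

(** Energy of rho, with exponent n, on the (n-1)-dimensional slice x_j = t of the box. The side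
    lengths are allowed to range from Dm to 2 Dm because the boxes will be cubes truncated by the
    half-space. *)
Definition slice_energy (j : 'I_n) (t : R) : \bar R :=
  (\int[@lebesgue_rV R m]_x (if `[< B (insert_coord j t x) >] then (rho (insert_coord j t x) ^+ n) else 0))%E.

(** The threshold at which the two terms of [morrey_average] balance in [slice_conn]: with dl =
    1/(64 n^2 Dm), both dl V and dl^-m eps0/Dm are at most V/(64 n^2 Dm), where V >= Dm^m is the
    volume of the slice. *)
Let eps0 : R := (64 * n%:R * n%:R * (64 * n%:R * n%:R) ^+ m)^-1.

Let nn0 : 0 < n%:R * n%:R :> R.
Proof. by rewrite mulr_gt0. Qed.

Lemma eps0_gt0 : 0 < eps0.
Proof. by rewrite /eps0 invr_gt0 mulr_gt0 ?exprn_gt0 //; rewrite -mulrA mulr_gt0. Qed.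

Definition drop_coord (j : 'I_n) (p : 'rV[R]_n) : 'rV[R]_m := \row_k p ord0 (lift j k).

Lemma insert_drop_coord j (p : 'rV[R]_n) : insert_coord j (p ord0 j) (drop_coord j p) = p.
Proof.
apply/rowP => i; case: (unliftP j i) => [k ->|->]; first by rewrite insert_coord_lift mxE.
by rewrite insert_coord_self.
Qed.

Lemma insert_coord_affine (j : 'I_n) t (x z : 'rV[R]_m) s :
  insert_coord j t (x + s *: (z - x)) = insert_coord j t x + s *: (insert_coord j t z - insert_coord j t x).
Proof.
apply/rowP => i; case: (unliftP j i) => [k ->|->].
  by rewrite !mxE !liftK !mxE.
by rewrite !mxE !unlift_none subrr mulr0 addr0.
Qed.

Lemma box_insert_coord (j : 'I_n) t x : B (insert_coord j t x) <->
  lo j < t < hi j /\ box (lo \o lift j) (hi \o lift j) x.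
Proof.
split=> [h|[h1 h2] i]; first by split => [|k]; [have := h j; rewrite insert_coord_self|have := h (lift j k); rewrite insert_coord_lift].
by case: (unliftP j i) => [k ->|->]; rewrite ?insert_coord_lift ?insert_coord_self //; exact: h2.
Qed.

Lemma insert_coord_dist_le (j : 'I_n) t (x z : 'rV[R]_m) :
  box (lo \o lift j) (hi \o lift j) x -> box (lo \o lift j) (hi \o lift j) z ->
  enorm (insert_coord j t z - insert_coord j t x) <= n%:R * (2 * Dm).
Proof.
move=> Qx Qz; apply: le_trans (enorm_le_sum _) _.
rewrite -[X in X%:R * _](card_ord n) -sumr_const mulr_suml; apply: ler_sum => i _.
rewrite mul1r (_ : (insert_coord j t z - insert_coord j t x) ord0 i = insert_coord j t z ord0 i - insert_coord j t x ord0 i); last by rewrite [LHS]mxE [X in _ + X]mxE.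
case: (unliftP j i) => [k ->|->]; last first.
  by rewrite !insert_coord_self subrr normr0 mulr_ge0 // ltW.
rewrite !insert_coord_lift ler_norml.
have := lohi (lift j k); have := Qx k; have := Qz k => /=.
move: (x ord0 k) (z ord0 k) (lo (lift j k)) (hi (lift j k)) => a b c d.
move=> /andP[h1 h2] /andP[h3 h4] /andP[h5 h6].
by apply/andP; split; lra.
Qed.

(** The rho-integrals along the segments from p, and from q, to a point z of the slice are small on
    average over z. Some z is good for p and q simultaneously, and the broken line through it is the
    connection. *)
Lemma slice_conn (j : 'I_n) (p q : 'rV[R]_n) : B p -> B q -> p ord0 j = q ord0 j ->
  (slice_energy j (p ord0 j) <= (eps0 / Dm)%:E)%E -> rho_conn B rho (1/4) p q.
Proof.
move=> Bp Bq pq he; set t := p ord0 j in pq he.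
pose Q := @box R m (lo \o lift j) (hi \o lift j).
pose p' := drop_coord j p; pose q' := drop_coord j q.
have pE : p = insert_coord j t p' by rewrite /t insert_drop_coord.
have qE : q = insert_coord j t q' by rewrite pq insert_drop_coord.
have [tj Qp] : lo j < t < hi j /\ Q p' by apply/box_insert_coord; rewrite -pE.
have [_ Qq] : lo j < t < hi j /\ Q q' by apply/box_insert_coord; rewrite -qE.
pose G (x : borel_rV R m) := rho (insert_coord j t x).
have mins : measurable_fun setT (fun x : borel_rV R m => insert_coord j t x : borel_rV R n).
  exact: (measurableT_comp (@measurable_insert_coord R m j) (measurable_pair1 (t : mR))).
have mG : measurable_fun setT G := measurableT_comp mrho mins.
have G0 x : (0 <= G x)%E by exact: rho0.
have mQ : measurable (Q : set (borel_rV R m)) by exact: box_measurable.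
have eE : (\int[@lebesgue_rV R m]_(z in Q) (G z ^+ m.+1) <= (eps0 / Dm)%:E)%E.
  apply: le_trans he; rewrite integral_mkcond le_eqVlt; apply/orP; left; apply/eqP.
  apply: eq_integral => x _; rewrite patchE.
  rewrite (_ : `[< B (insert_coord j t x) >] = (x \in Q)) //.
  apply/asboolP/idP; first by move/box_insert_coord => [_ h]; exact: mem_set.
  by move=> h; apply/box_insert_coord; split => //; exact: set_mem.
pose V := fine (lebesgue_rV (Q : set (borel_rV R m))).
have VE : lebesgue_rV (Q : set (borel_rV R m)) = V%:E.
  rewrite fineK // ge0_fin_numE; last exact: measure_ge0.
  by rewrite /Q lebesgue_rV_box; exact: prod_itv_lty.
have VD : Dm ^+ m <= V.
  rewrite -lee_fin -VE /Q lebesgue_rV_box.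
  have -> : (Dm ^+ m)%:E = (\prod_(i < m) Dm%:E)%E.
    by rewrite big_const_ord; elim: (m) => //= k <-; rewrite exprS EFinM.
  apply: (big_ind2 (fun x y : \bar R => 0 <= x /\ x <= y)%E _ _ _).2.
  - by split.
  - by move=> x1 x2 y1 y2 [h1 h2] [h3 h4]; split; [exact: mule_ge0|exact: lee_pmul].
  move=> i _; split; first by rewrite lee_fin ltW.
  rewrite lebesgue_measure_itv /= lte_fin.
  have /andP[h1 h2] := lohi (lift j i).
  have h3 : lo (lift j i) < hi (lift j i) by rewrite -subr_gt0; exact: lt_le_trans h1.
  by rewrite h3 -EFinD lee_fin.
have V0 : 0 < V by apply: lt_le_trans VD; rewrite exprn_gt0.
have n0 : 0 < n%:R :> R by rewrite ltr0n.
pose dl : R := (64 * n%:R * n%:R * Dm)^-1.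
have dl0 : 0 < dl by rewrite invr_gt0 !mulr_gt0.
pose S x z := (\int[lebesgue_measure]_(s in `]0%R, 1%R]) G (x + s *: (z - x))%R)%E.
have mseg x : measurable_fun setT (fun z : borel_rV R m => S x z).
  pose TS (z : mR * borel_rV R m) : \bar R := (if (0 < z.1 <= 1)%R then G (x + z.1 *: (z.2 - x))%R else 0)%E.
  have TS0 z : (0 <= TS z)%E by rewrite /TS; case: ifP.
  have mS : measurable_fun setT TS.
    apply: measurable_fun_ifT => //.
      by apply: measurable_and; [apply: measurable_fun_ltr|apply: measurable_fun_ler] => //; exact: measurable_fst.
    apply: (measurableT_comp mG); apply: measurable_rV => i.
    under eq_fun do rewrite !mxE.
    apply: measurable_funD => //; apply: measurable_funM; first exact: measurable_fst.
    apply: measurable_funB => //.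
    by apply: (measurableT_comp (@measurable_coord R m i)); exact: measurable_snd.
  have mS' := @measurable_fun_fubini_tonelli_G _ _ mR (borel_rV R m) R lebesgue_measure TS mS TS0.
  have -> : (fun z => S x z) = fubini_G lebesgue_measure TS; last exact: mS'.
  apply/funext => z; rewrite /fubini_G /S [LHS]integral_mkcond; apply: eq_integral => s _.
  by rewrite patchE mem_setE in_itv.
have S0 x z : (0 <= S x z)%E by apply: integral_ge0.
have Sav x : Q x -> (\int[@lebesgue_rV R m]_(z in Q) S x z <= (V / (32 * n%:R * Dm))%:E)%E.
  move=> Qx; apply: le_trans (morrey_average mG G0 Qx dl0) _.
  rewrite -/Q VE.
  have dm0 : 0 < dl ^- m by rewrite invr_gt0 exprn_gt0.
  apply: (@le_trans _ _ (n%:R%:E * ((dl * V)%:E + (dl ^- m * (eps0 / Dm))%:E))%E).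
    apply: lee_wpmul2l; first by rewrite lee_fin.
    rewrite EFinM; apply: leeD2l; rewrite EFinM; apply: lee_wpmul2l => //.
    by rewrite lee_fin ltW.
  rewrite -EFinD -EFinM lee_fin.
  have e1 : n%:R * (dl * V) = V / (64 * n%:R * Dm).
    rewrite /dl; field; by rewrite !gt_eqF.
  have e2 : n%:R * (dl ^- m * (eps0 / Dm)) = Dm ^+ m / (64 * n%:R * Dm).
    rewrite /dl exprVn invrK /eps0.
    have a0 : (64 * n%:R * n%:R : R) ^+ m != 0 by rewrite expf_neq0 // gt_eqF // -mulrA mulr_gt0.
    rewrite exprMn; field; by rewrite a0 !gt_eqF.
  rewrite mulrDr e1 e2.
  have k0 : 0 < n%:R * Dm by rewrite mulr_gt0.
  have e3 : V / (32 * n%:R * Dm) = 2 * V / (64 * n%:R * Dm) by field; rewrite !gt_eqF.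
  rewrite e3 -mulrDl ler_pM2r ?invr_gt0 -?mulrA ?mulr_gt0 //; lra.
(* A segment of the slice has length at most 2 n Dm, and 2 n Dm c = 1/4. The two averages add up to
   at most c/2, which leaves room for the strict inequality. *)
pose c : R := (8 * n%:R * Dm)^-1.
have c0 : 0 < c by rewrite invr_gt0 !mulr_gt0.
have [z Qz Sz] : exists2 z, Q z & (S p' z + S q' z < c%:E)%E.
  apply: (@exists_le_average _ _ (@lebesgue_rV R m)) => //.
  - by apply: measurable_funTS; exact: emeasurable_funD.
  - by move=> x _; rewrite adde_ge0.
  - exact: ltW.
  rewrite ge0_integralD //; try exact: measurable_funTS.
  apply: le_lt_trans (leeD (Sav _ Qp) (Sav _ Qq)) _.
  rewrite [X in (_ < _ * X)%E](_ : _ = V%:E); last exact: VE.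
  rewrite -EFinD -EFinM lte_fin -/c.
  have -> : V / (32 * n%:R * Dm) + V / (32 * n%:R * Dm) = c * V * 2^-1.
    by rewrite /c; field; rewrite !gt_eqF.
  have : 0 < c * V by rewrite mulr_gt0.
  by lra.
have [sp [sq [sp0 sq0 spE sqE spq]]] := ereal_add_lt_real (S0 p' z) (S0 q' z) Sz.
have len x : Q x -> enorm (insert_coord j t z - insert_coord j t x) <= n%:R * (2 * Dm).
  by move=> Qx; exact: insert_coord_dist_le.
have SE x : (\int[lebesgue_measure]_(s in `[0%R, 1%R]) rho (insert_coord j t x + s *: (insert_coord j t z - insert_coord j t x))%R)%E = S x z.
  rewrite -integral_itv_obnd_cbnd; last first.
    by apply: measurable_funTS; exact: measurable_seg.
  by apply: eq_integral => s _; rewrite /G insert_coord_affine.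
have Bz : B (insert_coord j t z) by apply/box_insert_coord.
have seg x : B (insert_coord j t x) -> forall s, 0 <= s -> s <= 1 -> B (insert_coord j t x + s *: (insert_coord j t z - insert_coord j t x)).
  by move=> Bx s s0 s1; apply: box_convex; rewrite ?s0.
pose k1 := enorm (insert_coord j t z - insert_coord j t p') * sp.
pose k2 := enorm (insert_coord j t z - insert_coord j t q') * sq.
have k10 : 0 <= k1 by rewrite mulr_ge0 ?enorm_ge0.
have k20 : 0 <= k2 by rewrite mulr_ge0 ?enorm_ge0.
have kk : k1 + k2 <= 1/4.
  apply: (@le_trans _ _ (n%:R * (2 * Dm) * (sp + sq))).
    by rewrite mulrDr; apply: lerD; apply: ler_wpM2r; rewrite ?len.
  apply: (@le_trans _ _ (n%:R * (2 * Dm) * c)).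
    by apply: ler_wpM2l; [rewrite !mulr_ge0 // ltW|exact: ltW].
  rewrite /c le_eqVlt; apply/orP; left; apply/eqP; field; by rewrite !gt_eqF.
apply: (rho_connW kk); rewrite {1}pE qE.
apply: (rho_conn_cat mrho rho0 (q := insert_coord j t z)).
  apply: (rho_conn_seg mrho rho0 k10); first by apply: seg; rewrite -pE.
  by rewrite (SE p') spE -EFinM.
apply: (rho_conn_seg_rev mrho rho0 k20); first by apply: seg; rewrite -qE.
by rewrite (SE q') sqE -EFinM.
Qed.

Lemma slice_energy_ge0 j t : (0 <= slice_energy j t)%E.
Proof. by apply: integral_ge0 => x _; case: ifP => // _; exact: expe_ge0. Qed.

Let h (x : borel_rV R n) : \bar R := if `[< B x >] then (rho x ^+ n)%E else 0%E.

Let h0 x : (0 <= h x)%E.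
Proof. by rewrite /h; case: ifP => // _; exact: expe_ge0. Qed.

Let mh : measurable_fun setT h.
Proof.
apply: measurable_fun_ifT => //; last exact: emeasurable_funX.
apply: (measurable_fun_bool true); rewrite setTI.
rewrite (_ : _ @^-1` _ = B); first exact: box_measurable.
by apply/seteqP; split => x /= /asboolP.
Qed.

Lemma measurable_slice_energy j : measurable_fun [set: mR] (fun t : mR => slice_energy j t).
Proof.
have mS : measurable_fun setT (fun z : mR * borel_rV R m => h (insert_coord j z.1 z.2)).
  exact: (measurableT_comp mh (@measurable_insert_coord R m j)).
exact: (@measurable_fun_fubini_tonelli_F _ _ mR (borel_rV R m) R (@lebesgue_rV R m) _ mS (fun z => h0 _)).
Qed.

Lemma slice_energy_le j : (\int[lebesgue_measure]_t slice_energy j t <=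
  \int[@lebesgue_rV R n]_x (rho x ^+ n))%E.
Proof.
have -> : (\int[lebesgue_measure]_t slice_energy j t = \int[@lebesgue_rV R n]_x h x)%E.
  by rewrite (integral_rV_slice j mh h0).
apply: ge0_le_integral => //; first exact: emeasurable_funX.
by move=> x _; rewrite /h; case: ifP => // _; exact: expe_ge0.
Qed.

(** The hyperplanes x_j = y_j + t and x_j = y_j - t carry the faces of the sup-norm sphere of radius
    t about y. Each of these 2n energies has integral at most eta in t, so one t of the interval
    makes them all small; every point of that sphere within the box then lies on a good slice. *)
Lemma good_level (y : 'I_n -> R) (a l eta e : R) : 0 < l -> 0 <= eta ->
  (\int[@lebesgue_rV R n]_x (rho x ^+ n) <= eta%:E)%E -> 2 * n%:R * eta < e * l ->
  exists2 t, a < t < a + l & forall j, (slice_energy j (y j + t) <= e%:E)%E /\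
     (slice_energy j (y j - t) <= e%:E)%E.
Proof.
move=> l0 eta0 heta hl.
pose f (t : mR) := (\sum_(j < n) (slice_energy j (y j + t) + slice_energy j (y j - t)))%E.
have m1 j : measurable_fun [set: mR] (fun t : mR => slice_energy j (y j + t)).
  by apply: (measurableT_comp (measurable_slice_energy j)); exact: measurable_funD.
have m2 j : measurable_fun [set: mR] (fun t : mR => slice_energy j (y j - t)).
  by apply: (measurableT_comp (measurable_slice_energy j)); exact: measurable_funB.
have f0 j t : (0 <= slice_energy j (y j + t) + slice_energy j (y j - t))%E.
  by rewrite adde_ge0 // slice_energy_ge0.
have m12 j : measurable_fun [set: mR] (fun t : mR => (slice_energy j (y j + t) + slice_energy j (y j - t))%E).
  exact: emeasurable_funD.
have [|||||t ta ft] := @exists_le_average _ mR lebesgue_measure `]a, (a + l)[%classic f e.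
- exact: measurable_itv.
- by apply: measurable_funTS; exact: emeasurable_sum.
- by move=> t _; apply: sume_ge0.
- have h1 : 0 < e * l by apply: le_lt_trans hl; rewrite !mulr_ge0.
  by rewrite pmulr_lgt0 // in h1; exact: ltW.
- rewrite /= lebesgue_measure_itv /= lte_fin ltrDl l0 -EFinD addrAC subrr add0r.
  apply: (@le_lt_trans _ _ (2 * n%:R * eta)%:E); last by rewrite -EFinM lte_fin.
  apply: (@le_trans _ _ (\int[lebesgue_measure]_t f t)%E).
    apply: ge0_subset_integral => //; [exact: emeasurable_sum|by move=> t _; exact: sume_ge0].
  rewrite ge0_integral_sum //.
  have -> : (2 * n%:R * eta)%:E = (\sum_(j < n) (eta + eta)%:E)%E.
    by rewrite sumEFin sumr_const card_ord -mulr_natl; congr EFin; ring.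
  apply: lee_sum => j _; rewrite ge0_integralD //; try by move=> t _; exact: slice_energy_ge0.
  rewrite EFinD; apply: leeD.
    apply: le_trans heta; apply: le_trans (slice_energy_le j).
    rewrite [leRHS](@integral_R_affine R (y j) 1) ?oner_eq0 //; last 2 first.
    - exact: measurable_slice_energy.
    - exact: slice_energy_ge0.
    by rewrite normr1 mul1e; under [leRHS]eq_integral do rewrite mul1r.
  apply: le_trans heta; apply: le_trans (slice_energy_le j).
  rewrite [leRHS](@integral_R_affine R (y j) (-1)) ?oppr_eq0 ?oner_eq0 //; last 2 first.
  - exact: measurable_slice_energy.
  - exact: slice_energy_ge0.
  by rewrite normrN normr1 mul1e; under [leRHS]eq_integral do rewrite mulN1r.
exists t; first by move: ta; rewrite /= in_itv.
move=> j; have : (slice_energy j (y j + t) + slice_energy j (y j - t) <= e%:E)%E.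
  by apply: le_trans (ltW ft); rewrite /f (bigD1 j) //= leeDl // sume_ge0.
move=> hj; split; apply: le_trans hj; first by rewrite leeDl // slice_energy_ge0.
by rewrite leeDr // slice_energy_ge0.
Qed.

Definition set_coord (p : 'rV[R]_n) (i : 'I_n) (t : R) : 'rV[R]_n :=
  \row_l (if l == i then t else p ord0 l).

Lemma box_set_coord p i t : B p -> lo i < t < hi i -> B (set_coord p i t).
Proof. by move=> Bp ti l; rewrite mxE; case: eqP => [->|_]; [exact: ti|exact: Bp]. Qed.

(* Two good slices with different normals meet; parallel ones are joined through a third slice. *)
Lemma good_slices_conn (p q : 'rV[R]_n) (j k : 'I_n) eta : (0 < m)%N -> B p -> B q -> 0 <= eta ->
  (\int[@lebesgue_rV R n]_x (rho x ^+ n) <= eta%:E)%E -> 2 * n%:R * eta < eps0 ->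
  (slice_energy j (p ord0 j) <= (eps0 / Dm)%:E)%E ->
  (slice_energy k (q ord0 k) <= (eps0 / Dm)%:E)%E -> rho_conn B rho (3/4) p q.
Proof.
move=> m0 Bp Bq eta0 heta he hj hk.
have [jk|jk] := eqVneq j k; last first.
  pose w := set_coord p k (q ord0 k).
  have Bw : B w by apply: box_set_coord => //; exact: Bq.
  have wk : w ord0 k = q ord0 k by rewrite mxE eqxx.
  have wj : p ord0 j = w ord0 j by rewrite mxE (negbTE jk).
  apply: (@rho_connW _ _ _ _ (1/4 + 1/4)); first lra.
  apply: (rho_conn_cat mrho rho0 (q := w)); first exact: (slice_conn Bp Bw wj hj).
  have hw : (slice_energy k (w ord0 k) <= (eps0 / Dm)%:E)%E by rewrite wk.
  exact: (slice_conn Bw Bq wk hw).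
(* A second direction exists because n >= 2. *)
have [i ij] : exists i : 'I_n, i != j.
  have [j0|j0] := eqVneq j ord0; last by exists ord0; rewrite eq_sym.
  exists (Ordinal (m0 : (1 < n)%N)); rewrite j0.
  by [].
have /andP[d1 d2] := lohi i.
(* With centre 0 the level t is itself the i-th coordinate of the third slice, sought in the first
   Dm units of the i-th side. *)
have [||||t /andP[t1 t2] ht] := @good_level (fun=> 0) (lo i) Dm eta (eps0 / Dm).
- exact: D0.
- exact: eta0.
- exact: heta.
- by rewrite divfK ?gt_eqF.
have {ht} [ht _] := ht i; rewrite add0r in ht.
have ti : lo i < t < hi i by rewrite t1 (lt_le_trans t2) //; lra.
pose w1 := set_coord p i t; pose w2 := set_coord q i t.
have B1 : B w1 by exact: box_set_coord.
have B2 : B w2 by exact: box_set_coord.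
have ji : (j == i) = false by rewrite eq_sym (negbTE ij).
have w1i : w1 ord0 i = t by rewrite mxE eqxx.
have w2i : w2 ord0 i = t by rewrite mxE eqxx.
apply: (@rho_connW _ _ _ _ (1/4 + (1/4 + 1/4))); first lra.
apply: (rho_conn_cat mrho rho0 (q := w1)).
  have w1j : p ord0 j = w1 ord0 j by rewrite mxE ji.
  exact: (slice_conn Bp B1 w1j hj).
apply: (rho_conn_cat mrho rho0 (q := w2)).
  have w12 : w1 ord0 i = w2 ord0 i by rewrite w1i w2i.
  have hw : (slice_energy i (w1 ord0 i) <= (eps0 / Dm)%:E)%E by rewrite w1i.
  exact: (slice_conn B1 B2 w12 hw).
rewrite -jk in hk.
have wj : w2 ord0 j = q ord0 j by rewrite mxE ji.
have hw : (slice_energy j (w2 ord0 j) <= (eps0 / Dm)%:E)%E by rewrite wj.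
exact: (slice_conn B2 Bq wj hw).
Qed.

End slices.

Lemma norm_coord n (x : 'rV[R]_n.+1) : exists i, `|x| = `|x ord0 i|.
Proof.
have [i _ hi] : exists2 i : 'I_n.+1, true & forall k, `|x ord0 k| <= `|x ord0 i|.
  by case: (@arg_maxP _ _ 'I_n.+1 ord0 xpredT (fun k => `|x ord0 k|) isT) => i _ h; exists i => // k; exact: h.
exists i; apply/eqP; rewrite eq_le ler_coord_norm andbT.
rewrite {1}/Num.norm /= mx_normrE; apply: bigmax_le => // -[k l] _ /=.
by rewrite ord1.
Qed.

(** A density of energy below eta has a good radius in each of the two ranges, hence a point of E
    and a point of F on good slices; these are joined with rho-length 3/4, against admissibility.
    Only the ratio theta of the ranges to the size D matters, by scale invariance. *)
Lemma modulus_ge_joined_shells (m : nat) (theta : R) : (0 < m)%N -> 0 < theta ->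
  exists2 eta : R, 0 < eta &
  forall (D a a' : R) (y : 'rV[R]_m.+1) (E F : set 'rV[R]_m.+1),
    0 < D -> 0 <= a -> a + theta * D <= D -> 0 <= a' -> a' + theta * D <= D ->
    (forall i : 'I_m.+1, i = m :> nat -> 0 <= y ord0 i) ->
    E `<=` half_space R m.+1 -> F `<=` half_space R m.+1 ->
    (forall t, a < t < a + theta * D -> exists2 p, E p & `|p - y| = t) ->
    (forall t, a' < t < a' + theta * D -> exists2 p, F p & `|p - y| = t) ->
    (eta%:E <= modulus (joining_curves E F))%E.
Proof.
move=> m0 th0; set n := m.+1.
pose e0 : R := (64 * n%:R * n%:R * (64 * n%:R * n%:R) ^+ m)^-1.
have e00 : 0 < e0 by exact: (@eps0_gt0 m).
have n0 : 0 < n%:R :> R by rewrite ltr0n.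
(* The minimum serves two searches: the radii range over intervals of length theta D, the auxiliary
   third slice over one of length D. *)
pose eta := Num.min theta 1 * e0 / (4 * n%:R).
have eta0 : 0 < eta by rewrite divr_gt0 ?mulr_gt0 // lt_min th0 ltr01.
have eta1 : 2 * n%:R * eta < e0.
  have -> : 2 * n%:R * eta = Num.min theta 1 * e0 / 2 by rewrite /eta; field; rewrite gt_eqF.
  have : Num.min theta 1 <= 1 by rewrite ge_min lexx orbT.
  by move=> h; nra.
have eta2 : 2 * n%:R * eta < e0 * theta.
  have -> : 2 * n%:R * eta = Num.min theta 1 * e0 / 2 by rewrite /eta; field; rewrite gt_eqF.
  have : Num.min theta 1 <= theta by rewrite ge_min lexx.
  by have : 0 < e0 * theta by [rewrite mulr_gt0]; move=> h1 h; nra.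
exists eta => // D a a' y E F D0 a0 aD a'0 a'D y0 EH FH hE hF.
apply: le_ereal_inf_tmp => _ [rho adm <-]; rewrite leNgt; apply/negP => lt.
have [mrho rho0 _] := adm.
(* The cube of sup-radius D about y, cut off at the boundary hyperplane; since y lies in the closed
   half-space, its sides keep length at least D. *)
pose lo (i : 'I_n) : R := if i == m :> nat then Num.max 0 (y ord0 i - D) else y ord0 i - D.
pose hi (i : 'I_n) : R := y ord0 i + D.
have lohi i : D <= hi i - lo i <= 2 * D.
  rewrite /hi /lo; case: eqP => [im|_]; last lra.
  by have := y0 i im; case: (leP 0 (y ord0 i - D)); lra.
have inB p t : half_space R n p -> `|p - y| = t -> t < D -> box lo hi p.
  move=> Hp pt tD i; have := ler_coord_norm (p - y) i; rewrite pt !mxE ler_norml.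
  have Hi : i = m :> nat -> 0 < p ord0 i by exact: Hp.
  rewrite /lo /hi; case: eqP => [/Hi|_]; last lra.
  by move=> pi /andP[h1 h2]; rewrite gt_max pi /=; lra.
have level p t : `|p - y| = t -> (forall j, (slice_energy lo hi rho j (y ord0 j + t) <= (e0 / D)%:E)%E /\
     (slice_energy lo hi rho j (y ord0 j - t) <= (e0 / D)%:E)%E) ->
    exists j, (slice_energy lo hi rho j (p ord0 j) <= (e0 / D)%:E)%E.
  move=> pt good; have [j] := norm_coord (p - y); rewrite pt !mxE => tj; exists j.
  have [g1 g2] := good j.
  have [h|h] := leP 0 (p ord0 j - y ord0 j).
    rewrite (_ : p ord0 j = y ord0 j + t); first exact: g1.
    by rewrite tj ger0_norm //; ring.
  rewrite (_ : p ord0 j = y ord0 j - t); first exact: g2.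
  rewrite tj ltr0_norm //; ring.
have thD : 0 < theta * D by rewrite mulr_gt0.
have cond : 2 * n%:R * eta < e0 / D * (theta * D).
  have aux (u v w : R) : w != 0 -> u / w * (v * w) = u * v by move=> w0; field.
  by rewrite (aux _ _ _ (lt0r_neq0 D0)); exact: eta2.
have [t t1 good] := good_level lo hi mrho rho0 (fun j => y ord0 j) a thD (ltW eta0) (ltW lt) cond.
have [t' t1' good'] := good_level lo hi mrho rho0 (fun j => y ord0 j) a' thD (ltW eta0) (ltW lt) cond.
have [p Ep pt] := hE t t1; have [q Fq qt] := hF t' t1'.
have Bp : box lo hi p by apply: (inB p t) => //; [exact: EH|case/andP: t1 => _; lra].
have Bq : box lo hi q by apply: (inB q t') => //; [exact: FH|case/andP: t1' => _; lra].
have [j hj] := level p t pt good; have [k hk] := level q t' qt good'.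
have [L [g [ug gp gq gB gk]]] :=
  good_slices_conn D0 lohi mrho rho0 m0 Bp Bq (ltW eta0) (ltW lt) eta1 hj hk.
have c : rho_conn (half_space R n) rho (3/4) p q.
  exists L, g; split => // s i im; have := gB s i.
  by rewrite /lo im eqxx gt_max => /andP[/andP[]].
have := admissible_conn adm Ep Fq c; lra.
Qed.

End Loewner.

(** * Quasiconformal maps at the boundary *)

Section QCPair.
Variables (R : realType) (n : nat).
Notation H := (half_space R n).
Implicit Types (f g : 'rV[R]_n -> 'rV[R]_n) (E F A : set 'rV[R]_n).

(** What the rest of the proof retains of quasiconformality. It is symmetric in f and its inverse g,
    so each statement is also available for the inverse, and it concerns only families of curves
    joining two sets. *)
Record qcpair (K : R) f g : Prop := QCPair {
  qc_map : forall x, H x -> H (f x);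
  qc_gmap : forall x, H x -> H (g x);
  qc_fK : forall x, H x -> g (f x) = x;
  qc_gK : forall x, H x -> f (g x) = x;
  qc_cont : forall x, H x -> {for x, continuous f};
  qc_gcont : forall x, H x -> {for x, continuous g};
  qc_mod : forall E F, E `<=` H -> F `<=` H ->
    (modulus (joining_curves (f @` E) (f @` F)) <= K%:E * modulus (joining_curves E F))%E;
  qc_gmod : forall E F, E `<=` H -> F `<=` H ->
    (modulus (joining_curves (g @` E) (g @` F)) <= K%:E * modulus (joining_curves E F))%E }.

Lemma qcpair_sym K f g : qcpair K f g -> qcpair K g f.
Proof. by case=> *; split. Qed.

Lemma joining_curves_in E F : joining_curves E F `<=` is_curve_in H.
Proof.
move=> _ [L [g [[-> L0 gc gn gp] [gH gE gF]]]]; split => //=.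
- by exists 0; rewrite /= in_itv /= lexx.
- by apply: continuous_subspaceT => x; exact: gc.
Qed.

Lemma curve_image_joining f g E F :
  (forall x, H x -> H (f x)) -> (forall x, H x -> H (g x)) ->
  (forall x, H x -> g (f x) = x) -> (forall x, H x -> f (g x) = x) ->
  (forall x, H x -> {for x, continuous f}) -> (forall x, H x -> {for x, continuous g}) ->
  E `<=` H -> F `<=` H ->
  curve_image f @` joining_curves E F = joining_curves (f @` E) (f @` F).
Proof.
move=> fH gH fK gK fc gc EH FH; apply/seteqP; split.
  move=> _ [_ [L [h [[-> L0 hc hn hp] [hH hE hF]]]] <-].
  exists L, (f \o h); split; split => //=.
  - by move=> t; apply: continuous_comp; [exact: hc|exact: fc].
  - by move=> s s0; rewrite /= hn.
  - by move=> s s0; rewrite /= hp.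
  - by move=> t; exact: fH.
  - by exists (h 0).
  - by exists (h L).
move=> _ [L [h [[-> L0 hc hn hp] [hH [e Ee eh] [e' Fe' eh']]]]].
exists (Curve `[0, L] (g \o h)); last first.
  by rewrite /curve_image /=; congr Curve; apply/funext => t /=; rewrite gK.
exists L, (g \o h); split; split => //=.
- by move=> t; apply: continuous_comp; [exact: hc|exact: gc].
- by move=> s s0; rewrite /= hn.
- by move=> s s0; rewrite /= hp.
- by move=> t; exact: gH.
- by rewrite -eh fK //; exact: EH.
- by rewrite -eh' fK //; exact: FH.
Qed.

Lemma qcpair_of_quasiconformal K f : 0 < K -> quasiconformal K H H f ->
  exists g, qcpair K f g.
Proof.
move=> K0 [_ _ [[fH finj fsurj] fc [g [gc gK]]] mod].
have gH y : H y -> H (g y) by move=> /fsurj [x Hx <-]; rewrite gK.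
have fgK y : H y -> f (g y) = y by move=> /fsurj [x Hx <-]; rewrite gK.
have fH' x : H x -> H (f x) by exact: fH.
have cf x : H x -> {for x, continuous f}.
  move=> Hx; move: fc; rewrite continuous_open_subspace; last exact: half_space_open.
  by apply; rewrite inE.
have cg x : H x -> {for x, continuous g}.
  move=> Hx; move: gc; rewrite continuous_open_subspace; last exact: half_space_open.
  by apply; rewrite inE.
exists g; split => // E F EH FH.
  have := mod _ (@joining_curves_in E F) => /andP[_].
  by rewrite (curve_image_joining fH' gH gK fgK cf cg EH FH).
(* The upper bound for g is the lower modulus bound of f, applied to the family joining g(E) and
   g(F), whose image joins E and F. *)
have gEH : g @` E `<=` H by move=> _ [x /EH Hx <-]; exact: gH.
have gFH : g @` F `<=` H by move=> _ [x /FH Hx <-]; exact: gH.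
have := mod _ (@joining_curves_in (g @` E) (g @` F)) => /andP[+ _].
rewrite (curve_image_joining fH' gH gK fgK cf cg gEH gFH).
have im A : A `<=` H -> f @` (g @` A) = A.
  move=> AH; apply/seteqP; split => [_ [_ [x Ax <-] <-]|x Ax].
    by rewrite fgK //; exact: AH.
  by exists (g x); [exists x|rewrite fgK //; exact: AH].
rewrite !im // => h.
have K0' : (0 <= K%:E)%E by rewrite lee_fin ltW.
by have := lee_wpmul2l K0' h; rewrite muleA -EFinM divff ?gt_eqF // mul1e.
Qed.

Definition path_connected_set A := forall p q, A p -> A q -> exists c : R -> 'rV[R]_n,
  [/\ c 0 = p, c 1 = q, forall t, 0 <= t -> t <= 1 -> {for t, continuous c} &
      forall t, 0 <= t -> t <= 1 -> A (c t)].

Lemma segment_continuous (p v : 'rV[R]_n) : continuous (fun t : R => p + t *: v).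
Proof.
move=> t; apply: cvgD; first exact: cvg_cst.
by apply: cvgZr_tmp; exact: cvg_id.
Qed.

Lemma half_space_segment p q t : H p -> H q -> 0 <= t -> t <= 1 -> H (p + t *: (q - p)).
Proof.
move=> Hp Hq t0 t1 i ie; have := Hp i ie; have := Hq i ie; rewrite !mxE => q0 p0.
have [->|t1'] := eqVneq t 1; first by lra.
have : 0 <= t * q ord0 i by rewrite mulr_ge0 // ltW.
have : 0 < (1 - t) * p ord0 i by rewrite mulr_gt0 // subr_gt0 lt_neqAle t1'.
lra.
Qed.

Definition half_ball xi (r : R) : set 'rV[R]_n := [set x | H x /\ enorm (x - xi) <= r].
Definition half_ball_compl xi (r : R) : set 'rV[R]_n := [set x | H x /\ r <= enorm (x - xi)].

Lemma pconn_half_ball xi r : path_connected_set (half_ball xi r).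
Proof.
move=> p q [Hp pr] [Hq qr]; exists (fun t => p + t *: (q - p)); split.
- by rewrite scale0r addr0.
- by rewrite scale1r addrC subrK.
- by move=> t _ _; exact: segment_continuous.
move=> t t0 t1; split; first exact: half_space_segment.
have -> : p + t *: (q - p) - xi = (1 - t) *: (p - xi) + t *: (q - xi).
  by rewrite !scalerBr !scalerBl !scale1r; apply/rowP => i; rewrite !mxE; ring.
apply: le_trans (ler_enormD _ _) _; rewrite !enormZ !ger0_norm ?subr_ge0 //.
have : t * enorm (q - xi) <= t * r by rewrite ler_wpM2l.
have : (1 - t) * enorm (p - xi) <= (1 - t) * r by rewrite ler_wpM2l // subr_ge0.
lra.
Qed.

Lemma half_space_last x : (0 < n)%N -> H x -> exists2 i : 'I_n, i = n.-1 :> nat & 0 < x ord0 i.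
Proof.
move=> n0 Hx; exists (Ordinal (eq_ind_r (fun k => (k <= n)%N) (leqnn n) (prednK n0))) => //.
exact: Hx.
Qed.

Lemma flat_dist_gt0 xi x : (0 < n)%N -> on_hyperplane xi -> H x -> 0 < enorm (x - xi).
Proof.
move=> n0 fx Hx; rewrite enorm_gt0; apply/eqP => /rowP e.
by have [i ie] := half_space_last n0 Hx; have := e i; rewrite !mxE fx // subr0 => ->; rewrite ltxx.
Qed.

(** This set is not convex, so the segment from p to q is pushed radially away from xi until its
    distance is max(|c|, r). This is possible because a segment in the open half-space never meets
    the boundary point xi. *)
Lemma pconn_half_ball_compl xi r : (0 < n)%N -> on_hyperplane xi -> 0 <= r -> path_connected_set (half_ball_compl xi r).
Proof.
move=> n0 fx r0 p q [Hp pr] [Hq qr].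
pose c (t : R) := p + t *: (q - p) - xi.
have c0 t : 0 <= t -> t <= 1 -> 0 < enorm (c t).
  by move=> t0 t1; apply: flat_dist_gt0 => //; exact: half_space_segment.
exists (fun t => xi + (Num.max (enorm (c t)) r / enorm (c t)) *: c t); split.
- rewrite /c scale0r addr0 max_l // divff ?gt_eqF ?flat_dist_gt0 //.
  by rewrite scale1r addrC subrK.
- rewrite /c scale1r [p + _]addrC subrK max_l // divff ?gt_eqF ?flat_dist_gt0 //.
  by rewrite scale1r addrC subrK.
- move=> t t0 t1.
  have cc : {for t, continuous c}.
    by apply: cvgB; [exact: segment_continuous|exact: cvg_cst].
  have ce : {for t, continuous (fun s => enorm (c s))}.
    by apply: (continuous_comp cc); exact: continuous_enorm.
  apply: cvgD; first exact: cvg_cst.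
  apply: cvgZ => //; apply: cvgM.
    apply: (@continuous_max _ _ (fun s => enorm (c s)) (fun=> r)) => //; exact: cvg_cst.
  by apply: cvgV => //; rewrite gt_eqF // c0.
move=> t t0 t1; have ct := c0 t t0 t1.
have m0 : 0 < Num.max (enorm (c t)) r by rewrite lt_max ct.
split.
  have k0 : 0 < Num.max (enorm (c t)) r / enorm (c t) by rewrite divr_gt0.
  have Ht := half_space_segment Hp Hq t0 t1.
  move=> i ie; rewrite mxE fx // add0r [X in 0 < X]mxE; apply: mulr_gt0 => //.
  by rewrite /c mxE [X in _ + X]mxE fx // oppr0 addr0; exact: Ht.
rewrite addrAC subrr add0r enormZ gtr0_norm ?divr_gt0 // divfK ?gt_eqF //.
by rewrite le_max lexx orbT.
Qed.

(** The intermediate value theorem along a path from p to q. It supplies the [hits] hypotheses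
    below: one point with image close to y and one with image far from y suffice. *)
Lemma image_shell f A y p q t : A `<=` H -> (forall x, H x -> {for x, continuous f}) ->
  path_connected_set A -> A p -> A q -> `|f p - y| < t -> t < `|f q - y| ->
  exists2 z, (f @` A) z & `|z - y| = t.
Proof.
move=> AH fc Ac Ap Aq pt tq; have [c [c0 c1 cc cA]] := Ac p q Ap Aq.
pose h (s : R) := `|f (c s) - y|.
have hc : {within `[0, 1], continuous h}.
  apply: continuous_in_subspaceT => s; rewrite inE /= in_itv /= => /andP[s0 s1].
  apply: (@continuous_comp _ _ _ (fun s => f (c s) - y) (fun z : 'rV[R]_n => `|z|)).
    apply: cvgB; last exact: cvg_cst.
    by apply: (continuous_comp (cc s s0 s1)); apply: fc; exact/AH/cA.
  exact: norm_continuous.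
have [|s] := @IVT R h 0 1 t ler01 hc.
  rewrite /h c0 c1; apply/andP; split; first by rewrite ge_min (ltW pt).
  by rewrite le_max (ltW tq) orbT.
rewrite in_itv /= => /andP[s0 s1] hs; exists (f (c s)) => //.
by exists (c s) => //; exact: cA.
Qed.

Lemma half_space_e_last : H (e_last R n).
Proof. by move=> i ie; rewrite mxE ie eqxx. Qed.

Lemma enorm_e_last : (0 < n)%N -> enorm (e_last R n) = 1.
Proof.
move=> n0; have [l le _] := half_space_last n0 half_space_e_last.
rewrite /enorm (bigD1 l) //= big1 ?addr0 => [|i il]; first by rewrite mxE le eqxx expr1n sqrtr1.
by rewrite mxE -le (inj_eq val_inj) (negbTE il) expr0n.
Qed.

Lemma half_space_add xi t : on_hyperplane xi -> 0 < t -> H (xi + t *: e_last R n).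
Proof. by move=> fx t0; apply/half_space_affine => //; exact: half_space_e_last. Qed.

Lemma dist_add xi t : (0 < n)%N -> 0 < t -> enorm (xi + t *: e_last R n - xi) = t.
Proof.
by move=> n0 t0; rewrite addrAC subrr add0r enormZ enorm_e_last // mulr1 gtr0_norm.
Qed.

Lemma on_hyperplane0 : on_hyperplane (0 : 'rV[R]_n).
Proof. by move=> i _; rewrite mxE. Qed.

Lemma half_space_far M : (0 < n)%N -> exists2 x, H x & M <= enorm x.
Proof.
move=> n0; have M1 : 0 < Num.max M 1 by rewrite lt_max ltr01 orbT.
exists (0 + Num.max M 1 *: e_last R n); first by apply: half_space_add => //; exact: on_hyperplane0.
by rewrite -[X in enorm X]subr0 dist_add // le_max lexx.
Qed.

Lemma enorm_coord_far (y x : 'rV[R]_n) t : enorm x > n%:R * (t + `|y|) -> t < `|x - y|.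
Proof.
move=> h; have : `|x| <= `|x - y| + `|y| by rewrite -{1}[x](subrK y) ler_normD.
move=> h2; have h3 : n%:R * (t + `|y|) < n%:R * `|x| by apply: lt_le_trans h (enorm_le_norm x).
have : t + `|y| < `|x|.
  rewrite ltNge; apply/negP => h4; move: h3; apply/negP; rewrite -leNgt.
  by rewrite ler_wpM2l.
lra.
Qed.

End QCPair.

(** * Wide half-annuli against the Loewner bound *)

Section RingBound.
Variables (R : realType) (m : nat) (K : R).
Hypotheses (m0 : (0 < m)%N) (K1 : 1 <= K).
Let n := m.+1.
Notation H := (half_space R n).
Implicit Types (f g : 'rV[R]_n -> 'rV[R]_n) (E F A : set 'rV[R]_n).

Definition hits (A : set 'rV[R]_n) y (a l : R) :=
  forall t, a < t < a + l -> exists2 p, A p & `|p - y| = t.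

(** The Loewner bound for the images and the annulus bound for E and F give eta <= K c0 N^(1-n). As
    n >= 2, N^(1-n) <= 1/N, whence N <= K c0 / eta. *)
Lemma ring_bound (th : R) : 0 < th -> exists2 B : R, 0 < B &
  forall f g, qcpair K f g -> forall (xi y : 'rV[R]_n) (s D a a' : R) (N : nat) E F,
    on_hyperplane xi -> 0 < s -> 0 < D -> 0 <= a -> a + th * D <= D -> 0 <= a' -> a' + th * D <= D ->
    (forall i : 'I_n, i = m :> nat -> 0 <= y ord0 i) ->
    E `<=` half_ball xi s -> F `<=` half_ball_compl xi (s * expR N%:R) ->
    hits (f @` E) y a (th * D) -> hits (f @` F) y a' (th * D) -> N%:R <= B.
Proof.
move=> th0; have [eta eta0 lower] := @modulus_ge_joined_shells R m th m0 th0.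
have c0f : unit_shell_mass R n \is a fin_num by rewrite ge0_fin_numE ?unit_shell_mass_ge0 ?unit_shell_mass_fin.
pose c := fine (unit_shell_mass R n).
have cE : unit_shell_mass R n = c%:E by rewrite fineK.
have c_gt0 : 0 < c by rewrite -lte_fin -cE; exact: unit_shell_mass_gt0.
have K0 : 0 < K by apply: lt_le_trans K1.
exists (K * c / eta); first by rewrite divr_gt0 // mulr_gt0.
move=> f g qc xi y s D a a' N E F fx s0 D0 a0 aD a'0 a'D y0 EB FB hE hF.
case: N FB => [|N] FB; first by rewrite divr_ge0 ?mulr_ge0 // ltW.
have EH : E `<=` H by move=> x /EB [].
have FH : F `<=` H by move=> x /FB [].
have fEH : f @` E `<=` H by move=> _ [x /EH Hx <-]; exact: qc_map qc _ Hx.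
have fFH : f @` F `<=` H by move=> _ [x /FH Hx <-]; exact: qc_map qc _ Hx.
have h1 := lower D a a' y _ _ D0 a0 aD a'0 a'D y0 fEH fFH hE hF.
have h2 := qc_mod qc EH FH.
have h3 : (modulus (joining_curves E F) <= (N.+1%:R^-1 ^+ n * N.+1%:R)%:E * unit_shell_mass R n)%E.
  by apply: (@modulus_le_shell _ _ _ _ xi s) => // x; [move/EB => []|move/FB => []].
have K0' : (0 <= K%:E)%E by rewrite lee_fin ltW.
have := le_trans h1 (le_trans h2 (lee_wpmul2l K0' h3)).
rewrite cE -!EFinM lee_fin => h4.
have N0 : 0 < N.+1%:R :> R by rewrite ltr0n.
rewrite ler_pdivlMr // mulrC -ler_pdivlMr //; apply: le_trans h4 _.
rewrite -[K * c / _]mulrA ler_pM2l // [c / _]mulrC ler_pM2r //.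
rewrite /n exprS mulrAC mulVf ?gt_eqF // mul1r.
have Ni : N.+1%:R^-1 <= 1 :> R by rewrite invf_le1 // ler1n.
case: (m) m0 => // k _; rewrite exprS ler_piMr ?invr_ge0 ?(ltW N0) //.
by rewrite exprn_ile1 // invr_ge0 ltW.
Qed.

(** The strict integer form is meant for N = B, where it is contradictory: an annulus of logarithmic
    width B cannot have such images. *)
Lemma ring_bound_nat (th : R) : 0 < th -> exists B : nat,
  forall f g, qcpair K f g -> forall (xi y : 'rV[R]_n) (s D a a' : R) (N : nat) E F,
    on_hyperplane xi -> 0 < s -> 0 < D -> 0 <= a -> a + th * D <= D -> 0 <= a' -> a' + th * D <= D ->
    (forall i : 'I_n, i = m :> nat -> 0 <= y ord0 i) ->
    E `<=` half_ball xi s -> F `<=` half_ball_compl xi (s * expR N%:R) ->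
    hits (f @` E) y a (th * D) -> hits (f @` F) y a' (th * D) -> (N < B)%N.
Proof.
move=> /ring_bound[B B0 h]; exists (Num.truncn B).+1 => f g qc xi y s D a a' N E F h1 h2 h3 h4 h5 h6 h7 h8 h9 h10 h11 h12.
have := h f g qc xi y s D a a' N E F h1 h2 h3 h4 h5 h6 h7 h8 h9 h10 h11 h12.
by rewrite ltnS -truncn_ge_nat // ltW.
Qed.

(** Otherwise g sends points w arbitrarily far out into a bounded region. The image of a far
    half-ball complement then contains the bounded point g w as well as distant points z = g (f z),
    so it meets a full range of spheres about y, as does the image of a fixed half-ball; the annulus
    between the two can be made as wide as desired. *)
Lemma tends_inv f g : qcpair K f g -> tends_to_infty H f -> tends_to_infty H g.
Proof.
move=> qc finf M; apply: contrapT => H0.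
have {H0} bad N : exists w, [/\ H w, N <= enorm w & enorm (g w) < M].
  apply: contrapT => H1; apply: H0; exists N => x Hx Nx; rewrite leNgt; apply/negP => gM.
  by apply: H1; exists x.
have gc := qc_gcont qc; have gH := qc_gmap qc.
have n0 : (0 < n)%N by [].
have H2 t : 0 < t -> t <= 2 -> half_ball 0 2 (t *: e_last R n).
  move=> t0 t2; rewrite -[_ *: _]add0r; split; first by apply: half_space_add => //; exact: on_hyperplane0.
  by rewrite dist_add.
pose p := 1 *: e_last R n; pose q := 2 *: e_last R n.
have hp : half_ball 0 2 p by apply: H2; lra.
have hq : half_ball 0 2 q by apply: H2; lra.
have pq : p != q.
  apply/eqP => e; have : enorm p = enorm q by rewrite e.
  rewrite !enormZ enorm_e_last // !mulr1 !ger0_norm //; lra.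
pose y := g p; pose s := `|g q - y|.
have s0 : 0 < s.
  rewrite normr_gt0 subr_eq0; apply: contra pq => /eqP e.
  by rewrite -(qc_gK qc hp.1) -(qc_gK qc hq.1) e.
have Hy : H y by apply: gH; exact: hp.1.
have [w0 [_ _ M0]] := bad 0.
have M0' : 0 <= M by apply: le_trans (ltW M0); exact: enorm_ge0.
pose a' := M + `|y|; have a'0 : 0 <= a' by rewrite addr_ge0.
pose D := a' + s; have D0 : 0 < D by rewrite ltr_wpDl.
pose th := s / D; have th0 : 0 < th by rewrite divr_gt0.
have thD : th * D = s by rewrite divfK // gt_eqF.
have [B hB] := ring_bound_nat th0.
pose T : R := 2 * expR B%:R.
have [w [Hw wT gw]] := bad T.
have [N1 fN1] := finf T.
have [z Hz zN] := half_space_far (Num.max N1 (n%:R * (D + 1 + `|y|))) n0.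
have := hB g f (qcpair_sym qc) 0 y 2 D 0 a' B (half_ball 0 2) (half_ball_compl 0 T).
rewrite thD ltnn => X; have : false; last by [].
apply: X => //.
- exact: on_hyperplane0.
- by rewrite add0r /D lerDr.
- by move=> i im; apply/ltW/Hy.
- move=> t /andP[t0 ts]; rewrite add0r in ts.
  apply: (@image_shell _ _ g (half_ball 0 2) y p q) => //.
  + by move=> x [].
  + exact: pconn_half_ball.
  + by rewrite subrr normr0.
- move=> t /andP[t1 t2].
  have T0 : 0 <= T by rewrite mulr_ge0 // ltW // expR_gt0.
  apply: (@image_shell _ _ g (half_ball_compl 0 T) y w (f z)) => //.
  + by move=> x [].
  + by apply: pconn_half_ball_compl => //; exact: on_hyperplane0.
  + by split; rewrite ?subr0.
  + split; first exact: (qc_map qc).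
    by rewrite subr0; apply: fN1 => //; apply: le_trans zN; rewrite le_max lexx.
  + apply: le_lt_trans t1; apply: le_trans (ler_normB _ _) _.
    by rewrite lerD2r; apply: le_trans (norm_le_enorm _) (ltW gw).
  + rewrite (qc_fK qc) //; apply: lt_trans t2 _; apply: enorm_coord_far.
    apply: lt_le_trans (_ : n%:R * (D + 1 + `|y|) <= _).
      by rewrite ltr_pM2l ?ltr0n // /D; lra.
    by apply: le_trans zN; rewrite le_max lexx orbT.
Qed.

(** If two points within d = exp(-B) of xi had images at distance e, the image of that half-ball
    would meet all small sup-norm spheres about one of them, while the image of the region outside
    the unit half-ball runs from f(xi + e_n) to infinity. The bound M for f near xi, due to the
    inverse tending to infinity, keeps the scale D and hence B independent of the two points. *)
Lemma boundary_osc f g : qcpair K f g -> tends_to_infty H f ->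
  forall xi e, on_hyperplane xi -> 0 < e -> exists2 d, 0 < d &
    forall x x', H x -> H x' -> enorm (x - xi) <= d -> enorm (x' - xi) <= d ->
      enorm (f x - f x') < e.
Proof.
move=> qc finf xi e fx e0.
have n0 : (0 < n)%N by [].
have nR : 0 < n%:R :> R by rewrite ltr0n.
have ginf := tends_inv qc finf.
have fc := qc_cont qc.
have [M hM] := ginf (enorm xi + 2).
have fM x : H x -> enorm (x - xi) <= 1 -> enorm (f x) < M.
  move=> Hx x1; rewrite ltNge; apply/negP => /(hM _ (qc_map qc Hx)).
  rewrite (qc_fK qc) // => h.
  have := ler_enormB x xi 0; rewrite !subr0; lra.
have M0 : 0 < M.
  apply: le_lt_trans (fM (xi + 1 *: e_last R n) _ _); first exact: enorm_ge0.
    exact: half_space_add.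
  by rewrite dist_add.
pose l := e / n%:R; have l0 : 0 < l by rewrite divr_gt0.
pose p0 := xi + 1 *: e_last R n.
have Hp0 : H p0 by exact: half_space_add.
pose a' := M + enorm (f p0); have a'0 : 0 <= a' by rewrite addr_ge0 ?enorm_ge0 // ltW.
pose D := a' + l; have D0 : 0 < D by rewrite ltr_wpDl.
pose th := l / D; have th0 : 0 < th by rewrite divr_gt0.
have thD : th * D = l by rewrite divfK // gt_eqF.
have [B hB] := ring_bound_nat th0.
pose d : R := expR (- B%:R); have d0 : 0 < d by exact: expR_gt0.
have d1 : d <= 1 by rewrite -(@expR0 R) ler_expR oppr_le0.
exists d => // x x' Hx Hx' xd x'd; rewrite ltNge; apply/negP => he.
pose y := f x; have Hy : H y by exact: (qc_map qc).
have yM : enorm y < M by apply: fM => //; exact: le_trans d1.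
have ln : l <= `|f x' - y|.
  rewrite /l ler_pdivrMr // mulrC; apply: le_trans he _.
  by rewrite enormB; exact: enorm_le_norm.
have [N1 fN1] := finf (n%:R * (D + 1 + `|y|)).
have [z Hz zN] := half_space_far (Num.max N1 (enorm xi + 1)) n0.
have := hB f g qc xi y d D 0 a' B (half_ball xi d) (half_ball_compl xi 1).
rewrite thD ltnn => X; have : false; last by [].
apply: X => //.
- by rewrite add0r /D lerDr.
- by move=> i im; apply/ltW/Hy.
- by rewrite /d -expRD addNr expR0.
- move=> t /andP[t0 ts]; rewrite add0r in ts.
  apply: (@image_shell _ _ f (half_ball xi d) y x x') => //.
  + by move=> u [].
  + exact: pconn_half_ball.
  + by rewrite subrr normr0.
  + exact: lt_le_trans ln.
- move=> t /andP[t1 t2].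
  apply: (@image_shell _ _ f (half_ball_compl xi 1) y p0 z) => //.
  + by move=> u [].
  + exact: pconn_half_ball_compl.
  + by split => //; rewrite dist_add.
  + split => //; have := ler_enormB z xi 0; rewrite !subr0.
    have : enorm xi + 1 <= enorm z by apply: le_trans zN; rewrite le_max lexx orbT.
    lra.
  + apply: le_lt_trans t1; apply: le_trans (norm_le_enorm _) _.
    apply: le_trans (ler_enormB _ 0 _) _; rewrite subr0 sub0r enormN /a'; lra.
  + apply: lt_trans t2 _; apply: enorm_coord_far.
    apply: lt_le_trans (_ : n%:R * (D + 1 + `|y|) <= _).
      by rewrite ltr_pM2l ?ltr0n // /D; lra.
    by apply: fN1 => //; apply: le_trans zN; rewrite le_max lexx.
Qed.

End RingBound.

(** * Boundary extension *)

Section BoundaryValues.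
Variables (R : realType) (n : nat).
Hypothesis n0 : (0 < n)%N.
Notation H := (half_space R n).
Implicit Types (f g : 'rV[R]_n -> 'rV[R]_n) (x y xi l : 'rV[R]_n).

Lemma nbhs_enormP x (A : set 'rV[R]_n) :
  nbhs x A <-> exists2 d, 0 < d & forall y, enorm (y - x) < d -> A y.
Proof.
split=> [/nbhs_ballP[e /= e0 h]|[d d0 h]].
  exists e => // y ye; apply: h; split => // i j; rewrite ord1.
  apply: le_lt_trans ye; rewrite enormB; have := ler_coord_enorm (x - y) j.
  by rewrite !mxE.
have := @continuous_enormP R n 'rV[R]_n id x (@cvg_id _ (nbhs x)) d d0.
exact: filterS.
Qed.

Definition boundary_limit f xi l := forall e, 0 < e -> exists2 d, 0 < d &
  forall x, H x -> enorm (x - xi) < d -> enorm (f x - l) < e.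

Lemma flat_approach xi d : on_hyperplane xi -> 0 < d -> exists2 x, H x & enorm (x - xi) < d.
Proof.
move=> fx d0; exists (xi + (d / 2) *: e_last R n).
  by apply: half_space_add => //; rewrite divr_gt0.
by rewrite dist_add // ?divr_gt0 //; lra.
Qed.

Lemma flat_approach2 xi d d' : on_hyperplane xi -> 0 < d -> 0 < d' ->
  exists x, [/\ H x, enorm (x - xi) < d & enorm (x - xi) < d'].
Proof.
move=> fx d0 d0'; have [|x Hx] := @flat_approach xi (Num.min d d') fx.
  by rewrite lt_min d0.
by rewrite lt_min => /andP[h1 h2]; exists x.
Qed.

Lemma enorm_small x : (forall e, 0 < e -> enorm x < e) -> x = 0.
Proof.
move=> h; apply/eqP; rewrite -enorm_eq0 eq_le enorm_ge0 andbT leNgt; apply/negP => x0.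
by have := h _ x0; rewrite ltxx.
Qed.

Lemma blim_unique f xi l l' : on_hyperplane xi -> boundary_limit f xi l -> boundary_limit f xi l' -> l = l'.
Proof.
move=> fx h h'; apply/eqP; rewrite -subr_eq0; apply/eqP; apply: enorm_small => e e0.
have e2 : 0 < e / 2 by rewrite divr_gt0.
have [d d0 hd] := h _ e2; have [d' d0' hd'] := h' _ e2.
have [x [Hx x1 x2]] := flat_approach2 fx d0 d0'.
apply: le_lt_trans (ler_enormB l (f x) l') _.
by have := hd _ Hx x1; have := hd' _ Hx x2; rewrite (enormB l (f x)); lra.
Qed.

Definition closed_upper : set 'rV[R]_n := [set x | forall i : 'I_n, i = n.-1 :> nat -> 0 <= x ord0 i].

Lemma last_index : exists l : 'I_n, l = n.-1 :> nat.
Proof. by exists (Ordinal (eq_ind_r (fun k => (k <= n)%N) (leqnn n) (prednK n0))). Qed.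

Lemma hclosed_cases x : closed_upper x -> H x \/ on_hyperplane x.
Proof.
move=> cx; have [l le] := last_index.
have := cx l le; rewrite le_eqVlt => /predU1P[e|p].
  right => i ie; have -> : i = l by apply: val_inj; rewrite /= ie le.
  by rewrite -e.
by left => i ie; have -> : i = l by apply: val_inj; rewrite /= ie le.
Qed.

Lemma H_hclosed x : H x -> closed_upper x.
Proof. by move=> h i ie; apply/ltW/h. Qed.

Lemma flat_hclosed x : on_hyperplane x -> closed_upper x.
Proof. by move=> h i ie; rewrite h. Qed.

Lemma flat_notH x : on_hyperplane x -> ~ H x.
Proof. by move=> fx Hx; have := flat_dist_gt0 n0 fx Hx; rewrite subrr enorm0 ltxx. Qed.

Lemma hclosed_limit x : (forall e, 0 < e -> exists2 y, H y & enorm (y - x) < e) -> closed_upper x.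
Proof.
move=> h i ie; rewrite leNgt; apply/negP => xi.
have [|y Hy yx] := h (- x ord0 i); first by rewrite oppr_gt0.
have := ler_coord_enorm (y - x) i; rewrite !mxE; have := Hy i ie => yi.
by rewrite ger0_norm; lra.
Qed.

Lemma blim_exists f xi : on_hyperplane xi ->
  (forall e, 0 < e -> exists2 d, 0 < d &
    forall x x', H x -> H x' -> enorm (x - xi) <= d -> enorm (x' - xi) <= d ->
      enorm (f x - f x') < e) -> exists l, boundary_limit f xi l.
Proof.
move=> fx osc.
pose u (k : nat) := f (xi + k.+1%:R^-1 *: e_last R n).
have k0 (k : nat) : 0 < k.+1%:R^-1 :> R by rewrite invr_gt0 ltr0n.
have near0 (d : R) : 0 < d -> exists N : nat, forall k, (N <= k)%N -> k.+1%:R^-1 <= d.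
  move=> d0; exists (Num.truncn d^-1) => k Nk.
  rewrite invf_ple ?posrE ?ltr0n //; apply: le_trans (ltW (truncnS_gt _)) _.
  by rewrite ler_nat ltnS.
have ucau : cauchy (u k @[k --> \oo]).
  apply/cauchy_ballP => e e0; have [d d0 hd] := osc e e0.
  have [N hN] := near0 d d0.
  exists ([set u k | k in [set k | (N <= k)%N]], [set u k | k in [set k | (N <= k)%N]]).
    by split; exists N => // k /= Nk; exists k.
  move=> [_ _] [/= [k Nk <-] [k' Nk' <-]]; split => // i j; rewrite ord1.
  have : enorm (u k - u k') < e.
    by apply: hd; rewrite ?dist_add ?hN //; apply: half_space_add.
  by apply: le_lt_trans; have := ler_coord_enorm (u k - u k') j; rewrite !mxE.
have cu : cvg (u k @[k --> \oo]) by apply: (cauchy_cvg _ ucau).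
have [l ul] : exists l, u k @[k --> \oo] --> l by exists (lim (u k @[k --> \oo])).
exists l => e e0; have e2 : 0 < e / 2 by rewrite divr_gt0.
have [d d0 hd] := osc _ e2; exists d => // x Hx xd.
have [N hN] := near0 d d0.
have /ul [N' _ hN'] : nbhs l [set z | enorm (z - l) < e / 2] by apply/nbhs_enormP; exists (e / 2).
pose k := maxn N N'.
have h1 : enorm (u k - l) < e / 2 by apply: hN'; rewrite /= leq_maxr.
apply: le_lt_trans (ler_enormB _ (u k) _) _.
have : enorm (f x - u k) < e / 2.
  apply: hd => //; first exact: half_space_add.
    exact: ltW.
  by rewrite dist_add // hN // leq_maxl.
lra.
Qed.

(** Outside the closed half-space every l is vacuously a limit and the value is arbitrary; only
    points of [closed_upper] are ever considered. *)
Definition boundary_ext f x := if `[< H x >] then f x else xget 0 [set l | boundary_limit f x l].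

Lemma extH f x : H x -> boundary_ext f x = f x.
Proof. by move=> Hx; rewrite /boundary_ext asboolT. Qed.

Lemma ext_flat f xi l : on_hyperplane xi -> boundary_limit f xi l -> boundary_ext f xi = l.
Proof.
move=> fx h; rewrite /boundary_ext asboolF; last exact: flat_notH.
by apply: (@blim_unique f xi) => //; apply: (@xgetPex _ 0 [set l | boundary_limit f xi l]); exists l.
Qed.

Section pair.
Variables (f g : 'rV[R]_n -> 'rV[R]_n).
Hypotheses (fH : forall x, H x -> H (f x)) (gH : forall x, H x -> H (g x))
  (fK : forall x, H x -> g (f x) = x) (gK : forall x, H x -> f (g x) = x)
  (fc : forall x, H x -> {for x, continuous f})
  (gc : forall x, H x -> {for x, continuous g}).
Hypothesis blf : forall xi, on_hyperplane xi -> exists l, boundary_limit f xi l.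

(** If l were an interior point, continuity of g at l would give xi = g l, which lies in the open
    half-space. *)
Lemma blim_flat xi l : on_hyperplane xi -> boundary_limit f xi l -> on_hyperplane l.
Proof.
move=> fx h.
have cl : closed_upper l.
  apply: hclosed_limit => e e0; have [d d0 hd] := h e e0.
  by have [x Hx xd] := flat_approach fx d0; exists (f x); [exact: fH|exact: hd].
have [Hl|//] := hclosed_cases cl; exfalso.
apply: (flat_notH fx).
suff -> : xi = g l by exact: gH.
apply/eqP; rewrite -subr_eq0; apply/eqP; apply: enorm_small => e e0.
have e2 : 0 < e / 2 by rewrite divr_gt0.
have /nbhs_enormP[d d0 hd] := @continuous_enormP R n 'rV[R]_n g l (gc Hl) _ e2.
have [d' d0' hd'] := h _ d0.
have [x [Hx x1 x2]] := flat_approach2 fx d0' e2.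
apply: le_lt_trans (ler_enormB _ x _) _.
have := hd _ (hd' _ Hx x1); rewrite /= fK // => h1.
by rewrite enormB; lra.
Qed.

Lemma ext_blim xi : on_hyperplane xi -> boundary_limit f xi (boundary_ext f xi) /\ on_hyperplane (boundary_ext f xi).
Proof.
move=> fx; have [l hl] := blf fx; rewrite (ext_flat fx hl); split => //.
exact: blim_flat hl.
Qed.

Lemma ext_near_flat xi e d : on_hyperplane xi -> 0 < e -> 0 < d ->
  exists x, [/\ H x, enorm (x - xi) < d & enorm (f x - boundary_ext f xi) < e].
Proof.
move=> fx e0 d0; have [h _] := ext_blim fx; have [d' d0' hd'] := h _ e0.
have [x [Hx x1 x2]] := flat_approach2 fx d0 d0'.
by exists x; split => //; exact: hd'.
Qed.

Lemma ext_hclosed x : closed_upper x -> closed_upper (boundary_ext f x).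
Proof.
move=> /hclosed_cases[Hx|fx]; first by rewrite extH //; apply/H_hclosed/fH.
exact/flat_hclosed/(ext_blim fx).2.
Qed.

(** At a boundary point x the limit controls interior points only; a nearby boundary point y is
    replaced by an interior z close to y whose value is close to that of y. *)
Lemma ext_continuous x e : closed_upper x -> 0 < e -> exists2 d, 0 < d &
  forall y, closed_upper y -> enorm (y - x) < d -> enorm (boundary_ext f y - boundary_ext f x) < e.
Proof.
move=> /hclosed_cases[Hx|fx] e0.
  have /nbhs_enormP[d d0 hd] := @continuous_enormP R n 'rV[R]_n f x (fc Hx) _ e0.
  have /nbhs_enormP[d' d0' hd'] : nbhs x H.
    by apply: open_nbhs_nbhs; split => //; exact: half_space_open.
  exists (Num.min d d'); first by rewrite lt_min d0.
  move=> y _; rewrite lt_min => /andP[h1 h2].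
  by rewrite !extH //; [exact: hd|exact: hd'].
have e2 : 0 < e / 2 by rewrite divr_gt0.
have [h _] := ext_blim fx; have [d d0 hd] := h _ e2.
exists d => // y /hclosed_cases[Hy|fy] yd.
  by rewrite [boundary_ext f y]extH //; have := hd _ Hy yd; lra.
have yd' : 0 < d - enorm (y - x) by rewrite subr_gt0.
have [z [Hz z1 z2]] := ext_near_flat fy e2 yd'.
have zx : enorm (z - x) < d by have := ler_enormB z y x; lra.
rewrite enormB in z2.
apply: le_lt_trans (ler_enormB (boundary_ext f y) (f z) (boundary_ext f x)) _.
by rewrite [ltRHS]splitr; apply: ltrD => //; exact: hd.
Qed.

Lemma ext_infty M : tends_to_infty H f ->
  exists N, forall x, closed_upper x -> N <= enorm x -> M <= enorm (boundary_ext f x).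
Proof.
move=> finf; have [N hN] := finf (M + 1); exists (N + 1) => x /hclosed_cases[Hx|fx] Nx.
  by rewrite extH //; have := hN x Hx; lra.
have [z [Hz z1 z2]] := ext_near_flat fx ltr01 ltr01.
have := ler_enormB x z 0; have := ler_enormB (f z) (boundary_ext f x) 0.
rewrite !subr0 (enormB x z) => h1 h2.
have := hN z Hz; lra.
Qed.

Lemma ext_cancel x : (forall xi, on_hyperplane xi -> exists l, boundary_limit g xi l) ->
  closed_upper x -> boundary_ext g (boundary_ext f x) = x.
Proof.
move=> blg /hclosed_cases[Hx|fx].
  by rewrite (extH f Hx) extH ?fK //; exact: fH.
have [h fl] := ext_blim fx; have [l hl] := blg _ fl.
rewrite (ext_flat fl hl); apply/eqP; rewrite -subr_eq0; apply/eqP; apply: enorm_small => e e0.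
have e2 : 0 < e / 2 by rewrite divr_gt0.
have [d d0 hd] := hl _ e2.
have [z [Hz z1 z2]] := ext_near_flat fx d0 e2.
have := hd _ (fH Hz) z2; rewrite fK // => h1.
by apply: le_lt_trans (ler_enormB _ z _) _; rewrite (enormB l z); lra.
Qed.

End pair.

Notation opc := (one_point_compactification 'rV[R]_n).

Lemma closed_half_spaceE : closed_half_space R n = [set p | if p is Some x then closed_upper x else True].
Proof.
apply/seteqP; split => -[x|] //.
- move=> h; apply: hclosed_limit => e e0.
  have /h [_ [[y Hy <-] /= yx]] : nbhs (Some x : opc) (Some @` [set y | enorm (y - x) < e]).
    by apply: one_point_compactification_some_nbhs; apply/nbhs_enormP; exists e.
  by case: yx => z zx [zy]; exists y => //; rewrite -zy.
- move=> /= cx U hU; have /nbhs_enormP[d d0 hd] : nbhs x (fun z => U (Some z)) := hU.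
  have [Hx|fx] := hclosed_cases cx.
    by exists (Some x); split; [exists x|apply: hd; rewrite subrr enorm0].
  have [y Hy yd] := flat_approach fx d0.
  by exists (Some y); split; [exists y|exact: hd].
(* Infinity belongs to the closure because a compact set is bounded and the half-space is not. *)
- move=> _ U [C [Cc _] hC].
  have [M [_ hM]] := compact_bounded Cc.
  have [z Hz zM] := @half_space_far R n (n%:R * (M + 2)) n0.
  exists (Some z); split; first by exists z.
  apply: hC; left; exists z => // Cz.
  have := hM (M + 1) (ltr_pwDr ltr01 (lexx M)) z Cz => h1.
  have nR : 0 < n%:R :> R by rewrite ltr0n.
  have : n%:R * (M + 2) <= n%:R * `|z| by apply: le_trans zM (enorm_le_norm z).
  by rewrite ler_pM2l //; move: h1 => /=; lra.
Qed.

Definition opc_ext (F : 'rV[R]_n -> 'rV[R]_n) (p : opc) : opc :=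
  if p is Some x then Some (F x) else None.

Lemma compact_enorm_ball N : compact [set x : 'rV[R]_n | enorm x <= N].
Proof.
case: n n0 => // k _; apply: bounded_closed_compact.
  exists (Num.max N 0); split; first exact: num_real.
  move=> M NM x /= xN; apply: le_trans (norm_le_enorm x) _.
  by apply: le_trans xN _; apply: ltW; apply: le_lt_trans NM; rewrite le_max lexx.
rewrite (_ : mkset _ = (@enorm R k.+1) @^-1` [set t | t <= N]) //.
by apply: closed_comp => [x _|]; [exact: continuous_enorm|exact: closed_le].
Qed.

Lemma closed_enorm_ball N : closed [set x : 'rV[R]_n | enorm x <= N].
Proof.
rewrite (_ : mkset _ = (@enorm R n) @^-1` [set t | t <= N]) //.
by apply: closed_comp => [x _|]; [exact: continuous_enorm|exact: closed_le].
Qed.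

Lemma opc_ext_continuous (F : 'rV[R]_n -> 'rV[R]_n) :
  (forall x e, closed_upper x -> 0 < e -> exists2 d, 0 < d &
     forall y, closed_upper y -> enorm (y - x) < d -> enorm (F y - F x) < e) ->
  (forall M, exists N, forall x, closed_upper x -> N <= enorm x -> M <= enorm (F x)) ->
  {within closed_half_space R n, continuous (opc_ext F)}.
Proof.
move=> Fc Finf; apply/subspace_continuousP; rewrite closed_half_spaceE => -[x|] /= cx.
- move=> U /=; rewrite nbhs_simpl /= => /nbhs_enormP[e e0 he].
  have [d d0 hd] := Fc x e cx e0.
  rewrite /= /within /= nbhs_simpl /=; apply/nbhs_enormP; exists d => // y yd cy.
  exact/he/hd.
move=> U [C [Cc _] hC].
have [M [_ hM]] := compact_bounded Cc.
have [N hN] := Finf (n%:R * (M + 2)).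
exists [set x | enorm x <= N]; first by split; [exact: compact_enorm_ball|exact: closed_enorm_ball].
move=> p [[z /= /negP]|/= ->]; last by move=> _; apply: hC; right.
rewrite -ltNge => Nz <- /= cz; apply: hC; left; exists (F z) => // CF.
have := hM (M + 1) (ltr_pwDr ltr01 (lexx M)) (F z) CF => h1.
have nR : 0 < n%:R :> R by rewrite ltr0n.
have : n%:R * (M + 2) <= n%:R * `|F z| by apply: le_trans (hN z cz (ltW Nz)) (enorm_le_norm _).
by rewrite ler_pM2l //; move: h1 => /=; lra.
Qed.

Lemma boundary_flat xi : boundary H xi -> on_hyperplane xi.
Proof.
move=> [cl ni].
have : closed_upper xi.
  apply: hclosed_limit => e e0.
  have /cl [y [Hy yx]] : nbhs xi [set y | enorm (y - xi) < e] by apply/nbhs_enormP; exists e.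
  by exists y.
move=> /hclosed_cases[Hx|//]; exfalso; apply: ni.
by apply: open_nbhs_nbhs; split => //; exact: half_space_open.
Qed.

(** The estimate concerns an arbitrary extension [ft], not the constructed one; continuity within
    the closed half-space forces its value at xi to be the boundary limit. Infinity is excluded
    since f stays within |l| + 1 near xi. *)
Lemma homeomorphic_extension_blim f ft xi : on_hyperplane xi -> (exists l, boundary_limit f xi l) ->
  homeomorphic_extension f ft -> exists2 y, ft (Some xi) = Some y & boundary_limit f xi y.
Proof.
move=> fx [l hl] [[_ /subspace_continuousP fc _] fE].
have cx : closed_half_space R n (Some xi) by rewrite closed_half_spaceE; exact: flat_hclosed.
have h (U : set opc) : nbhs (ft (Some xi)) U -> nbhs xi (fun x => closed_half_space R n (Some x) -> U (ft (Some x))) := fc _ cx U.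
case Eft : (ft (Some xi)) h => [y|] h.
  exists y => // e e0.
  have hU : nbhs (Some y : opc) (Some @` [set z | enorm (z - y) < e]).
    by apply: one_point_compactification_some_nbhs; apply/nbhs_enormP; exists e.
  have /nbhs_enormP[d d0 hd] : nbhs xi (fun x => closed_half_space R n (Some x) ->
      (Some @` [set z | enorm (z - y) < e]) (ft (Some x))) := h _ hU.
  exists d => // x Hx xd.
  have [|z zy] := hd x xd; first by rewrite closed_half_spaceE; exact: H_hclosed.
  by rewrite fE // => -[<-].
exfalso.
have hU : nbhs (None : opc) ((Some @` (~` [set z | enorm z <= enorm l + 1])) `|` [set None]).
  exists [set z | enorm z <= enorm l + 1] => //.
  by split; [exact: compact_enorm_ball|exact: closed_enorm_ball].
have /nbhs_enormP[d d0 hd] : nbhs xi (fun x => closed_half_space R n (Some x) ->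
   ((Some @` (~` [set z | enorm z <= enorm l + 1])) `|` [set None]) (ft (Some x))) := h _ hU.
have [d' d0' hd'] := hl _ ltr01.
have [x [Hx x1 x2]] := flat_approach2 fx d0 d0'.
have := hd x x1; rewrite fE // => /(_ _)[||//].
  by rewrite closed_half_spaceE; exact: H_hclosed.
move=> [z /= zl [zf]]; apply: zl; rewrite zf.
by have := hd' _ Hx x2; have := ler_enormB (f x) l 0; rewrite !subr0; lra.
Qed.

End BoundaryValues.

(** * Quasisymmetry and the Hoelder estimate *)

Section Hoelder.
Variables (R : realType) (m : nat) (K : R).
Hypotheses (m0 : (0 < m)%N) (K1 : 1 <= K).
Let n := m.+1.
Notation H := (half_space R n).
Implicit Types (f g : 'rV[R]_n -> 'rV[R]_n) (x y xi l : 'rV[R]_n).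

Let n0 : (0 < n)%N. Proof. by []. Qed.

Lemma qc_blim f g : qcpair K f g -> tends_to_infty H f ->
  forall xi, on_hyperplane xi -> exists l, boundary_limit f xi l.
Proof. by move=> qc finf xi fx; apply: blim_exists => // e; exact: (boundary_osc m0 K1 qc finf). Qed.

Lemma qc_blim_flat f g : qcpair K f g ->
  forall xi l, on_hyperplane xi -> boundary_limit f xi l -> on_hyperplane l.
Proof.
move=> qc xi l; apply: (@blim_flat R n n0 f g).
- exact: qc_map qc.
- exact: qc_gmap qc.
- exact: qc_fK qc.
- exact: qc_gcont qc.
Qed.

Lemma homeomorphic_extension_exists f g : qcpair K f g -> tends_to_infty H f ->
  exists ft, homeomorphic_extension f ft.
Proof.
move=> qc finf; have ginf := tends_inv m0 K1 qc finf.
have qc' := qcpair_sym qc.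
have blf := qc_blim qc finf; have blg := qc_blim qc' ginf.
have [fH gH fK gK fc gc _ _] := qc.
have cf : {within closed_half_space R n, continuous (opc_ext (boundary_ext f))}.
  apply: opc_ext_continuous => // [x e|M]; first exact: (ext_continuous n0 fH gH fK fc gc blf).
  exact: (ext_infty n0 fH gH fK gc blf).
have cg : {within closed_half_space R n, continuous (opc_ext (boundary_ext g))}.
  apply: opc_ext_continuous => // [x e|M]; first exact: (ext_continuous n0 gH fH gK gc fc blg).
  exact: (ext_infty n0 gH fH gK fc blg).
have mf p : closed_half_space R n p -> closed_half_space R n (opc_ext (boundary_ext f) p).
  by rewrite closed_half_spaceE //; case: p => [x|] //=; exact: (ext_hclosed n0 fH gH fK gc blf).
have mg p : closed_half_space R n p -> closed_half_space R n (opc_ext (boundary_ext g) p).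
  by rewrite closed_half_spaceE //; case: p => [x|] //=; exact: (ext_hclosed n0 gH fH gK fc blg).
have fgK p : closed_half_space R n p -> opc_ext (boundary_ext g) (opc_ext (boundary_ext f) p) = p.
  rewrite closed_half_spaceE //; case: p => [x|] //= cx.
  by rewrite (ext_cancel n0 fH gH fK gc blf blg cx).
have gfK p : closed_half_space R n p -> opc_ext (boundary_ext f) (opc_ext (boundary_ext g) p) = p.
  rewrite closed_half_spaceE //; case: p => [x|] //= cx.
  by rewrite (ext_cancel n0 gH fH gK fc blg blf cx).
exists (opc_ext (boundary_ext f)); split; last by move=> x Hx; rewrite /= extH.
split => //; last by exists (opc_ext (boundary_ext g)).
split => //.
  move=> p q; rewrite !inE => cp cq e.
  by rewrite -(fgK p cp) e fgK.
move=> p cp; exists (opc_ext (boundary_ext g) p); [exact: mg|exact: gfK].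
Qed.

(** Suppose |f x2 - y| >= exp(B) l with l = |f x1 - y|, and apply the ring bound to g and the
    half-annulus about y between these radii. The preimage of its inside contains x1 and points
    tending to xi, that of its outside contains x2 and distant points, so both meet spheres about xi
    at scale r = |x1 - xi|. Scale invariance makes the constant independent of f, xi and y. *)
Lemma quasisymmetry : exists2 C : R, 1 <= C &
  forall f g, qcpair K f g -> tends_to_infty H f ->
  forall xi y, on_hyperplane xi -> boundary_limit f xi y -> forall x1 x2, H x1 -> H x2 ->
  enorm (x2 - xi) <= enorm (x1 - xi) -> enorm (f x2 - y) < C * enorm (f x1 - y).
Proof.
have nR : 0 < n%:R :> R by rewrite ltr0n.
(* The sup-distance from xi to x1 is only known to be at least r/n, which is th times the scale D =
   2r. *)
pose th : R := (2 * n%:R)^-1; have th0 : 0 < th by rewrite invr_gt0 mulr_gt0.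
have [B hB] := ring_bound_nat m0 K1 th0.
exists (expR B%:R); first by rewrite -(@expR0 R) ler_expR.
move=> f g qc finf xi y fx hy x1 x2 Hx1 Hx2 x21; rewrite ltNge; apply/negP => hL.
have fy := qc_blim_flat qc fx hy.
have [fH gH fK gK fc gc _ _] := qc.
set l := enorm (f x1 - y) in hL.
have l0 : 0 < l by apply: flat_dist_gt0 => //; exact: fH.
set r := enorm (x1 - xi) in x21.
have r0 : 0 < r by exact: flat_dist_gt0.
have D0 : 0 < 2 * r by rewrite mulr_gt0.
have thD : th * (2 * r) = r / n%:R.
  by rewrite /th invfM; field; rewrite gt_eqF.
have rn : r / n%:R <= r by rewrite ler_pdivrMr // ler_peMr ?(ltW r0) // ler1n.
have X := hB g f (qcpair_sym qc) y xi l (2 * r) 0 r B (half_ball y l) (half_ball_compl y (l * expR B%:R)) fy l0 D0.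
rewrite thD ltnn in X; have : false; last by [].
apply: X => //.
- lra.
- exact: ltW.
- lra.
- by move=> i im; rewrite (fx i im).
- move=> t /andP[t0 tr]; rewrite add0r in tr.
  have [d d0 hd] := hy _ l0.
  have [x [Hx xd xt]] := flat_approach2 n0 fx d0 t0.
  apply: (@image_shell _ _ g (half_ball y l) xi (f x) (f x1)) => //.
  + by move=> u [].
  + exact: pconn_half_ball.
  + by split; [exact: fH|apply/ltW/hd].
  + by split; [exact: fH|].
  + by rewrite fK //; apply: le_lt_trans xt; exact: norm_le_enorm.
  + rewrite fK //; apply: lt_le_trans tr _; rewrite ler_pdivrMr // mulrC.
    exact: enorm_le_norm.
- move=> t /andP[t1 t2].
  have [N1 fN1] := finf (enorm y + l * expR B%:R).
  have [z Hz zN] := half_space_far (Num.max N1 (n%:R * (t + `|xi| + 1))) n0.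
  apply: (@image_shell _ _ g (half_ball_compl y (l * expR B%:R)) xi (f x2) (f z)) => //.
  + by move=> u [].
  + by apply: pconn_half_ball_compl => //; rewrite mulr_ge0 ?(ltW l0) // ltW // expR_gt0.
  + by split; [exact: fH|rewrite mulrC].
  + split; first exact: fH.
    have : enorm y + l * expR B%:R <= enorm (f z).
      by apply: fN1 => //; apply: le_trans zN; rewrite le_max lexx.
    by have := ler_enormB (f z) y 0; rewrite !subr0; lra.
  + by rewrite fK //; apply: le_lt_trans t1; apply: le_trans (norm_le_enorm _) x21.
  + rewrite fK //; apply: enorm_coord_far.
    apply: lt_le_trans (_ : n%:R * (t + `|xi| + 1) <= _).
      by rewrite ltr_pM2l // ltrDl.
    by apply: le_trans zN; rewrite le_max lexx orbT.
Qed.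

(** Here the normalisation f(e_n) = e_n enters. If y were far away, the preimage of the far
    half-ball complement would contain points near xi, within r + 2 of e_n, and distant ones; the
    preimage of the half-ball of radius 2 contains e_n itself and points near the boundary
    hyperplane. Sup-norm radii about e_n in ]0, 1[ and ]r + 2, r + 3[ are thus met. *)
Lemma normalization (r : R) : 0 < r -> exists2 C : R, 1 <= C &
  forall f g, qcpair K f g -> tends_to_infty H f -> f (e_last R n) = e_last R n ->
  forall xi y, on_hyperplane xi -> enorm xi <= r -> boundary_limit f xi y -> enorm (e_last R n - y) <= C.
Proof.
move=> r0; have nR : 0 < n%:R :> R by rewrite ltr0n.
pose th : R := (r + 3)^-1; have th0 : 0 < th by rewrite invr_gt0; lra.
have [B hB] := ring_bound_nat m0 K1 th0.
have eB : 0 < expR B%:R :> R by exact: expR_gt0.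
exists (1 + 2 * expR B%:R); first by lra.
move=> f g qc finf fe xi y fx xr hy; rewrite leNgt; apply/negP => hT.
have ginf := tends_inv m0 K1 qc finf.
have [fH gH fK gK fc gc _ _] := qc.
have He : H (e_last R n) by exact: half_space_e_last.
have ge : g (e_last R n) = e_last R n by rewrite -{1}fe fK.
have e1 := @enorm_e_last R n n0.
set T := 2 * expR B%:R in hT.
have T0 : 0 < T by rewrite mulr_gt0.
have yT : T < enorm y.
  by have := ler_enormB (e_last R n) 0 y; rewrite subr0 sub0r enormN e1; lra.
have D0 : 0 < r + 3 by lra.
have thD : th * (r + 3) = 1 by rewrite mulVf // gt_eqF.
have X := hB g f (qcpair_sym qc) 0 (e_last R n) 2 (r + 3) 0 (r + 2) B (half_ball 0 2) (half_ball_compl 0 T).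
rewrite thD ltnn in X; have : false; last by [].
apply: X => //.
- exact: on_hyperplane0.
- lra.
- lra.
- lra.
- by move=> i im; apply/ltW/He.
- move=> t /andP[t0 t1]; rewrite add0r in t1.
  (* The boundary limit of g at 0 lies on the hyperplane, so some g w has last coordinate below 1 -
     t and is at sup-distance more than t from e_n. *)
  have [et het] := qc_blim (qcpair_sym qc) ginf (@on_hyperplane0 R n).
  have fet := qc_blim_flat (qcpair_sym qc) (@on_hyperplane0 R n) het.
  have t1' : 0 < 1 - t by lra.
  have [d d0 hd] := het _ t1'.
  have [w [Hw wd w2]] := flat_approach2 n0 (@on_hyperplane0 R n) d0 (ltr0Sn R 1).
  apply: (@image_shell _ _ g (half_ball 0 2) (e_last R n) (e_last R n) w) => //.
  + by move=> u [].
  + exact: pconn_half_ball.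
  + by split => //; rewrite subr0 e1; lra.
  + by split => //; exact: ltW.
  + by rewrite ge subrr normr0.
  + have [i im gi] := half_space_last n0 (gH _ Hw).
    have := ler_coord_enorm (g w - et) i; rewrite !mxE (fet i im) subr0 => h1.
    have h2 := hd _ Hw wd.
    apply: lt_le_trans (ler_coord_norm _ i); rewrite !mxE im eqxx /=.
    rewrite ger0_norm ?(ltW gi) // in h1.
    rewrite ltr0_norm; lra.
- move=> t /andP[t1 t2].
  have yT' : 0 < enorm y - T by rewrite subr_gt0.
  have [d d0 hd] := hy _ yT'.
  have [x [Hx xd x1]] := flat_approach2 n0 fx d0 ltr01.
  have [N1 fN1] := finf T.
  have [z Hz zN] := half_space_far (Num.max N1 (n%:R * (t + `|e_last R n| + 1))) n0.
  apply: (@image_shell _ _ g (half_ball_compl 0 T) (e_last R n) (f x) (f z)) => //.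
  + by move=> u [].
  + by apply: pconn_half_ball_compl; rewrite ?(ltW T0) //; exact: on_hyperplane0.
  + split; first exact: fH.
    have := hd _ Hx xd; have := ler_enormB y (f x) 0; rewrite !subr0 (enormB y (f x)); lra.
  + split; first exact: fH.
    by rewrite subr0; apply: fN1 => //; apply: le_trans zN; rewrite le_max lexx.
  + rewrite fK //; apply: le_lt_trans t1; apply: le_trans (norm_le_enorm _) _.
    have := ler_enormB x xi (e_last R n); have := ler_enormB xi 0 (e_last R n).
    by rewrite subr0 sub0r enormN e1; lra.
  + rewrite fK //; apply: enorm_coord_far.
    apply: lt_le_trans (_ : n%:R * (t + `|e_last R n| + 1) <= _).
      by rewrite ltr_pM2l // ltrDl.
    by apply: le_trans zN; rewrite le_max lexx orbT.
Qed.

Let alpha : R := 1 / K `^ (1 / m%:R).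

Let K0 : 0 < K. Proof. exact: lt_le_trans K1. Qed.

Let alpha_gt0 : 0 < alpha.
Proof. by rewrite divr_gt0 // powR_gt0. Qed.

Let alpha_le1 : alpha <= 1.
Proof.
rewrite /alpha div1r invf_le1 ?powR_gt0 //.
have : K `^ 0 <= K `^ (1 / m%:R) by apply: ler_powR => //; rewrite divr_ge0.
by rewrite powRr0.
Qed.

Let alphaX : alpha ^+ m = K^-1.
Proof.
rewrite /alpha div1r exprVn -powR_mulrn ?powR_ge0 // -powRrM div1r mulVf ?pnatr_eq0 -?lt0n //.
by rewrite powRr1 // ltW.
Qed.

(** The constant c0 cancels from the two annulus bounds, leaving (N'+1)^(1-n) <= K N^(1-n); since
    alpha^(n-1) = 1/K, an (n-1)-st root makes this linear in the widths. Here the sharp exponent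
    arises. *)
Lemma shell_width f g xi y (s t : R) N N' (E F : set 'rV[R]_n) : qcpair K f g ->
  on_hyperplane xi -> on_hyperplane y -> 0 < s -> 0 < t -> (0 < N)%N -> (0 < N')%N ->
  E `<=` half_ball xi s -> F `<=` half_ball_compl xi (s * expR N%:R) ->
  half_ball y (t * expR 1) `<=` f @` E -> half_ball_compl y (t * expR N'%:R) `<=` f @` F ->
  alpha * N%:R <= N'%:R + 1.
Proof.
move=> qc fx fy s0 t0 N0 N'0 EB FB EB' FB'.
have EH : E `<=` H by move=> x /EB [].
have FH : F `<=` H by move=> x /FB [].
have h3 : (modulus (joining_curves E F) <= (N%:R^-1 ^+ n * N%:R)%:E * unit_shell_mass R n)%E.
  by apply: (@modulus_le_shell _ _ _ _ xi s) => // x; [move/EB => []|move/FB => []].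
have h4 : ((N'.+1%:R^-1 ^+ n * N'.+1%:R)%:E * unit_shell_mass R n <= modulus (joining_curves (f @` E) (f @` F)))%E.
  by apply: (@modulus_ge_shell _ _ _ _ y t) => // x Hx hx; [exact: EB'|exact: FB'].
have K0' : (0 <= K%:E)%E by rewrite lee_fin ltW.
have := le_trans h4 (le_trans (qc_mod qc EH FH) (lee_wpmul2l K0' h3)).
have c0f : unit_shell_mass R n \is a fin_num by rewrite ge0_fin_numE ?unit_shell_mass_ge0 ?unit_shell_mass_fin.
have c0p : 0 < fine (unit_shell_mass R n) by rewrite -lte_fin fineK //; exact: unit_shell_mass_gt0.
rewrite -(fineK c0f) -!EFinM lee_fin mulrA ler_pM2r // => h5.
have NR : 0 < N%:R :> R by rewrite ltr0n.
have NR' : 0 < N'.+1%:R :> R by rewrite ltr0n.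
have simp (k : nat) : 0 < k%:R :> R -> k%:R^-1 ^+ n * k%:R = k%:R ^- m :> R.
  by move=> k0; rewrite /n exprS mulrAC mulVf ?gt_eqF // mul1r exprVn.
rewrite !simp // in h5.
rewrite natr1 -(@ler_pXn2r _ m) ?nnegrE ?(ltW NR') ?mulr_ge0 ?(ltW NR) ?(ltW alpha_gt0) //.
rewrite exprMn alphaX.
have A0 : 0 < N%:R ^+ m :> R by rewrite exprn_gt0.
have B0 : 0 < N'.+1%:R ^+ m :> R by rewrite exprn_gt0.
move: (N%:R ^+ m) (N'.+1%:R ^+ m) A0 B0 h5 => A B A0 B0 h5.
rewrite ler_pdivrMl //; have := ler_wpM2l (ltW (mulr_gt0 A0 B0)) h5.
have -> : A * B * B^-1 = A by field; rewrite gt_eqF.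
  by have -> : A * B * (K / A) = K * B by field; rewrite gt_eqF.
by rewrite invr_ge0 powR_ge0.
Qed.

Lemma hoelder_boundary (r : R) : 0 < r -> exists2 C : R, 0 < C &
  forall f g, qcpair K f g -> tends_to_infty H f -> f (e_last R n) = e_last R n ->
  forall xi y x, on_hyperplane xi -> enorm xi <= r -> boundary_limit f xi y -> H x -> enorm (x - xi) <= 1 ->
  enorm (f x - y) <= C * enorm (x - xi) `^ alpha.
Proof.
move=> r0; have [C1 C11 qs] := quasisymmetry; have [C2 C21 nor] := normalization r0.
(* [Q] is chosen so that C1 C2 / t = Q / l for the inner radius t = l / (2 e C1) below. *)
pose Q := 2 * expR 1 * C1 ^+ 2 * C2.
have e10 : 0 < expR 1 :> R by exact: expR_gt0.
have e11 : 1 <= expR 1 :> R by rewrite -(@expR0 R) ler_expR.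
have C10 : 0 < C1 by lra.
have C20 : 0 < C2 by lra.
have C12 : 1 <= C1 * C2 by rewrite mulr_ege1.
have Q0 : 0 < Q by rewrite !mulr_gt0 // exprn_gt0.
have QC : C1 * C2 <= Q.
  have -> : Q = (C1 * C2) * (2 * expR 1 * C1) by rewrite /Q expr2; ring.
  by rewrite ler_peMr ?(le_trans _ C12) // mulr_ege1 // mulr_ege1 //; lra.
(* The factor exp 3 collects three losses of one: rounding -ln d down to N (with alpha <= 1),
   rounding ln(Q/l) up to N', and the +1 in [shell_width]. *)
exists (Q * expR 3); first by rewrite mulr_gt0 // expR_gt0.
move=> f g qc finf fe xi y x fx xr hy Hx x1.
have fy := qc_blim_flat qc fx hy.
have [fH gH fK gK fc gc _ _] := qc.
have He : H (e_last R n) by exact: half_space_e_last.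
have d0 : 0 < enorm (x - xi) by exact: flat_dist_gt0.
set d := enorm (x - xi) in x1 d0 *.
have l0 : 0 < enorm (f x - y) by apply: flat_dist_gt0 => //; exact: fH.
set l := enorm (f x - y) in l0 *.
have exi : 1 <= enorm (e_last R n - xi).
  have [i im _] := half_space_last n0 He.
  apply: le_trans (ler_coord_enorm _ i); rewrite !mxE im eqxx (fx i im) subr0.
  by rewrite normr1.
(* A point within 1 of xi is no farther from xi than e_n, so quasisymmetry compares it with the
   fixed point e_n, whose distance to y is at most C2. *)
have bnd z : H z -> enorm (z - xi) <= 1 -> enorm (f z - y) < C1 * C2.
  move=> Hz z1; apply: lt_le_trans (qs f g qc finf xi y fx hy _ z He Hz (le_trans z1 exi)) _.
  by rewrite fe ler_wpM2l ?(ltW C10) //; exact: nor qc finf fe _ _ fx xr hy.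
have lC : l < C1 * C2 by exact: bnd.
suff key : alpha * - ln d <= ln (Q / l) + 3.
  rewrite -[l]lnK ?posrE // -[Q]lnK ?posrE // /powR (gt_eqF d0) -!expRD ler_expR.
  move: key; rewrite lnM ?posrE ?invr_gt0 // lnV ?posrE //; lra.
have lnQl : 0 <= ln (Q / l).
  by rewrite ln_ge0 // ler_pdivlMr // mul1r; apply: le_trans QC; exact: ltW.
have lnd : 0 <= - ln d by rewrite oppr_ge0 ln_le0.
pose N := Num.truncn (- ln d).
have NE : N%:R <= - ln d < N.+1%:R by exact: truncn_itv.
have [Nle Nlt] := andP NE.
have aln : alpha * - ln d <= alpha * N%:R + 1.
  have : alpha * - ln d <= alpha * N.+1%:R by rewrite ler_wpM2l ?(ltW alpha_gt0) // ltW.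
  by rewrite -natr1 mulrDr mulr1; have := alpha_le1; lra.
have [N_eq0|N0] := posnP N.
  by move: aln; rewrite N_eq0 mulr0; lra.
pose t := l / (2 * expR 1 * C1).
have t0 : 0 < t by rewrite divr_gt0 // !mulr_gt0.
have Qt : C1 * C2 / t = Q / l.
  by rewrite /t /Q; field; rewrite !gt_eqF.
pose N' := (Num.truncn (ln (Q / l))).+1.
have N'lt : ln (Q / l) < N'%:R by exact: truncnS_gt.
have N'le : N'%:R <= ln (Q / l) + 1.
  by rewrite -natr1 lerD2r truncn_le.
suff : alpha * N%:R <= N'%:R + 1 by lra.
apply: (@shell_width f g xi y (expR (- N%:R)) t N N' (half_ball xi (expR (- N%:R))) (half_ball_compl xi 1)) => //.
- by rewrite -expRD addNr expR0; exact: subset_refl.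
(* A point w within t e = l / (2 C1) of y has g w within d of xi: otherwise quasisymmetry would give
   l < C1 |w - y| <= l / 2. Moreover d <= exp(-N). *)
- move=> w [Hw wt]; exists (g w); last exact: gK.
  split; first exact: gH.
  apply: (@le_trans _ _ d); last by rewrite -[d]lnK ?posrE // ler_expR; lra.
  rewrite leNgt; apply/negP => dg.
  have := qs f g qc finf xi y fx hy _ x (gH _ Hw) Hx (ltW dg); rewrite gK // -/l.
  rewrite ltNge => /negP; apply.
  apply: (@le_trans _ _ (C1 * (t * expR 1))); first by rewrite ler_wpM2l // ltW.
  have -> : C1 * (t * expR 1) = l / 2 by rewrite /t; field; rewrite !gt_eqF.
  lra.
(* If g w were within 1 of xi, then |w - y| < C1 C2; but t exp N' >= C1 C2 by the choice of N'. *)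
move=> w [Hw wt]; exists (g w); last exact: gK.
split; first exact: gH.
rewrite leNgt; apply/negP => g1.
have := bnd _ (gH _ Hw) (ltW g1); rewrite gK // ltNge => /negP; apply.
apply: le_trans wt; rewrite -ler_pdivrMl // mulrC Qt -[leLHS]lnK ?posrE ?divr_gt0 //.
by rewrite ler_expR ltW.
Qed.

End Hoelder.

(** The constant is chosen before f and [ft], which expresses that it depends on r, K and n alone;
    the conclusion includes that [ft] is finite at boundary points. *)
Theorem theorem5p9 (R : realType) (n : nat) (K : R) (hn : (2 <= n)%N)
    (hK : 1 <= K) :
  (forall f : 'rV[R]_n -> 'rV[R]_n,
     quasiconformal K (half_space R n) (half_space R n) f ->
     f (e_last R n) = e_last R n ->
     tends_to_infty (half_space R n) f ->
     exists ft, homeomorphic_extension f ft) /\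
  (forall r : R, 0 < r ->
     exists C : R, 0 < C /\
       forall f ft,
         quasiconformal K (half_space R n) (half_space R n) f ->
         f (e_last R n) = e_last R n ->
         tends_to_infty (half_space R n) f ->
         homeomorphic_extension f ft ->
         forall xi x : 'rV[R]_n,
           boundary (half_space R n) xi -> enorm xi <= r ->
           half_space R n x -> enorm (x - xi) <= 1 ->
           exists2 y : 'rV[R]_n, ft (Some xi) = Some y &
             enorm (f x - y) <=
               C * enorm (x - xi) `^ (1 / K `^ (1 / n.-1%:R))).
Proof.
have K0 : 0 < K by exact: lt_le_trans hK.
case: n hn => // m m0; split=> [f qcf fe finf|r r0].
  have [g qc] := qcpair_of_quasiconformal K0 qcf.
  exact: (homeomorphic_extension_exists m0 hK qc finf).
have [C C0 hC] := hoelder_boundary m0 hK r0; exists C; split => //.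
move=> f ft qcf fe finf hft xi x bxi xir Hx xxi.
have [g qc] := qcpair_of_quasiconformal K0 qcf.
have fx := boundary_flat (ltn0Sn m) bxi.
have [y fty hy] := homeomorphic_extension_blim (ltn0Sn m) fx (qc_blim m0 hK qc finf fx) hft.
by exists y => //; exact: (hC f g qc finf fe xi y x fx xir hy Hx xxi).
Qed.
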